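(* Let $p$ be a prime and let $G$ be a cyclic $p$-group. There is a $G$-symmetric monoidal structure on the category $\mathcal{M}ack_G$ of $G$-Mackey functors such that a $G$-Mackey functor is a $G$-commutative monoid if and only if it has the structure of a $G$-Tambara functor.
   Context: $\mathcal{M}ack_G$ is regarded as a symmetric monoidal category under the box product $\Box$, with unit the Burnside Mackey functor. **$G$-symmetric monoidal structure.** Let $\mathscr{S}et_G^{Fin}$ be the category of finite $G$-sets, $\mathscr{S}et_G^{Fin,Iso}$ the category of finite $G$-sets and isomorphisms, and $\mathscr{S}et^{Fin,Iso}$ the category of finite sets and bijections (finite sets viewed as trivial $G$-sets). Let $(\mathscr C,\boxtimes,e)$ be a symmetric monoidal category. A $G$-symmetric monoidal structure on $\mathscr C$ is a functor $(-)\otimes(-)\colon\mathscr{S}et_G^{Fin,Iso}\times\mathscr C\to\mathscr C$ such that: (1) $(X\amalg Y)\otimes C$ is naturally isomorphic to $(X\otimes C)\boxtimes(Y\otimes C)$ and $X\otimes(C\boxtimes D)$ is naturally isomorphic to $(X\otimes C)\boxtimes(X\otimes D)$; (2) restricted to $\mathscr{S}et^{Fin,Iso}\times\mathscr C$ it is the canonical exponentiation $X\otimes C=C^{\boxtimes|X|}$; (3) $X\otimes(Y\otimes C)$ is naturally isomorphic to $(X\times Y)\otimes C$. **$G$-commutative monoid.** An object $C$ of $\mathscr C$ together with an extension of the functor $(-)\otimes C\colon\mathscr{S}et_G^{Fin,Iso}\to\mathscr C$ along the inclusion $\mathscr{S}et_G^{Fin,Iso}\to\mathscr{S}et_G^{Fin}$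 to a functor $\mathscr{S}et_G^{Fin}\to\mathscr C$. **Tambara functor.** For $f\colon X\to Y$ and $p\colon A\to X$ in $\mathscr{S}et_G^{Fin}$, the dependent product is $\prod_fA=\{(y,\sigma): y\in Y,\ \sigma\colon f^{-1}(y)\to A \text{ a map of sets},\ p\sigma(x)=x \text{ for all } x\in f^{-1}(y)\}$ with $g(y,\sigma)=(gy,g\sigma)$, $(g\sigma)(x)=g\sigma(g^{-1}x)$. The canonical exponential diagram generated by $f,p$ consists of $X\xleftarrow{p}A\xleftarrow{e}X\times_Y\prod_fA\xrightarrow{f'}\prod_fA\xrightarrow{h}Y\xleftarrow{f}X$, with $h(y,\sigma)=y$, $e(x,(y,\sigma))=\sigma(x)$ and $f'$ the pullback of $f$ along $h$; an exponential diagram is a diagram isomorphic to a canonical one. A $G$-Tambara functor $\underline S$ is a triple $(S^*,S_*,S_\star)$ of functors from $\mathscr{S}et_G^{Fin}$ to sets, $S_*,S_\star$ covariant and $S^*$ contravariant, with common object function $X\mapsto\underline S(X)$, such that each $\underline S(X)$ is a commutative ring; $S_*(f)$ is a homomorphism of additive monoids, $S_\star(f)$ a homomorphism of multiplicative monoids and $S^*(f)$ a ring homomorphism; $(S^*,S_* )$ is a $G$-Mackey functor and $(S^*,S_\star)$ a semi-$G$-Mackey functor (same axioms, valued in commutative monoids); and for every exponential diagram $X\xleftarrow{p}A\xleftarrow{e}X'\xrightarrow{f'}Y'\xrightarrow{h}Y\xleftarrow{f}X$ in $\mathscr{S}et_G^{Fin}$, $S_\star(f)S_*(p)=S_*(h)S_\star(f')S^*(e)$.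 A $G$-Mackey functor has the structure of a $G$-Tambara functor if it is the underlying Mackey functor $(S^*,S_* )$ of one.
   Formalization: For a G-commutative monoid, the extension of (-)⊗C to all finite G-sets must also keep the isomorphisms for disjoint unions (1) and products (3) natural; for a bare functor extension the claim is false (G trivial, C the direct sum of Z/q^k over k≥1). *)

(* Defs.v *)
From HB Require Import structures.
From mathcomp Require Import all_boot all_order all_algebra all_fingroup all_solvable.
From mathcomp Require Import boolp.

Set Implicit Arguments.
Unset Strict Implicit.
Unset Printing Implicit Defensive.

Import GRing.Theory.

Declare Scope cat_scope.
Delimit Scope cat_scope with cat.

(** * Categories and symmetric monoidal categories *)

Record category := Category {
  ob :> Type;
  hom : ob -> ob -> Type;
  idm : forall a, hom a a;
  comp : forall a b c, hom b c -> hom a b -> hom a c;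
  comp_idl : forall a b (f : hom a b), comp (idm b) f = f;
  comp_idr : forall a b (f : hom a b), comp f (idm a) = f;
  compA : forall a b c d (f : hom c d) (g : hom b c) (h : hom a b),
    comp f (comp g h) = comp (comp f g) h }.

Arguments hom {c0} a b : rename.
Arguments idm {c0} a : rename.
Arguments comp {c0 a b c} f g : rename.

Notation "f ∘ g" := (comp f g) (at level 40, left associativity) : cat_scope.
Local Open Scope cat_scope.

Record iso (C : category) (a b : C) := Iso {
  iso_fun :> hom a b;
  iso_inv : hom b a;
  iso_invl : iso_inv ∘ iso_fun = idm a;
  iso_invr : iso_fun ∘ iso_inv = idm b }.

Arguments Iso {C a b}.

Lemma iso_eq (C : category) (a b : C) (f g : iso a b) :
  iso_fun f = iso_fun g -> f = g.
Proof.
case: f g => f fi fl fr [g gi gl gr] /= efg; subst g.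
have e : fi = gi by rewrite -[fi]comp_idr -gr compA fl comp_idl.
by subst gi; congr Iso; apply: Prop_irrelevance.
Qed.

Definition iso_id (C : category) (a : C) : iso a a :=
  Iso (idm a) (idm a) (comp_idl _) (comp_idl _).

Definition iso_sym (C : category) (a b : C) (f : iso a b) : iso b a :=
  Iso (iso_inv f) (iso_fun f) (iso_invr f) (iso_invl f).

Definition iso_comp (C : category) (a b c : C) (f : iso b c) (g : iso a b) :
  iso a c.
Proof.
apply: (Iso (f ∘ g) (iso_inv g ∘ iso_inv f)).
- by rewrite compA -(compA (iso_inv g)) iso_invl comp_idr iso_invl.
- by rewrite compA -(compA (iso_fun f)) iso_invr comp_idr iso_invr.
Defined.

Definition is_pullback (C : category) (w x y z : C)
    (a : hom w x) (b : hom w y) (f : hom x z) (g : hom y z) : Prop :=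
  f ∘ a = g ∘ b /\
  forall (v : C) (s : hom v x) (t : hom v y), f ∘ s = g ∘ t ->
    exists! u : hom v w, a ∘ u = s /\ b ∘ u = t.

Definition core (C : category) : category.
Proof.
apply: (@Category C (@iso C) (@iso_id C) (@iso_comp C)).
- by move=> a b f; apply: iso_eq; rewrite /= comp_idl.
- by move=> a b f; apply: iso_eq; rewrite /= comp_idr.
- by move=> a b c d f g h; apply: iso_eq; rewrite /= compA.
Defined.

Definition prodcat (C D : category) : category.
Proof.
apply: (@Category (C * D)%type
          (fun u v => (hom u.1 v.1 * hom u.2 v.2)%type)
          (fun u => (idm u.1, idm u.2))
          (fun u v w f g => (f.1 ∘ g.1, f.2 ∘ g.2))).
- by move=> u v [f g] /=; rewrite !comp_idl.
- by move=> u v [f g] /=; rewrite !comp_idr.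
- by move=> u v w x f g h /=; rewrite !compA.
Defined.

Record functor (C D : category) := Functor {
  fob :> C -> D;
  fmap : forall a b, hom a b -> hom (fob a) (fob b);
  fmap_id : forall a, fmap (idm a) = idm (fob a);
  fmap_comp : forall a b c (f : hom b c) (g : hom a b),
    fmap (f ∘ g) = fmap f ∘ fmap g }.

Arguments fmap {C D} f0 {a b} f : rename.

Definition bifmap (B C D : category) (F : functor (prodcat B C) D)
    (a a' : B) (b b' : C) (f : hom a a') (g : hom b b') :
    hom (F (a, b)) (F (a', b')) :=
  @fmap _ _ F (a, b) (a', b') (f, g).

Record symmon (C : category) := SymMon {
  sm_tens : functor (prodcat C C) C;
  sm_unit : C;
  sm_assoc : forall a b c : C,
    iso (sm_tens (sm_tens (a, b), c)) (sm_tens (a, sm_tens (b, c)));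
  sm_lunit : forall a : C, iso (sm_tens (sm_unit, a)) a;
  sm_runit : forall a : C, iso (sm_tens (a, sm_unit)) a;
  sm_braid : forall a b : C, iso (sm_tens (a, b)) (sm_tens (b, a));
  sm_assoc_nat : forall a a' b b' c c'
      (f : hom a a') (g : hom b b') (h : hom c c'),
    sm_assoc a' b' c' ∘ bifmap sm_tens (bifmap sm_tens f g) h
    = bifmap sm_tens f (bifmap sm_tens g h) ∘ sm_assoc a b c;
  sm_lunit_nat : forall a a' (f : hom a a'),
    sm_lunit a' ∘ bifmap sm_tens (idm sm_unit) f = f ∘ sm_lunit a;
  sm_runit_nat : forall a a' (f : hom a a'),
    sm_runit a' ∘ bifmap sm_tens f (idm sm_unit) = f ∘ sm_runit a;
  sm_braid_nat : forall a a' b b' (f : hom a a') (g : hom b b'),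
    sm_braid a' b' ∘ bifmap sm_tens f g = bifmap sm_tens g f ∘ sm_braid a b;
  sm_pentagon : forall a b c d : C,
    sm_assoc a b (sm_tens (c, d)) ∘ sm_assoc (sm_tens (a, b)) c d
    = bifmap sm_tens (idm a) (sm_assoc b c d)
      ∘ sm_assoc a (sm_tens (b, c)) d
      ∘ bifmap sm_tens (sm_assoc a b c) (idm d);
  sm_triangle : forall a b : C,
    bifmap sm_tens (idm a) (sm_lunit b) ∘ sm_assoc a sm_unit b
    = bifmap sm_tens (sm_runit a) (idm b);
  sm_hexagon : forall a b c : C,
    sm_assoc b c a ∘ sm_braid a (sm_tens (b, c)) ∘ sm_assoc a b c
    = bifmap sm_tens (idm b) (sm_braid a c)
      ∘ sm_assoc b a c
      ∘ bifmap sm_tens (sm_braid a b) (idm c);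
  sm_braid_sym : forall a b : C,
    sm_braid b a ∘ sm_braid a b = idm (sm_tens (a, b)) }.

(** * The canonical exponentiation [c^{⊠|X|}] *)

Section Exponentiation.
Variables (C : category) (V : symmon C).
Local Notation "a ⊠ b" := (sm_tens V (a, b)) (at level 40, left associativity).

Fixpoint tpow (c : C) (n : nat) : C :=
  if n is n'.+1 then c ⊠ tpow c n' else sm_unit V.

Fixpoint tpow_map (c d : C) (h : hom c d) (n : nat) :
    hom (tpow c n) (tpow d n) :=
  match n return hom (tpow c n) (tpow d n) with
  | 0 => idm _
  | n'.+1 => bifmap (sm_tens V) h (tpow_map h n')
  end.

Definition swap2 (c d : C) : hom (c ⊠ (c ⊠ d)) (c ⊠ (c ⊠ d)) :=
  sm_assoc V c c d
  ∘ bifmap (sm_tens V) (iso_fun (sm_braid V c c)) (idm d)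
  ∘ iso_inv (sm_assoc V c c d).

(* The first of the [n.+1] factors goes to position [i <= n], the others keep
   their order. *)
Fixpoint tmove (c : C) (i n : nat) : hom (tpow c n.+1) (tpow c n.+1) :=
  match i, n return hom (tpow c n.+1) (tpow c n.+1) with
  | i'.+1, n'.+1 =>
      bifmap (sm_tens V) (idm c) (tmove c i' n') ∘ swap2 c (tpow c n')
  | _, _ => idm _
  end.

(* [w] lists the images of a permutation of {0, ..., n-1}; the factor in
   position [k] goes to position [nth 0 w k]. *)
Fixpoint tperm_map (c : C) (n : nat) (w : seq nat) : hom (tpow c n) (tpow c n) :=
  match n, w return hom (tpow c n) (tpow c n) with
  | n'.+1, j :: w' =>
      tmove c j n'
      ∘ bifmap (sm_tens V) (idm c) (tperm_map c n' [seq unbump j k | k <- w'])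
  | _, _ => idm _
  end.

(* The map [c^{⊠|X|} -> c^{⊠|Y|}] induced by a bijection [f : X -> Y], where the
   factors are indexed by [enum X] and [enum Y]. *)
Definition texp_map (X Y : finType) (f : X -> Y) (eXY : #|X| = #|Y|) (c : C) :
    hom (tpow c #|X|) (tpow c #|Y|) :=
  eq_rect #|X| (fun n => hom (tpow c #|X|) (tpow c n))
    (tperm_map c #|X| [seq val (enum_rank (f x)) | x <- enum X]) #|Y| eXY.

End Exponentiation.

(** * Finite G-sets *)

(* Actions are on the right, as in the library: [g] in a left action
   corresponds to [g^-1] here. *)
Record gset (gT : finGroupType) := MkGSet {
  gcar :> finType;
  gact : {action gT &-> gcar} }.

Arguments gact {gT} X : rename.

Record gmap (gT : finGroupType) (X Y : gset gT) := GMap {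
  gfun :> X -> Y;
  gfunP : forall x g, gfun (gact X x g) = gact Y (gfun x) g }.

Arguments GMap {gT X Y}.

Section GSets.
Variable gT : finGroupType.
Implicit Types X Y Z A : gset gT.

Lemma gmap_eq X Y (f g : gmap X Y) : (forall x, f x = g x) -> f = g.
Proof.
case: f g => f fP [g gP] /= /funext efg; subst g.
by congr GMap; apply: Prop_irrelevance.
Qed.

Definition gid X : gmap X X := GMap (fun x => x) (fun _ _ => erefl).

Definition gcomp X Y Z (f : gmap Y Z) (g : gmap X Y) : gmap X Z.
Proof.
by exists (fun x => f (g x)) => x a; rewrite !gfunP.
Defined.

Definition GSet : category.
Proof.
apply: (@Category (gset gT) (@gmap gT) gid gcomp);
by move=> *; apply: gmap_eq.
Defined.

Definition gtriv (X : finType) : gset gT.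
Proof.
by exists X; exists (fun x (_ : gT) => x); apply: is_total_action.
Defined.

Definition gpt : gset gT := gtriv unit.

Definition gsum_act X Y (u : X + Y) (g : gT) : X + Y :=
  match u with inl x => inl (gact X x g) | inr y => inr (gact Y y g) end.

Definition gsum X Y : gset gT.
Proof.
exists (X + Y)%type; exists (@gsum_act X Y); apply: is_total_action.
- by case=> x /=; rewrite act1.
- by case=> x a b /=; rewrite actM.
Defined.

Definition ginl X Y : gmap X (gsum X Y) :=
  @GMap gT X (gsum X Y) inl (fun _ _ => erefl).
Definition ginr X Y : gmap Y (gsum X Y) :=
  @GMap gT Y (gsum X Y) inr (fun _ _ => erefl).

Definition gcopair X Y Z (f : gmap X Z) (g : gmap Y Z) : gmap (gsum X Y) Z.
Proof.
exists (fun u : X + Y => match u with inl x => f x | inr y => g y end).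
by case=> x a /=; rewrite gfunP.
Defined.

Definition gsum_map X X' Y Y' (f : gmap X X') (g : gmap Y Y') :
    gmap (gsum X Y) (gsum X' Y') :=
  gcopair (gcomp (ginl X' Y') f) (gcomp (ginr X' Y') g).

Definition gprod_act X Y (u : X * Y) (g : gT) : X * Y :=
  (gact X u.1 g, gact Y u.2 g).

Definition gprod X Y : gset gT.
Proof.
exists (X * Y)%type; exists (@gprod_act X Y); apply: is_total_action.
- by case=> x y; rewrite /gprod_act /= !act1.
- by case=> x y a b; rewrite /gprod_act /= !actM.
Defined.

Definition gprod_map X X' Y Y' (f : gmap X X') (g : gmap Y Y') :
  gmap (gprod X Y) (gprod X' Y').
Proof.
exists (fun u : X * Y => (f u.1, g u.2)).
by case=> x y a; rewrite /= /gprod_act /= !gfunP.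
Defined.

Definition gprodA X Y Z : gmap (gprod (gprod X Y) Z) (gprod X (gprod Y Z)) :=
  @GMap gT (gprod (gprod X Y) Z) (gprod X (gprod Y Z))
    (fun u : X * Y * Z => (u.1.1, (u.1.2, u.2))) (fun _ _ => erefl).
Definition gprodC X Y : gmap (gprod X Y) (gprod Y X) :=
  @GMap gT (gprod X Y) (gprod Y X)
    (fun u : X * Y => (u.2, u.1)) (fun _ _ => erefl).
Definition gfst X Y : gmap (gprod X Y) X :=
  @GMap gT (gprod X Y) X (fun u : X * Y => u.1) (fun _ _ => erefl).
Definition gsnd X Y : gmap (gprod X Y) Y :=
  @GMap gT (gprod X Y) Y (fun u : X * Y => u.2) (fun _ _ => erefl).

Lemma giso_cancel X Y (f : @iso GSet X Y) : cancel (iso_fun f) (iso_inv f).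
Proof. by move=> x; have /(congr1 (fun h : gmap X X => h x)) := iso_invl f. Qed.

Lemma giso_card X Y (f : @iso GSet X Y) : #|X| = #|Y|.
Proof.
apply: (@bij_eq_card _ _ (iso_fun f)); exists (iso_inv f).
- exact: giso_cancel.
- exact: (giso_cancel (iso_sym f)).
Qed.

Definition gsum_iso X X' Y Y' (f : @iso GSet X X') (g : @iso GSet Y Y') :
  @iso GSet (gsum X Y) (gsum X' Y').
Proof.
apply: (@Iso GSet _ _ (gsum_map (iso_fun f) (iso_fun g))
                      (gsum_map (iso_inv f) (iso_inv g))); apply: gmap_eq.
- by case=> x /=; rewrite giso_cancel.
- by case=> x /=; rewrite ?(giso_cancel (iso_sym f)) ?(giso_cancel (iso_sym g)).
Defined.

Definition gprod_iso X X' Y Y' (f : @iso GSet X X') (g : @iso GSet Y Y') :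
  @iso GSet (gprod X Y) (gprod X' Y').
Proof.
apply: (@Iso GSet _ _ (gprod_map (iso_fun f) (iso_fun g))
                      (gprod_map (iso_inv f) (iso_inv g))); apply: gmap_eq.
- by case=> x y /=; rewrite !giso_cancel.
- by case=> x y /=; rewrite (giso_cancel (iso_sym f)) (giso_cancel (iso_sym g)).
Defined.

(** ** Dependent products and exponential diagrams *)

Section DependentProduct.
Variables (X Y A : gset gT) (f : gmap X Y) (p : gmap A X).

Definition gfiber (y : Y) := {x : X | f x == y}.

Definition gsection (y : Y) :=
  {s : {ffun gfiber y -> A} | [forall x, p (s x) == val x]}.

Definition dprod_car := {y : Y & gsection y}.

Lemma gfiber_backP (y : Y) (g : gT) (x : gfiber (gact Y y g)) :
  f (gact X (val x) g^-1%g) == y.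
Proof. by rewrite gfunP (eqP (valP x)) actK. Qed.

Definition gfiber_back (y : Y) (g : gT) (x : gfiber (gact Y y g)) : gfiber y :=
  exist _ (gact X (val x) g^-1%g) (gfiber_backP x).

Lemma gsection_actP (y : Y) (g : gT) (s : gsection y) :
  [forall x : gfiber (gact Y y g),
     p ([ffun x => gact A (val s (gfiber_back x)) g] x) == val x].
Proof.
apply/forallP => x; rewrite ffunE gfunP.
by rewrite (eqP (forallP (valP s) (gfiber_back x))) /= actKV.
Qed.

(* [(s · g)(x) = s(x · g^-1) · g] *)
Definition gsection_act (y : Y) (g : gT) (s : gsection y) :
    gsection (gact Y y g) :=
  exist _ [ffun x : gfiber (gact Y y g) => gact A (val s (gfiber_back x)) g]
    (gsection_actP g s).

Definition dprod_act (u : dprod_car) (g : gT) : dprod_car :=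
  existT _ (gact Y (projT1 u) g) (gsection_act g (projT2 u)).

Lemma dprod_eq (u v : dprod_car) :
  projT1 u = projT1 v ->
  (forall x h h', val (projT2 u) (exist _ x h) = val (projT2 v) (exist _ x h')) ->
  u = v.
Proof.
case: u v => y s [y' s'] /= eyy'; subst y' => ess'; congr existT.
apply/val_inj/ffunP => -[x h]; exact: ess'.
Qed.

Lemma gsection_congr (u : dprod_car) x x'
    (h : f x == projT1 u) (h' : f x' == projT1 u) :
  x = x' -> val (projT2 u) (exist _ x h) = val (projT2 u) (exist _ x' h').
Proof. by move=> e; subst x'; rewrite (bool_irrelevance h h'). Qed.

Definition gdprod : gset gT.
Proof.
exists dprod_car; exists dprod_act; apply: is_total_action.
- move=> u; apply: dprod_eq => [|x h h'] /=; first by rewrite act1.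
  by rewrite ffunE act1; apply: gsection_congr; rewrite /= invg1 act1.
- move=> u a b; apply: dprod_eq => [|x h h'] /=; first by rewrite actM.
  rewrite !ffunE actM; do 2 congr (gact A _ _).
  by apply: gsection_congr; rewrite /= invMg actM.
Defined.

Definition gdprod_proj : gmap gdprod Y :=
  @GMap gT gdprod Y (fun u : dprod_car => projT1 u) (fun _ _ => erefl).

End DependentProduct.

Definition pb_car X Y Z (f : gmap X Z) (g : gmap Y Z) :=
  {u : X * Y | f u.1 == g u.2}.

Lemma pb_actP X Y Z (f : gmap X Z) (g : gmap Y Z) (u : pb_car f g) (a : gT) :
  f (gprod_act (val u) a).1 == g (gprod_act (val u) a).2.
Proof. by rewrite /= !gfunP (eqP (valP u)). Qed.

Definition gpb X Y Z (f : gmap X Z) (g : gmap Y Z) : gset gT.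
Proof.
exists (pb_car f g).
exists (fun u a => exist _ (gprod_act (val u) a) (pb_actP u a)).
apply: is_total_action.
- by move=> [[x y] h]; apply: val_inj; rewrite /gprod_act /= !act1.
- by move=> [[x y] h] a b; apply: val_inj; rewrite /gprod_act /= !actM.
Defined.

Section CanonicalExponential.
Variables (X Y A : gset gT) (f : gmap X Y) (p : gmap A X).

Definition gexp_pb : gset gT := gpb f (gdprod_proj f p).

Definition gexp_f' : gmap gexp_pb (gdprod f p) :=
  @GMap gT gexp_pb (gdprod f p)
    (fun u : pb_car f (gdprod_proj f p) => (val u).2) (fun _ _ => erefl).

Definition gexp_eval (u : pb_car f (gdprod_proj f p)) : A :=
  val (projT2 (val u).2) (exist _ (val u).1 (valP u)).

Definition gexp_e : gmap gexp_pb A.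
Proof.
exists (gexp_eval : gexp_pb -> A) => -[[x [y s]] h] a.
rewrite /gexp_eval /= ffunE; congr (gact A _ a).
by apply: (@gsection_congr X Y A f p (existT _ y s)); rewrite /= actK.
Defined.

End CanonicalExponential.

(* The diagram [X <-p- A <-e- X' -f'-> Y' -h-> Y <-f- X] is isomorphic to the
   canonical exponential diagram generated by some [f0, p0]. *)
Definition is_exponential X Y A X' Y' (p : gmap A X) (e : gmap X' A)
    (f' : gmap X' Y') (h : gmap Y' Y) (f : gmap X Y) : Prop :=
  exists (X0 Y0 A0 : gset gT) (f0 : gmap X0 Y0) (p0 : gmap A0 X0)
    (iX : @iso GSet X X0) (iY : @iso GSet Y Y0) (iA : @iso GSet A A0)
    (iX' : @iso GSet X' (gexp_pb f0 p0)) (iY' : @iso GSet Y' (gdprod f0 p0)),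
    [/\ gcomp (iso_fun iX) p = gcomp p0 (iso_fun iA),
        gcomp (iso_fun iA) e = gcomp (gexp_e f0 p0) (iso_fun iX'),
        gcomp (iso_fun iY') f' = gcomp (gexp_f' f0 p0) (iso_fun iX'),
        gcomp (iso_fun iY) h = gcomp (gdprod_proj f0 p0) (iso_fun iY') &
        gcomp (iso_fun iY) f = gcomp f0 (iso_fun iX)].

End GSets.

(** * Mackey functors and Tambara functors *)

(* The axioms of a (semi-)Mackey functor with values in commutative monoids;
   [res] is the contravariant part and [tr] the covariant one. *)
Record semi_mackey_axioms (gT : finGroupType) (S : gset gT -> Type)
    (op : forall X, S X -> S X -> S X) (e : forall X, S X)
    (res : forall X Y, gmap X Y -> S Y -> S X)
    (tr : forall X Y, gmap X Y -> S X -> S Y) : Prop := SemiMackeyAxioms {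
  ma_opA : forall X, associative (@op X);
  ma_opC : forall X, commutative (@op X);
  ma_op1 : forall X, left_id (@e X) (@op X);
  ma_res_op : forall X Y (f : gmap X Y), {morph res X Y f : s t / op _ s t};
  ma_res_e : forall X Y (f : gmap X Y), res _ _ f (e Y) = e X;
  ma_tr_op : forall X Y (f : gmap X Y), {morph tr X Y f : s t / op _ s t};
  ma_tr_e : forall X Y (f : gmap X Y), tr _ _ f (e X) = e Y;
  ma_res_id : forall X s, res _ _ (gid X) s = s;
  ma_res_comp : forall X Y Z (f : gmap Y Z) (g : gmap X Y) s,
    res _ _ (gcomp f g) s = res _ _ g (res _ _ f s);
  ma_tr_id : forall X s, tr _ _ (gid X) s = s;
  ma_tr_comp : forall X Y Z (f : gmap Y Z) (g : gmap X Y) s,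
    tr _ _ (gcomp f g) s = tr _ _ f (tr _ _ g s);
  ma_double_coset : forall (W X Y Z : gset gT) (a : gmap W X) (b : gmap W Y)
      (f : gmap X Z) (g : gmap Y Z), @is_pullback (GSet gT) W X Y Z a b f g ->
    forall s, res _ _ g (tr _ _ f s) = tr _ _ b (res _ _ a s);
  ma_additive : forall X Y,
    bijective (fun s : S (gsum X Y) =>
                 (res _ _ (ginl X Y) s, res _ _ (ginr X Y) s)) }.

Record mackey (gT : finGroupType) := Mackey {
  mob :> gset gT -> zmodType;
  mres : forall X Y, gmap X Y -> mob Y -> mob X;
  mtr : forall X Y, gmap X Y -> mob X -> mob Y;
  mackeyP : semi_mackey_axioms (fun X => @GRing.add (mob X))
              (fun X => @GRing.zero (mob X)) mres mtr }.

Arguments mres {gT} M {X Y} f s : rename.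
Arguments mtr {gT} M {X Y} f s : rename.

Record mackey_hom (gT : finGroupType) (M N : mackey gT) := MackeyHom {
  mhfun :> forall X, M X -> N X;
  mh_add : forall X, {morph @mhfun X : s t / (s + t)%R};
  mh_res : forall X Y (f : gmap X Y) s, mhfun (mres M f s) = mres N f (mhfun s);
  mh_tr : forall X Y (f : gmap X Y) s, mhfun (mtr M f s) = mtr N f (mhfun s) }.

Arguments mhfun {gT M N} m X s : rename.
Arguments MackeyHom {gT M N}.

Lemma mackey_hom_eq (gT : finGroupType) (M N : mackey gT) (f g : mackey_hom M N) :
  (forall X s, f X s = g X s) -> f = g.
Proof.
case: f g => f fa fr ft [g ga gr gt] /= efg.
have e : f = g by apply: functional_extensionality_dep => X; apply: funext.
by subst g; congr MackeyHom; apply: Prop_irrelevance.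
Qed.

Definition mackey_id (gT : finGroupType) (M : mackey gT) : mackey_hom M M.
Proof. by exists (fun X s => s). Defined.

Definition mackey_comp (gT : finGroupType) (M N P : mackey gT)
  (f : mackey_hom N P) (g : mackey_hom M N) : mackey_hom M P.
Proof.
exists (fun X s => f X (g X s)).
- by move=> X s t; rewrite !mh_add.
- by move=> X Y h s; rewrite !mh_res.
- by move=> X Y h s; rewrite !mh_tr.
Defined.

Definition Mack (gT : finGroupType) : category.
Proof.
apply: (@Category (mackey gT) (@mackey_hom gT) (@mackey_id gT) (@mackey_comp gT));
by move=> *; apply: mackey_hom_eq.
Defined.

(* [tam_semi_mackey] contains the commutative monoid axioms of the
   multiplication and the multiplicativity of restrictions and norms. *)
Record tambara (gT : finGroupType) := Tambara {
  tam_mackey :> mackey gT;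
  tam_mul : forall X, tam_mackey X -> tam_mackey X -> tam_mackey X;
  tam_one : forall X, tam_mackey X;
  tam_norm : forall X Y, gmap X Y -> tam_mackey X -> tam_mackey Y;
  tam_mulDl : forall X, left_distributive (@tam_mul X) +%R;
  tam_semi_mackey :
    semi_mackey_axioms tam_mul tam_one (@mres _ tam_mackey) tam_norm;
  tam_exponential : forall (X Y A X' Y' : gset gT) (p : gmap A X)
      (e : gmap X' A) (f' : gmap X' Y') (h : gmap Y' Y) (f : gmap X Y),
    is_exponential p e f' h f -> forall s : tam_mackey A,
    tam_norm f (mtr tam_mackey p s)
    = mtr tam_mackey h (tam_norm f' (mres tam_mackey e s)) }.

Definition has_tambara_structure (gT : finGroupType) (M : mackey gT) : Prop :=
  exists S : tambara gT, tam_mackey S = M.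

(** * The box product *)

(* A natural transformation [M(X) ⊗ N(Y) -> P(X × Y)] in restrictions and
   transfers; the box product is the left Kan extension along [×], i.e. the
   universal such [P]. *)
Record pairing (gT : finGroupType) (M N P : mackey gT) := Pairing {
  prfun :> forall X Y, M X -> N Y -> P (gprod X Y);
  pr_addl : forall X Y s s' t,
    @prfun X Y (s + s')%R t = (@prfun X Y s t + @prfun X Y s' t)%R;
  pr_addr : forall X Y s t t',
    @prfun X Y s (t + t')%R = (@prfun X Y s t + @prfun X Y s t')%R;
  pr_res : forall X X' Y Y' (f : gmap X' X) (g : gmap Y' Y) s t,
    @prfun X' Y' (mres M f s) (mres N g t)
    = mres P (gprod_map f g) (@prfun X Y s t);
  pr_tr : forall X X' Y Y' (f : gmap X X') (g : gmap Y Y') s t,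
    @prfun X' Y' (mtr M f s) (mtr N g t)
    = mtr P (gprod_map f g) (@prfun X Y s t) }.

Arguments prfun {gT M N P} p X Y s t : rename.

(* [A] is the Burnside Mackey functor: [A(X)] is the Grothendieck group of the
   finite G-sets over [X] under disjoint union, with transfers given by
   composition and restrictions by pullback. *)
Record burnside (gT : finGroupType) (A : mackey gT) := Burnside {
  bcl : forall X Y : gset gT, gmap Y X -> A X;
  bcl_iso : forall (X Y Y' : gset gT) (f : gmap Y X) (i : @iso (GSet gT) Y' Y),
    bcl (gcomp f (iso_fun i)) = bcl f;
  bcl_sum : forall (X Y Y' : gset gT) (f : gmap Y X) (f' : gmap Y' X),
    bcl (gcopair f f') = (bcl f + bcl f')%R;
  bcl_univ : forall (X : gset gT) (Z : zmodType)
      (c : forall Y : gset gT, gmap Y X -> Z),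
    (forall (Y Y' : gset gT) (f : gmap Y X) (i : @iso (GSet gT) Y' Y),
       c Y' (gcomp f (iso_fun i)) = c Y f) ->
    (forall (Y Y' : gset gT) (f : gmap Y X) (f' : gmap Y' X),
       c (gsum Y Y') (gcopair f f') = (c Y f + c Y' f')%R) ->
    exists! phi : A X -> Z,
      {morph phi : s t / (s + t)%R} /\
      forall (Y : gset gT) (f : gmap Y X), phi (bcl f) = c Y f;
  bcl_tr : forall (X X' Y : gset gT) (g : gmap X X') (f : gmap Y X),
    mtr A g (bcl f) = bcl (gcomp g f);
  bcl_res : forall (W X X' Y : gset gT) (a : gmap W Y) (b : gmap W X')
      (f : gmap Y X) (g : gmap X' X), @is_pullback (GSet gT) W Y X' X a b f g ->
    mres A g (bcl f) = bcl b }.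

(* The symmetric monoidal structure of the box product, with unit the Burnside
   Mackey functor. The universal property and the compatibilities below
   determine it up to a unique isomorphism. *)
Record box_product (gT : finGroupType) := BoxProduct {
  box_sm :> symmon (Mack gT);
  box_pair : forall M N : mackey gT, pairing M N (sm_tens box_sm (M, N));
  box_univ : forall (M N P : mackey gT) (theta : pairing M N P),
    exists! phi : mackey_hom (sm_tens box_sm (M, N)) P,
      forall X Y (s : M X) (t : N Y),
        phi (gprod X Y) (box_pair M N X Y s t) = theta X Y s t;
  box_burnside : burnside (sm_unit box_sm);
  box_map : forall (M M' N N' : mackey gT)
      (f : mackey_hom M M') (g : mackey_hom N N') X Y (s : M X) (t : N Y),
    (@bifmap (Mack gT) (Mack gT) (Mack gT) (sm_tens box_sm) M M' N N' f g
       : mackey_hom _ _) _ (box_pair M N X Y s t)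
    = box_pair M' N' X Y (f X s) (g Y t);
  box_assoc : forall (M N P : mackey gT) X Y Z (s : M X) (t : N Y) (u : P Z),
    (iso_fun (sm_assoc box_sm M N P) : mackey_hom _ _) _
      (box_pair _ P _ Z (box_pair M N X Y s t) u)
    = mres _ (gprodA X Y Z) (box_pair M _ X _ s (box_pair N P Y Z t u));
  box_braid : forall (M N : mackey gT) X Y (s : M X) (t : N Y),
    (iso_fun (sm_braid box_sm M N) : mackey_hom _ _) _ (box_pair M N X Y s t)
    = mres _ (gprodC X Y) (box_pair N M Y X t s);
  box_lunit : forall (M : mackey gT) X (s : M X),
    (iso_fun (sm_lunit box_sm M) : mackey_hom _ _) _
      (box_pair _ M _ X (bcl box_burnside (gid (gpt gT))) s)
    = mres M (gsnd (gpt gT) X) s;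
  box_runit : forall (M : mackey gT) X (s : M X),
    (iso_fun (sm_runit box_sm M) : mackey_hom _ _) _
      (box_pair M _ X _ s (bcl box_burnside (gid (gpt gT))))
    = mres M (gfst X (gpt gT)) s }.

(** * G-symmetric monoidal structures and G-commutative monoids *)

Record gsymmon (gT : finGroupType) (C : category) (V : symmon C) := GSymMon {
  gs_tens : functor (prodcat (core (GSet gT)) C) C;
  gs_sum : forall (X Y : gset gT) (c : C),
    iso (gs_tens (gsum X Y, c))
        (sm_tens V (gs_tens (X : GSet gT, c), gs_tens (Y : GSet gT, c)));
  gs_sum_nat : forall (X X' Y Y' : GSet gT) (f : iso X X') (g : iso Y Y')
      (c c' : C) (h : hom c c'),
    gs_sum X' Y' c' ∘ bifmap gs_tens (gsum_iso f g : hom (c0 := core _) _ _) h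
    = bifmap (sm_tens V) (bifmap gs_tens (f : hom (c0 := core _) _ _) h)
                         (bifmap gs_tens (g : hom (c0 := core _) _ _) h)
      ∘ gs_sum X Y c;
  gs_box : forall (X : gset gT) (c d : C),
    iso (gs_tens (X : GSet gT, sm_tens V (c, d)))
        (sm_tens V (gs_tens (X : GSet gT, c), gs_tens (X : GSet gT, d)));
  gs_box_nat : forall (X X' : GSet gT) (f : iso X X')
      (c c' d d' : C) (h : hom c c') (k : hom d d'),
    gs_box X' c' d'
      ∘ bifmap gs_tens (f : hom (c0 := core _) _ _) (bifmap (sm_tens V) h k)
    = bifmap (sm_tens V) (bifmap gs_tens (f : hom (c0 := core _) _ _) h)
                         (bifmap gs_tens (f : hom (c0 := core _) _ _) k)
      ∘ gs_box X c d;
  gs_triv : forall (X : finType) (c : C),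
    iso (gs_tens (gtriv gT X : GSet gT, c)) (tpow V c #|X|);
  gs_triv_nat : forall (X Y : finType)
      (f : @iso (GSet gT) (gtriv gT X) (gtriv gT Y)) (c c' : C) (h : hom c c'),
    gs_triv Y c' ∘ bifmap gs_tens (f : hom (c0 := core _) _ _) h
    = texp_map V (iso_fun f : gmap _ _) (giso_card f) c' ∘ tpow_map V h #|X|
      ∘ gs_triv X c;
  gs_prod : forall (X Y : gset gT) (c : C),
    iso (gs_tens (X : GSet gT, gs_tens (Y : GSet gT, c)))
        (gs_tens (gprod X Y : GSet gT, c));
  gs_prod_nat : forall (X X' Y Y' : GSet gT) (f : iso X X') (g : iso Y Y')
      (c c' : C) (h : hom c c'),
    gs_prod X' Y' c'
      ∘ bifmap gs_tens (f : hom (c0 := core _) _ _)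
                       (bifmap gs_tens (g : hom (c0 := core _) _ _) h)
    = bifmap gs_tens (gprod_iso f g : hom (c0 := core _) _ _) h
      ∘ gs_prod X Y c }.

(* An extension of [(-) ⊗ c] to all maps of finite G-sets. The extension is one
   of functors with their G-symmetric monoidal structure: the isomorphisms for
   [⊔] and [×] stay natural ([gcm_sum], [gcm_prod]). For a bare functor the
   notion would be too weak: for [G = 1] it would not even give an associative
   product, and the abelian group [⊕_k Z/q^k] ([q] prime), which has no unital
   ring structure, would be a monoid. *)
Record gcm_structure (gT : finGroupType) (C : category) (V : symmon C)
    (T : gsymmon gT V) (c : C) := GcmStructure {
  gcm_map : forall X Y : GSet gT,
    hom X Y -> hom (gs_tens T (X, c)) (gs_tens T (Y, c));
  gcm_id : forall X, gcm_map (idm X) = idm _;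
  gcm_comp : forall (X Y Z : GSet gT) (f : hom Y Z) (g : hom X Y),
    gcm_map (f ∘ g) = gcm_map f ∘ gcm_map g;
  gcm_iso : forall (X Y : GSet gT) (f : iso X Y),
    gcm_map (iso_fun f) = bifmap (gs_tens T) (f : hom (c0 := core _) _ _) (idm c);
  gcm_sum : forall (X X' Y Y' : GSet gT) (f : hom X X') (g : hom Y Y'),
    gs_sum T X' Y' c ∘ gcm_map (gsum_map f g : hom (c0 := GSet gT) _ _)
    = bifmap (sm_tens V) (gcm_map f) (gcm_map g) ∘ gs_sum T X Y c;
  gcm_prod : forall (X Y Y' : GSet gT) (g : hom Y Y'),
    gs_prod T X Y' c
      ∘ bifmap (gs_tens T) (idm (X : core (GSet gT))) (gcm_map g)
    = gcm_map (gprod_map (gid X) g : hom (c0 := GSet gT) _ _)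
      ∘ gs_prod T X Y c }.

Definition is_gcm (gT : finGroupType) (C : category) (V : symmon C)
    (T : gsymmon gT V) (c : C) : Prop :=
  inhabited (gcm_structure T c).

(* Main.v *)
(** For a finite G-set [X], the Mackey functor [X ⊗ M] is the universal target of maps
[n : M (X × T) -> (X ⊗ M) T] that commute with restrictions and satisfy
[n (q_* a) = h_* (n (e^* a))], where [h : E -> T] is the dependent product of
[q : A -> X × T] along the projection and [e : X × E -> A] is the evaluation. Box products
and the Burnside functor are universal targets of the same kind: all are presented by
generators [d : D S], contravariant in [S], and relations saying that [d] is the transfer of [d'].

Two facts give the isomorphisms of the structure. By currying, a box product of presented
Mackey functors is presented by pairs of generators. The norm along [X] of a functor
presented by [D] is presented by the generators [D (X × T)]: on an effective element, the
transfer of a generator along [S -> X × T], the norm must be a transfer from the dependent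
product; by inclusion-exclusion over the sets of values of a section, this map is polynomial
of degree at most the cardinality of [X], so that it extends uniquely to the group completion.

If [M] is a Tambara functor, a map [f : X -> Y] acts by [n_X m |-> n_Y (f_* m)], with [f_*]
the norm. Conversely a G-commutative monoid has norms [N_X : M (X × T) -> M T], and the norm
of [f : X -> Y] is [N_X] of the extension by one along the graph [X -> X × Y]. Any other
embedding of [X] over [Y] gives the same norm because, for [s : S -> Y], the map [N_Y] sends
the extension by one of [m] along the graph of [s] to [m]: functoriality for
[S -> S × Y -> S] proves this inside [S ⊗ M], and over an orbit [S] of an abelian group
[S × S] is the product of [S] with a trivial G-set, hence [S ⊗ M] maps to [M] by a power of
the multiplication, which recovers [m]. *)

From HB Require Import structures.
From mathcomp Require Import all_boot all_order all_algebra all_fingroup all_solvable.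
From mathcomp Require Import boolp zify.
Require Import Defs.

Set Implicit Arguments.
Unset Strict Implicit.
Unset Printing Implicit Defensive.

Import GRing.Theory.

(** * Pointwise constructions on finite G-sets *)

(** The norm is not additive, so the structure isomorphisms of [X ⊗ M] are out of reach of linear
    computations with a quotient of values of [M]. They are obtained instead by comparing universal
    pairings whose generators are in bijection, and every coherence diagram is checked on
    generators, where it becomes an identity between maps of finite G-sets. Dependent products enter
    through their points, that is, through sections, and are compared by uniqueness.

    In the converse direction the obstacle is that an element [m] over [S × T] is not known to be
    recoverable from its generator in [S ⊗ M]: an equality of generators says something about [M]
    only after a retraction is exhibited. One is constructed for extensions by one along the
    diagonal of an orbit [S], which is enough. Commutativity of [G] makes it possible: an element of
    [G] that carries the base point of [S] to another point acts on [S] by an equivariant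
    translation. *)

Section GSetFacts.
Variable gT : finGroupType.
Implicit Types (X Y Z W S T U V E A : gset gT).

(** Unique choice turns a pointwise universal property into a G-map; equivariance passes from the
    relation to the function by uniqueness. *)
Lemma gmap_of_graph X Y (R : X -> Y -> Prop) :
  (forall x, exists! y, R x y) ->
  (forall x y g, R x y -> R (gact X x g) (gact Y y g)) ->
  exists f : gmap X Y, forall x, R x (f x).
Proof.
move=> exR eqvR; pose f x := sval (cid (exR x)).
have fR x : R x (f x) by rewrite /f; case: cid => y [].
have fU x y : R x y -> f x = y.
  by move=> Rxy; rewrite /f; case: cid => y' [/= Ry' Uy']; apply: Uy'.
have fP x g : f (gact X x g) = gact Y (f x) g by apply: fU; apply: eqvR.
by exists (GMap f fP).
Qed.

Lemma gbij_inv X Y (f : gmap X Y) :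
  injective f -> (forall y, exists x, f x = y) ->
  exists g : gmap Y X, cancel f g /\ cancel g f.
Proof.
move=> fI fS; have [|y x a e|g gP] := @gmap_of_graph Y X (fun y x => f x = y).
- by move=> y; have [x xP] := fS y; exists x; split=> // x' e; apply: fI; rewrite e.
- by rewrite gfunP e.
- by exists g; split=> // x; apply: fI; rewrite gP.
Qed.

Definition gvoid : gset gT := gtriv gT void.

Definition gvoid_map X : gmap gvoid X.
Proof. by exists (fun x : void => match x return X with end); case. Defined.

Section Sub.
Variables (X : gset gT) (P : pred X) (Pinv : forall x g, P (gact X x g) = P x).

Definition gsub_act (u : {x | P x}) (g : gT) : {x | P x} :=
  exist _ (gact X (val u) g) (etrans (Pinv (val u) g) (valP u)).

Definition gsub : gset gT.
Proof.
exists {x | P x}; exists gsub_act; apply: is_total_action.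
- by move=> u; apply: val_inj; rewrite /= act1.
- by move=> u a b; apply: val_inj; rewrite /= actM.
Defined.

Definition gincl : gmap gsub X :=
  @GMap gT gsub X (fun u : {x | P x} => val u) (fun _ _ => erefl).

Lemma gincl_inj : injective gincl.
Proof. exact: val_inj. Qed.

Lemma ginclP (u : gsub) : P (gincl u).
Proof. exact: (valP u). Qed.

Definition glift Y (f : gmap Y X) (fP : forall y, P (f y)) : gmap Y gsub.
Proof.
exists (fun y => exist _ (f y) (fP y) : gsub) => y g.
by apply: val_inj; rewrite /= gfunP.
Defined.

Definition gsubmk (x : X) (Px : P x) : gsub := exist _ x Px.

End Sub.

Lemma gcompl_inv X (P : pred X) (Pinv : forall x g, P (gact X x g) = P x) x g :
  predC P (gact X x g) = predC P x.
Proof. by rewrite /= Pinv. Qed.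

Lemma gim_inv W X (i : gmap W X) (x : X) g :
  (gact X x g \in codom i) = (x \in codom i).
Proof.
apply/codomP/codomP => -[w e].
- by exists (gact W w g^-1%g); rewrite gfunP -e actK.
- by exists (gact W w g); rewrite gfunP -e.
Qed.

Definition is_pb W X Y Z (a : gmap W X) (b : gmap W Y) (f : gmap X Z) (g : gmap Y Z) :=
  (forall w, f (a w) = g (b w)) /\
  forall x y, f x = g y -> exists! w, a w = x /\ b w = y.

(** Working with arbitrary internal decompositions instead of [gsum] avoids transport along
    isomorphisms. *)
Definition is_cop V1 V2 V (i1 : gmap V1 V) (i2 : gmap V2 V) :=
  [/\ injective i1, injective i2, forall x y, i1 x <> i2 y &
      forall v, (exists x, i1 x = v) \/ (exists y, i2 y = v)].

Lemma is_pb_pullback W X Y Z (a : gmap W X) (b : gmap W Y) (f : gmap X Z) (g : gmap Y Z) :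
  is_pb a b f g -> @is_pullback (GSet gT) W X Y Z a b f g.
Proof.
case=> [comm univ]; split=> [|V s t /= est]; first exact: gmap_eq.
have {}est v : f (s v) = g (t v) by have := congr1 (fun h : gmap V Z => h v) est.
have [|v w c [e1 e2]|u uP] :=
    @gmap_of_graph V W (fun v w => a w = s v /\ b w = t v).
- by move=> v; apply: univ.
- by rewrite !gfunP e1 e2.
exists u; split=> [|u' [eu1 eu2]].
  by split; apply: gmap_eq => v /=; have [] := uP v.
apply: gmap_eq => v; have [w [_ wU]] := univ _ _ (est v).
rewrite -(wU _ (uP v)) -(wU (u' v)) // -eu1 -eu2; split=> //.
Qed.

Lemma pb_map W X Y Z V (a : gmap W X) (b : gmap W Y) (f : gmap X Z) (g : gmap Y Z)
    (s : gmap V X) (t : gmap V Y) : is_pb a b f g -> (forall v, f (s v) = g (t v)) ->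
  exists u : gmap V W, (forall v, a (u v) = s v) /\ (forall v, b (u v) = t v).
Proof.
move=> /is_pb_pullback[_ univ] e; have [|u [[u1 u2] _]] := univ V s t.
  exact: gmap_eq.
by exists u; split=> v; [rewrite -u1|rewrite -u2].
Qed.

Lemma pb_eq W X Y Z (a : gmap W X) (b : gmap W Y) (f : gmap X Z) (g : gmap Y Z) w w' :
  is_pb a b f g -> a w = a w' -> b w = b w' -> w = w'.
Proof.
case=> c u e1 e2; have [v [_ vU]] := u _ _ (c w).
by rewrite -(vU w) // (vU w').
Qed.

Lemma pb_ex W X Y Z (a : gmap W X) (b : gmap W Y) (f : gmap X Z) (g : gmap Y Z) x y :
  is_pb a b f g -> f x = g y -> exists w, a w = x /\ b w = y.
Proof. by case=> _ u /u[w [? _]]; exists w. Qed.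

Lemma is_pbI W X Y Z (a : gmap W X) (b : gmap W Y) (f : gmap X Z) (g : gmap Y Z) :
  (forall w, f (a w) = g (b w)) ->
  (forall x y, f x = g y -> exists w, a w = x /\ b w = y) ->
  (forall w w', a w = a w' -> b w = b w' -> w = w') -> is_pb a b f g.
Proof.
move=> c ex un; split=> // x y /ex[w [e1 e2]]; exists w; split=> // w' [e1' e2'].
by apply: un; rewrite ?e1 ?e2.
Qed.

Lemma pb_comp W X Y Z W' Y' (a : gmap W X) (b : gmap W Y) (f : gmap X Z) (g : gmap Y Z)
    (a' : gmap W' W) (b' : gmap W' Y') (g' : gmap Y' Y) :
  is_pb a b f g -> is_pb a' b' b g' -> is_pb (gcomp a a') b' f (gcomp g g').
Proof.
move=> p p'; have [pc _] := p; have [pc' _] := p'.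
apply: is_pbI => [w|x y /= /(pb_ex p)[w [w1 w2]]|w w' /= e1 e2] /=.
- by rewrite pc pc'.
- have [v [v1 v2]] := pb_ex p' w2.
  by exists v; rewrite v1.
- by apply: (pb_eq p') => //; apply: (pb_eq p) => //; rewrite !pc' e2.
Qed.

(** [G] acting on itself by translation: equivariant maps out of it are points, so the categorical
    pullback property can be tested on elements. *)
Definition gfree : gset gT.
Proof.
exists gT; exists (fun x g => (x * g)%g); apply: is_total_action => *.
- exact: mulg1.
- exact: mulgA.
Defined.

Definition gpoint X (x : X) : gmap gfree X.
Proof. by exists (fun a => gact X x a) => a b /=; rewrite actM. Defined.

Lemma pullback_is_pb W X Y Z (a : gmap W X) (b : gmap W Y) (f : gmap X Z) (g : gmap Y Z) :
  @is_pullback (GSet gT) W X Y Z a b f g -> is_pb a b f g.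
Proof.
case=> [comm univ]; split=> [w|x y exy].
  by have := congr1 (fun h : gmap W Z => h w) comm.
have [|u [[u1 u2] uU]] := univ gfree (gpoint x) (gpoint y).
  by apply: gmap_eq => c /=; rewrite !gfunP exy.
exists (u 1%g); split=> [|w [aw bw]].
  have := congr1 (fun h : gmap gfree X => h 1%g) u1.
  have := congr1 (fun h : gmap gfree Y => h 1%g) u2.
  by rewrite /= !act1 => -> ->.
rewrite (uU (gpoint w)) /= ?act1 //.
by split; apply: gmap_eq => c /=; rewrite gfunP ?aw ?bw.
Qed.

Lemma is_pb_sym W X Y Z (a : gmap W X) (b : gmap W Y) (f : gmap X Z) (g : gmap Y Z) :
  is_pb a b f g -> is_pb b a g f.
Proof.
case=> c u; split=> // x y e; have [w [[h1 h2] wU]] := u y x (esym e).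
by exists w; split=> // w' [? ?]; apply: wU.
Qed.

Definition gpb1 X Y Z (f : gmap X Z) (g : gmap Y Z) : gmap (gpb f g) X :=
  @GMap gT (gpb f g) X (fun u : pb_car f g => (val u).1) (fun _ _ => erefl).
Definition gpb2 X Y Z (f : gmap X Z) (g : gmap Y Z) : gmap (gpb f g) Y :=
  @GMap gT (gpb f g) Y (fun u : pb_car f g => (val u).2) (fun _ _ => erefl).

Lemma gpb_mk X Y Z (f : gmap X Z) (g : gmap Y Z) x y : f x = g y ->
  exists u : gpb f g, gpb1 f g u = x /\ gpb2 f g u = y.
Proof.
by move/eqP => e; exists (exist (fun u : X * Y => f u.1 == g u.2) (x, y) e).
Qed.

Lemma gpbE X Y Z (f : gmap X Z) (g : gmap Y Z) (u : gpb f g) :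
  f (gpb1 f g u) = g (gpb2 f g u).
Proof. exact: (eqP (valP u)). Qed.

Lemma gpb_inj X Y Z (f : gmap X Z) (g : gmap Y Z) (u v : gpb f g) :
  gpb1 f g u = gpb1 f g v -> gpb2 f g u = gpb2 f g v -> u = v.
Proof.
move=> e1 e2; apply: val_inj; move: e1 e2 => /=.
by case: (val u) (val v) => x y [x' y'] /= -> ->.
Qed.

Lemma gpb_is_pb X Y Z (f : gmap X Z) (g : gmap Y Z) : is_pb (gpb1 f g) (gpb2 f g) f g.
Proof.
split=> [w|x y exy]; first exact: gpbE.
have [u [u1 u2]] := gpb_mk exy; exists u; split=> // v [v1 v2].
by apply: gpb_inj; rewrite ?u1 ?u2 ?v1 ?v2.
Qed.

Lemma gsum_is_cop X Y : is_cop (ginl X Y) (ginr X Y).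
Proof.
split=> // [x y []|x y []|] //.
by case=> v; [left|right]; exists v.
Qed.

Lemma gincl_is_cop X (P : pred X) (Pinv : forall x g, P (gact X x g) = P x) :
  is_cop (gincl Pinv) (gincl (gcompl_inv Pinv)).
Proof.
split; try exact: gincl_inj.
- by move=> u v e; have := ginclP v; rewrite -e /= ginclP.
- move=> v; case Pv: (P v); [left|right]; first by exists (gsubmk Pinv Pv).
  have nPv : predC P v by rewrite /= Pv.
  by exists (gsubmk (gcompl_inv Pinv) nPv).
Qed.

Lemma pb_void X Y Z (f : gmap X Z) (g : gmap Y Z) : (forall x y, f x <> g y) ->
  is_pb (gvoid_map X) (gvoid_map Y) f g.
Proof. by move=> d; split=> [[]|x y /d]. Qed.

Lemma pb_inj X Z (f : gmap X Z) : injective f -> is_pb (gid X) (gid X) f f.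
Proof.
move=> fI; split=> // x y /fI <-; exists x; split=> // w [] //.
Qed.

Lemma pb_bij X Y (f : gmap X Y) : bijective f -> is_pb f f (gid Y) (gid Y).
Proof.
case=> g fK gK; split=> // x y /= <-; exists (g x); split=> [|w [<- _]]; by rewrite ?gK ?fK.
Qed.

Lemma gcopair_bij V1 V2 V (i1 : gmap V1 V) (i2 : gmap V2 V) :
  is_cop i1 i2 -> bijective (gcopair i1 i2).
Proof.
case=> I1 I2 dis cov; have [||g [fK gK]] := @gbij_inv _ _ (gcopair i1 i2).
- case=> x [] y /= e; first by rewrite (I1 _ _ e).
  + by case: (dis _ _ e).
  + by case: (dis _ _ (esym e)).
  + by rewrite (I2 _ _ e).
- by move=> v; case: (cov v) => -[x <-]; [exists (inl x)|exists (inr x)].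
- by exists g.
Qed.

Lemma cop_map V1 V2 V X (i1 : gmap V1 V) (i2 : gmap V2 V) (f1 : gmap V1 X) (f2 : gmap V2 X) :
  is_cop i1 i2 -> exists k : gmap V X, (forall a, k (i1 a) = f1 a) /\ (forall b, k (i2 b) = f2 b).
Proof.
move/gcopair_bij => [r rK Kr]; have [||g [gK Kg]] := @gbij_inv _ _ (gcopair i1 i2).
- exact: can_inj rK.
- by move=> v; exists (r v).
exists (gcomp (gcopair f1 f2) g); split=> [a|b] /=.
- by have /= -> := gK (inl a).
- by have /= -> := gK (inr b).
Qed.

Lemma gid_compl X Y (f : gmap X Y) : gcomp (gid Y) f = f.
Proof. exact: gmap_eq. Qed.
Lemma gid_compr X Y (f : gmap X Y) : gcomp f (gid X) = f.
Proof. exact: gmap_eq. Qed.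
Lemma gcompA X Y Z W (f : gmap Z W) (g : gmap Y Z) (h : gmap X Y) :
  gcomp f (gcomp g h) = gcomp (gcomp f g) h.
Proof. exact: gmap_eq. Qed.

Lemma gbij_iso X Y (f : gmap X Y) : bijective f ->
  exists i : @iso (GSet gT) X Y, iso_fun i = f.
Proof.
move=> [f' fK fK']; have [||g [gK Kg]] := @gbij_inv _ _ f.
- exact: can_inj fK.
- by move=> y; exists (f' y).
have e1 : @comp (GSet gT) _ _ _ g f = idm _ by apply: gmap_eq.
have e2 : @comp (GSet gT) _ _ _ f g = idm _ by apply: gmap_eq.
by exists (@Iso (GSet gT) X Y f g e1 e2).
Qed.

Lemma giso_bij X Y (i : @iso (GSet gT) X Y) : bijective (iso_fun i : gmap X Y).
Proof.
exists (iso_inv i : gmap Y X); first exact: giso_cancel.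
exact: (giso_cancel (iso_sym i)).
Qed.

End GSetFacts.

Arguments gpb1 {gT X Y Z} f g : simpl never.
Arguments gpb2 {gT X Y Z} f g : simpl never.

Notation "f ⊠ g" := (gprod_map f g) (at level 40, left associativity).
Notation "X ** Y" := (gprod X Y) (at level 40, left associativity).

(** * Presheaves and Mackey functors on points *)

(** Additivity forces the value on the empty G-set to have at most one element; [pinh] provides one,
    from which the zero of the presented group is made. *)
Record gpsh (gT : finGroupType) := GPsh {
  pob :> gset gT -> Type;
  pres : forall X Y, gmap X Y -> pob Y -> pob X;
  pres_id : forall X s, pres (gid X) s = s;
  pres_comp : forall X Y Z (f : gmap Y Z) (g : gmap X Y) s,
    pres (gcomp f g) s = pres g (pres f s);
  padd : forall X Y, bijective (fun s : pob (gsum X Y) =>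
                 (pres (ginl X Y) s, pres (ginr X Y) s));
  pinh : pob (gvoid gT) }.

Arguments pres {gT} D {X Y} f s : rename.

Section Presheaf.
Variable gT : finGroupType.
Implicit Types (X Y Z W S T U V E A : gset gT) (D : gpsh gT).

Lemma pres_bij D X Y (f : gmap X Y) : bijective f -> bijective (pres D f).
Proof.
move=> [f' fK fK']; have [||g [gK Kg]] := @gbij_inv _ _ _ f.
- exact: can_inj fK.
- by move=> y; exists (f' y).
exists (pres D g) => s; rewrite -pres_comp (_ : gcomp _ _ = gid _) ?pres_id //;
by apply: gmap_eq.
Qed.

Lemma padd_ex D V1 V2 V (i1 : gmap V1 V) (i2 : gmap V2 V) a b : is_cop i1 i2 ->
  exists s, pres D i1 s = a /\ pres D i2 s = b.
Proof.
move=> /gcopair_bij/(@pres_bij D)[r rK Kr]; have [j jK Kj] := padd D V1 V2.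
exists (r (j (a, b))).
have E1 s : pres D i1 s = pres D (ginl _ _) (pres D (gcopair i1 i2) s).
  by rewrite -pres_comp; congr pres; apply: gmap_eq.
have E2 s : pres D i2 s = pres D (ginr _ _) (pres D (gcopair i1 i2) s).
  by rewrite -pres_comp; congr pres; apply: gmap_eq.
by rewrite E1 E2 Kr; have := Kj (a, b) => -[-> ->].
Qed.

Lemma padd_inj D V1 V2 V (i1 : gmap V1 V) (i2 : gmap V2 V) s t : is_cop i1 i2 ->
  pres D i1 s = pres D i1 t -> pres D i2 s = pres D i2 t -> s = t.
Proof.
move=> /gcopair_bij/(@pres_bij D)/bij_inj rI e1 e2; apply: rI.
have /bij_inj jI := padd D V1 V2; apply: jI.
have E1 s' : pres D i1 s' = pres D (ginl _ _) (pres D (gcopair i1 i2) s').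
  by rewrite -pres_comp; congr pres; apply: gmap_eq.
have E2 s' : pres D i2 s' = pres D (ginr _ _) (pres D (gcopair i1 i2) s').
  by rewrite -pres_comp; congr pres; apply: gmap_eq.
by move: e1 e2; rewrite !E1 !E2 => -> ->.
Qed.

(** An empty [V] is the coproduct of itself with itself along two identities, so some element
    restricts along the identity both to [s] and to [t]. *)
Lemma pvoid_eq D V (s t : D V) : (V -> False) -> s = t.
Proof.
move=> V0; have cop : is_cop (gid V) (gid V).
  by split=> // [x|v]; case: (V0 _).
have [u [us ut]] := @padd_ex D _ _ _ _ _ s t cop.
by rewrite -us -ut.
Qed.

Definition void_to V (V0 : V -> False) : gmap V (gvoid gT).
Proof. by exists (fun v => match V0 v return void with end) => v; case: (V0 v). Defined.

Section MackeyFacts.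
Variable M : mackey gT.

Lemma mres_id X (s : M X) : mres M (gid X) s = s.
Proof. exact: (ma_res_id (mackeyP M)). Qed.
Lemma mres_comp X Y Z (f : gmap Y Z) (g : gmap X Y) s :
  mres M (gcomp f g) s = mres M g (mres M f s).
Proof. exact: (ma_res_comp (mackeyP M)). Qed.
Lemma mtr_id X (s : M X) : mtr M (gid X) s = s.
Proof. exact: (ma_tr_id (mackeyP M)). Qed.
Lemma mtr_comp X Y Z (f : gmap Y Z) (g : gmap X Y) s :
  mtr M (gcomp f g) s = mtr M f (mtr M g s).
Proof. exact: (ma_tr_comp (mackeyP M)). Qed.
Lemma mresD X Y (f : gmap X Y) s t : mres M f (s + t)%R = (mres M f s + mres M f t)%R.
Proof. exact: (ma_res_op (mackeyP M)). Qed.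
Lemma mtrD X Y (f : gmap X Y) s t : mtr M f (s + t)%R = (mtr M f s + mtr M f t)%R.
Proof. exact: (ma_tr_op (mackeyP M)). Qed.
Lemma mres0 X Y (f : gmap X Y) : mres M f 0%R = 0%R.
Proof. exact: (ma_res_e (mackeyP M)). Qed.
Lemma mtr0 X Y (f : gmap X Y) : mtr M f 0%R = 0%R.
Proof. exact: (ma_tr_e (mackeyP M)). Qed.

Lemma mbase W X Y Z (a : gmap W X) (b : gmap W Y) (f : gmap X Z) (g : gmap Y Z) s :
  is_pb a b f g -> mres M g (mtr M f s) = mtr M b (mres M a s).
Proof. by move/is_pb_pullback => pb; apply: (ma_double_coset (mackeyP M) pb). Qed.

Lemma mres_is_additive X Y (f : gmap X Y) : zmod_morphism (mres M f).
Proof. by move=> s t; apply/eqP; rewrite -subr_eq0 opprB addrA -mresD subrK subrr. Qed.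
Lemma mtr_is_additive X Y (f : gmap X Y) : zmod_morphism (mtr M f).
Proof. by move=> s t; apply/eqP; rewrite -subr_eq0 opprB addrA -mtrD subrK subrr. Qed.
HB.instance Definition _ X Y (f : gmap X Y) :=
  GRing.isZmodMorphism.Build (M Y) (M X) (mres M f) (mres_is_additive f).
HB.instance Definition _ X Y (f : gmap X Y) :=
  GRing.isZmodMorphism.Build (M X) (M Y) (mtr M f) (mtr_is_additive f).

Definition psh_of_mackey : gpsh gT :=
  @GPsh gT (fun X => M X) (@mres gT M) (@mres_id) (@mres_comp)
    (ma_additive (mackeyP M)) 0%R.

Lemma madd_ex V1 V2 V (i1 : gmap V1 V) (i2 : gmap V2 V) (a : M V1) (b : M V2) :
  is_cop i1 i2 -> exists s, mres M i1 s = a /\ mres M i2 s = b.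
Proof. exact: (@padd_ex psh_of_mackey). Qed.

Lemma madd_inj V1 V2 V (i1 : gmap V1 V) (i2 : gmap V2 V) (s t : M V) : is_cop i1 i2 ->
  mres M i1 s = mres M i1 t -> mres M i2 s = mres M i2 t -> s = t.
Proof. exact: (@padd_inj psh_of_mackey). Qed.

Lemma mvoid_eq V (s t : M V) : (V -> False) -> s = t.
Proof. exact: (@pvoid_eq psh_of_mackey). Qed.

Lemma mres_tr_inj X Y (f : gmap X Y) s : injective f -> mres M f (mtr M f s) = s.
Proof. by move=> /pb_inj /mbase ->; rewrite mtr_id mres_id. Qed.

Lemma mres_tr_disj X Y Z (f : gmap X Z) (g : gmap Y Z) s :
  (forall x y, f x <> g y) -> mres M g (mtr M f s) = 0%R.
Proof.
move=> /pb_void/mbase->; rewrite [mres _ _ _](_ : _ = 0%R) ?mtr0 //.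
exact: mvoid_eq.
Qed.

Lemma mtr_res_bij X Y (f : gmap X Y) s : bijective f -> mtr M f (mres M f s) = s.
Proof. by move=> /pb_bij /mbase <-; rewrite mtr_id mres_id. Qed.

Lemma mdecomp V1 V2 V (i1 : gmap V1 V) (i2 : gmap V2 V) s : is_cop i1 i2 ->
  s = (mtr M i1 (mres M i1 s) + mtr M i2 (mres M i2 s))%R.
Proof.
move=> cop; have [I1 I2 dis _] := cop; apply: (madd_inj cop); rewrite mresD.
- by rewrite mres_tr_inj // mres_tr_disj ?addr0 // => x y /esym/dis.
- by rewrite mres_tr_inj // mres_tr_disj ?add0r // => x y /dis.
Qed.

End MackeyFacts.
End Presheaf.

(** * Group completion *)

Lemma sig_eq (A : Type) (P : A -> Prop) (u v : {x | P x}) : sval u = sval v -> u = v.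
Proof. by case: u v => x p [y q] /= e; subst y; rewrite (Prop_irrelevance p q). Qed.

Section Quotient.
Variables (T : Type) (e : T -> T -> Prop).

Definition quo := {A : T -> Prop | exists x, A = e x}.
Definition cls (x : T) : quo := exist _ (e x) (ex_intro _ x erefl).
Definition repr (a : quo) : T := sval (cid (svalP a)).

Hypotheses (eR : forall x, e x x) (eS : forall x y, e x y -> e y x)
  (eT : forall x y z, e x y -> e y z -> e x z).

Lemma cls_eq x y : cls x = cls y <-> e x y.
Proof.
split=> [/(congr1 sval) /= E|exy]; first by rewrite E.
apply: sig_eq => /=; apply: funext => z; apply: propext; split; last exact: eT.
exact: eT (eS exy).
Qed.

Lemma cls_repr a : cls (repr a) = a.
Proof. by apply: sig_eq; rewrite /= /repr; case: cid. Qed.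

Lemma repr_cls x : e (repr (cls x)) x.
Proof. by apply/cls_eq; rewrite cls_repr. Qed.

Lemma quoP (P : quo -> Prop) : (forall x, P (cls x)) -> forall a, P a.
Proof. by move=> H a; rewrite -(cls_repr a). Qed.

End Quotient.

(** A commutative monoid up to an equivalence: disjoint sums of formal transfers satisfy the monoid
    laws only up to the generated relation. *)
Record premonoid := PreMonoid {
  pm_car :> Type;
  pm_eq : pm_car -> pm_car -> Prop;
  pm_op : pm_car -> pm_car -> pm_car;
  pm_zero : pm_car;
  pm_refl : forall x, pm_eq x x;
  pm_sym : forall x y, pm_eq x y -> pm_eq y x;
  pm_trans : forall x y z, pm_eq x y -> pm_eq y z -> pm_eq x z;
  pm_cong : forall x y z, pm_eq x y -> pm_eq (pm_op z x) (pm_op z y);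
  pm_opC : forall x y, pm_eq (pm_op x y) (pm_op y x);
  pm_opA : forall x y z, pm_eq (pm_op x (pm_op y z)) (pm_op (pm_op x y) z);
  pm_op0 : forall x, pm_eq (pm_op pm_zero x) x }.

Definition pmquo (P : premonoid) : Type := quo (@pm_eq P).
HB.instance Definition _ (P : premonoid) := gen_eqMixin (pmquo P).
HB.instance Definition _ (P : premonoid) := gen_choiceMixin (pmquo P).

Section PremonoidQuotient.
Variable P : premonoid.

Definition pmcls (x : P) : pmquo P := cls (@pm_eq P) x.

Lemma pmcls_eq x y : pmcls x = pmcls y <-> pm_eq x y.
Proof. by apply: cls_eq; [exact: pm_refl|exact: pm_sym|exact: pm_trans]. Qed.

Lemma pmclsP (Q : pmquo P -> Prop) : (forall x, Q (pmcls x)) -> forall a, Q a.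
Proof. exact: quoP. Qed.

Definition pmadd (a b : pmquo P) : pmquo P := pmcls (pm_op (repr a) (repr b)).

Lemma pmaddE x y : pmadd (pmcls x) (pmcls y) = pmcls (pm_op x y).
Proof.
have rP z : pm_eq (repr (pmcls z)) z.
  by apply: repr_cls; [exact: pm_refl|exact: pm_sym|exact: pm_trans].
apply/pmcls_eq; apply: (pm_trans (pm_cong _ (rP y))).
apply: (pm_trans (pm_opC _ _)); apply: (pm_trans (pm_cong _ (rP x))).
exact: pm_opC.
Qed.

Lemma pmaddA : associative pmadd.
Proof.
elim/pmclsP => x; elim/pmclsP => y; elim/pmclsP => z; rewrite !pmaddE.
by apply/pmcls_eq; apply: pm_opA.
Qed.

Lemma pmaddC : commutative pmadd.
Proof.
elim/pmclsP => x; elim/pmclsP => y; rewrite !pmaddE.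
by apply/pmcls_eq; apply: pm_opC.
Qed.

Lemma pmadd0 : left_id (pmcls (pm_zero P)) pmadd.
Proof. by elim/pmclsP => x; rewrite pmaddE; apply/pmcls_eq; apply: pm_op0. Qed.

End PremonoidQuotient.

HB.instance Definition _ (P : premonoid) :=
  GRing.isNmodule.Build (pmquo P) (@pmaddA P) (@pmaddC P) (@pmadd0 P).

Lemma pmclsD (P : premonoid) (x y : P) :
  pmcls (pm_op x y) = (pmcls x + pmcls y)%R.
Proof. by rewrite -pmaddE. Qed.

Section GroupCompletion.
Variable C : nmodType.
Local Open Scope ring_scope.

(** The summand [z] gives transitivity in a monoid that is not known to be cancellative. *)
Definition gceq (p q : C * C) := exists z, p.1 + q.2 + z = q.1 + p.2 + z.

Lemma gceq_refl p : gceq p p. Proof. by exists 0. Qed.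
Lemma gceq_sym p q : gceq p q -> gceq q p.
Proof. by case=> z e; exists z. Qed.
Lemma gceq_trans p q r : gceq p q -> gceq q r -> gceq p r.
Proof.
case: p q r => [p1 p2] [q1 q2] [r1 r2] [z /= e] [w /= f].
exists (q1 + q2 + z + w) => /=.
rewrite (_ : p1 + r2 + _ = (p1 + q2 + z) + (q1 + r2 + w)); last first.
  by rewrite (AC (2*4) ((1*4*5)*(3*2*6))).
by rewrite e f (AC (3*3) ((4*2)*(1*5*3*6))) /= .
Qed.

Definition gcar : Type := quo gceq.
HB.instance Definition _ := gen_eqMixin gcar.
HB.instance Definition _ := gen_choiceMixin gcar.

Definition gcls (p : C * C) : gcar := cls gceq p.

Lemma gcls_eq p q : gcls p = gcls q <-> gceq p q.
Proof. by apply: cls_eq; [exact: gceq_refl|exact: gceq_sym|exact: gceq_trans]. Qed.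

Lemma gclsP (Q : gcar -> Prop) : (forall x, Q (gcls x)) -> forall a, Q a.
Proof. exact: quoP. Qed.

Definition gadd (a b : gcar) : gcar :=
  gcls ((repr a).1 + (repr b).1, (repr a).2 + (repr b).2).
Definition gopp (a : gcar) : gcar := gcls ((repr a).2, (repr a).1).

Lemma gc_repr p : gceq (repr (gcls p)) p.
Proof. by apply: repr_cls; [exact: gceq_refl|exact: gceq_sym|exact: gceq_trans]. Qed.

Lemma gaddE p q : gadd (gcls p) (gcls q) = gcls (p.1 + q.1, p.2 + q.2).
Proof.
apply/gcls_eq; have [z e] := gc_repr p; have [w f] := gc_repr q.
exists (z + w) => /=.
rewrite (AC (2*2*2) ((1*3*5)*(2*4*6))) /= e f.
by rewrite (AC (3*3) ((1*4)*(2*5)*(3*6))).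
Qed.

Lemma goppE p : gopp (gcls p) = gcls (p.2, p.1).
Proof.
apply/gcls_eq; have [z e] := gc_repr p; exists z => /=.
by rewrite [(repr _).2 + _]addrC -e [_ + p.2]addrC.
Qed.

Lemma gaddA : associative gadd.
Proof. by elim/gclsP => x; elim/gclsP => y; elim/gclsP => z; rewrite !gaddE /= !addrA. Qed.
Lemma gaddC : commutative gadd.
Proof. by elim/gclsP => x; elim/gclsP => y; rewrite !gaddE addrC [_.2 + _]addrC. Qed.
Lemma gadd0 : left_id (gcls (0, 0)) gadd.
Proof. by elim/gclsP => -[x y]; rewrite !gaddE /= !add0r. Qed.
Lemma gaddN : left_inverse (gcls (0, 0)) gopp gadd.
Proof.
elim/gclsP => -[x y]; rewrite goppE gaddE; apply/gcls_eq; exists 0 => /=.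
by rewrite !addr0 !add0r addrC.
Qed.

HB.instance Definition _ := GRing.isZmodule.Build gcar gaddA gaddC gadd0 gaddN.

Definition gin (x : C) : gcar := gcls (x, 0).

Lemma ginD x y : gin (x + y) = gin x + gin y.
Proof.
by rewrite -[RHS]/(gadd (gin x) (gin y)) /gin gaddE /= addr0.
Qed.
Lemma gin_surj a : exists x y, a = gin x - gin y.
Proof.
elim/gclsP: a => -[x y]; exists x, y.
rewrite -[RHS]/(gadd (gin x) (gopp (gin y))) /gin goppE gaddE /=.
by rewrite addr0 add0r.
Qed.
Lemma gin_eq x y : gin x = gin y <-> exists z, x + z = y + z.
Proof.
rewrite /gin; split=> [/gcls_eq[z]|[z e]]; last first.
  by apply/gcls_eq; exists z; rewrite /= !addr0.
by rewrite /= !addr0; exists z.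
Qed.

End GroupCompletion.

(** * Mackey functors presented by generators and transfer relations *)

(* [irel h d d'] imposes on generators that [d] is the transfer of [d'] along [h]. *)
Record input (gT : finGroupType) := Input {
  ipsh :> gpsh gT;
  irel : forall S' S, gmap S' S -> ipsh S -> ipsh S' -> Prop;
  irel_iso : forall S' S (h : gmap S' S) d, bijective h -> irel h d (pres ipsh h d);
  irel_pb : forall W S' U S (a : gmap W S') (b : gmap W U) (h : gmap S' S)
      (g : gmap U S) d d', is_pb a b h g -> irel h d d' ->
    irel b (pres ipsh g d) (pres ipsh a d');
  irel_cop : forall V1 V2 V V' W (i1 : gmap V1 V) (i2 : gmap V2 V) (h : gmap V' V2)
      (j1 : gmap V1 W) (j2 : gmap V' W) (k : gmap W V) d d',
    is_cop i1 i2 -> is_cop j1 j2 ->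
    gcomp k j1 = i1 -> gcomp k j2 = gcomp i2 h ->
    pres ipsh j1 d' = pres ipsh i1 d ->
    irel h (pres ipsh i2 d) (pres ipsh j2 d') -> irel k d d' }.

Arguments irel {gT} D {S' S} h d d' : rename.

Section Pairing.
Variables (gT : finGroupType) (D : input gT).

Record is_pairing (P : mackey gT) (nu : forall S, D S -> P S) : Prop := IsPairing {
  pairing_res : forall S T (f : gmap S T) d, nu S (pres D f d) = mres P f (nu T d);
  pairing_tr : forall S' S (h : gmap S' S) d d', irel D h d d' ->
    nu S d = mtr P h (nu S' d') }.

Definition universal (L : mackey gT) (nu : forall S, D S -> L S) : Prop :=
  is_pairing nu /\
  forall (P : mackey gT) (mu : forall S, D S -> P S), is_pairing mu ->
    exists! phi : mackey_hom L P, forall S d, phi S (nu S d) = mu S d.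

(** Both maps solve the extension problem for the pairing obtained by composing [nu] with [g]. *)
Lemma universal_ext (L P : mackey gT) (nu : forall S, D S -> L S)
    (f g : mackey_hom L P) : universal nu ->
  (forall S d, f S (nu S d) = g S (nu S d)) -> f = g.
Proof.
case=> [[pr pt] univ] efg.
have [|phi [_ phiU]] := univ P (fun S d => g S (nu S d)).
  split=> [S T h d|S' S h d d' R]; first by rewrite pr mh_res.
  by rewrite (pt _ _ _ _ _ R) mh_tr.
by rewrite -(phiU f efg) -(phiU g).
Qed.

End Pairing.

(* The G-sets over [Z] are coded by functions on natural numbers, since the
   universe of finite types lies above that of abelian groups. *)
Section Codes.
Variable gT : finGroupType.
Implicit Types (X Y Z S T : gset gT).

Record gcode := GCode {
  gc_n : nat;
  gc_a : nat -> nat -> nat;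
  gc_wf : exists A : {action gT &-> 'I_gc_n}, forall i g,
    A i g = gc_a i (enum_rank g) :> nat }.

Definition gdecode (c : gcode) : gset gT := MkGSet (sval (cid (gc_wf c))).

Lemma gcode_ex X : exists c, exists f : gmap (gdecode c) X, bijective f.
Proof.
pose act (i : 'I_#|X|) (g : gT) := enum_rank (gact X (enum_val i) g).
have actP : is_action setT act.
  apply: is_total_action => [i|i g h]; rewrite /act ?act1 ?enum_valK //.
  by rewrite enum_rankK actM.
pose A : {action gT &-> 'I_#|X|} := Action actP.
(* Arguments out of range get the filler 0, which [gc_wf] never reads. *)
pose a (i j : nat) : nat :=
  if insub i : option 'I_#|X| is Some i' then
    if insub j : option 'I_#|gT| is Some j' then A i' (enum_val j') else 0
  else 0.
have wf : exists A : {action gT &-> 'I_#|X|}, forall i g, A i g = a i (enum_rank g) :> nat.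
  by exists A => i g; rewrite /a !valK enum_rankK.
exists (GCode wf).
have eA (i : 'I_#|X|) g : gact (gdecode (GCode wf)) i g = A i g.
  by apply: ord_inj; rewrite /gdecode /=; case: cid => /= B ->; rewrite /a !valK enum_rankK.
have fP (i : gdecode (GCode wf)) g :
    enum_val (gact (gdecode (GCode wf)) i g : 'I_#|X|) = gact X (enum_val (i : 'I_#|X|)) g.
  by rewrite eA /= /act enum_rankK.
exists (GMap (fun i : gdecode (GCode wf) => enum_val (i : 'I_#|X|)) fP).
by exists (@enum_rank X) => x; rewrite /= ?enum_valK ?enum_rankK.
Qed.

Variable D : gpsh gT.

(** A formal transfer: it stands for the transfer along [bf] of the generator [bd]. *)
Record bobj Z := BObj { bS : gset gT; bf : gmap bS Z; bd : D bS }.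

Record sobj Z := SObj {
  so_c : gcode;
  so_f : nat -> nat;
  so_wf : exists f : gmap (gdecode so_c) Z, forall i : 'I_(gc_n so_c),
    enum_rank (f i) = so_f i :> nat;
  so_d : D (gdecode so_c) }.

Definition sdec Z (x : sobj Z) : bobj Z := BObj (sval (cid (so_wf x))) (so_d x).

Definition bisom Z (x y : bobj Z) := exists h : gmap (bS y) (bS x),
  [/\ bijective h, bf y = gcomp (bf x) h & bd y = pres D h (bd x)].

Lemma senc_ex Z (x : bobj Z) : exists y, bisom x (sdec y).
Proof.
case: x => S f d; have [c [h hb]] := gcode_ex S.
pose a (i : nat) : nat :=
  if insub i : option 'I_(gc_n c) is Some i' then enum_rank (f (h i')) else 0.
have wf : exists f : gmap (gdecode c) Z, forall i : 'I_(gc_n c), enum_rank (f i) = a i :> nat.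
  by exists (gcomp f h) => i; rewrite /a valK.
exists (SObj wf (pres D h d)); exists h; split=> //=.
apply: gmap_eq => i /=; case: cid => /= k kP.
apply: enum_rank_inj; apply: ord_inj.
by rewrite (kP i) /a valK.
Qed.

Definition senc Z (x : bobj Z) : sobj Z := sval (cid (senc_ex x)).
Lemma sencP Z (x : bobj Z) : bisom x (sdec (senc x)).
Proof. by rewrite /senc; case: cid. Qed.

End Codes.

(** * Formal transfers of generators and their disjoint sums *)

Section Objects.
Variables (gT : finGroupType) (D : input gT).
Implicit Types (X Y Z S T : gset gT).

(** The relation makes [bd x] the transfer of [bd y] along [h], so by functoriality of transfers
    both formal transfers must get the same value. *)
Definition bstep Z (x y : bobj D Z) := exists h : gmap (bS y) (bS x),
  bf y = gcomp (bf x) h /\ irel D h (bd x) (bd y).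

Inductive beq Z : bobj D Z -> bobj D Z -> Prop :=
| beq_step x y : bstep x y -> beq x y
| beq_refl x : beq x x
| beq_sym x y : beq x y -> beq y x
| beq_trans x y z : beq x y -> beq y z -> beq x z.

Lemma beq_iso Z (x y : bobj D Z) : bisom x y -> beq x y.
Proof.
by case=> h [hb ef ed]; apply: beq_step; exists h; split=> //; rewrite ed; apply: irel_iso.
Qed.

(** Stated as a relation, so that pullbacks and pushforwards of sums are again sums without an
    intervening isomorphism. *)
Definition is_bsum Z (x y z : bobj D Z) := exists i1 : gmap (bS x) (bS z),
  exists i2 : gmap (bS y) (bS z),
  [/\ is_cop i1 i2, gcomp (bf z) i1 = bf x, gcomp (bf z) i2 = bf y,
      pres D i1 (bd z) = bd x & pres D i2 (bd z) = bd y].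

Lemma bsum_ex Z (x y : bobj D Z) : exists z, is_bsum x y z.
Proof.
have [d [d1 d2]] := padd_ex (bd x) (bd y) (gsum_is_cop (bS x) (bS y)).
exists (BObj (gcopair (bf x) (bf y)) d); exists (ginl _ _), (ginr _ _); split=> //.
- exact: gsum_is_cop.
- exact: gmap_eq.
- exact: gmap_eq.
Qed.

Definition bsum Z (x y : bobj D Z) := sval (cid (bsum_ex x y)).
Lemma bsumP Z (x y : bobj D Z) : is_bsum x y (bsum x y).
Proof. by rewrite /bsum; case: cid. Qed.

(** The axiom [irel_cop] is made for this: a relation between second summands extends to the sums
    along a map that matches the first summands identically. *)
Lemma is_bsum_step Z (x y y' z z' : bobj D Z) :
  is_bsum x y z -> is_bsum x y' z' -> bstep y y' -> bstep z z'.
Proof.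
move=> [i1 [i2 [cop f1 f2 d1 d2]]] [j1 [j2 [cop' f1' f2' d1' d2']]] [h [eh R]].
have [k [k1 k2]] := cop_map i1 (gcomp i2 h) cop'.
exists k; split.
- apply: gmap_eq => w; have [J1 J2 dis cov] := cop'; case: (cov w) => -[a <-] /=.
  + by rewrite k1 -[RHS]/(gcomp (bf z) i1 a) f1 -f1'.
  + rewrite k2 -[RHS]/(gcomp (gcomp (bf z) i2) h a) f2 -[LHS]/(gcomp (bf z') j2 a) f2' eh.
    by [].
- by apply: (irel_cop (h := h) cop cop'); rewrite ?d1 ?d1' ?d2 ?d2' //; apply: gmap_eq.
Qed.

Lemma is_bsum_cong Z (x y y' : bobj D Z) : beq y y' -> 
  forall z z', is_bsum x y z -> is_bsum x y' z' -> beq z z'.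
Proof.
(* Two sums of the same objects are joined by a step, with the identity of the second summand as the
   underlying relation. *)
have isob (u v z z' : bobj D Z) : is_bsum u v z -> is_bsum u v z' -> beq z z'.
  move=> s s'; apply: beq_step; apply: (is_bsum_step s s'); exists (gid _).
  split; first by apply: gmap_eq.
  by rewrite -[in X in irel _ _ _ X](pres_id (bd v)); apply: irel_iso; exists id.
elim=> {y y'} [y y' st z z' s s'|y|y y' _ IH z z' s s'|y1 y2 y3 _ IH1 _ IH2 z z' s s'].
- by apply: beq_step; apply: (is_bsum_step s s').
- exact: isob.
- by apply: beq_sym; apply: IH.
- have sm := bsumP x y2; apply: (@beq_trans _ _ (bsum x y2)); first exact: IH1.
  exact: IH2.
Qed.

Lemma is_bsumC Z (x y z : bobj D Z) : is_bsum x y z -> is_bsum y x z.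
Proof.
move=> [i1 [i2 [[I1 I2 dis cov] f1 f2 d1 d2]]]; exists i2, i1; split=> //.
split=> // [a b /esym/dis|v] //; case: (cov v); [right|left] => //.
Qed.

Lemma is_bsum_beq Z (x y x' y' z z' : bobj D Z) : beq x x' -> beq y y' ->
  is_bsum x y z -> is_bsum x' y' z' -> beq z z'.
Proof.
move=> ex ey s s'; have sm := bsumP x y'.
apply: (beq_trans (is_bsum_cong ey s sm)).
by apply: (is_bsum_cong ex (is_bsumC sm) (is_bsumC s')).
Qed.

Lemma is_bsumA Z (x y z xy yz u v : bobj D Z) :
  is_bsum y z yz -> is_bsum x yz u -> is_bsum x y xy -> is_bsum xy z v -> beq u v.
Proof.
move=> [a1 [a2 [ca af1 af2 ad1 ad2]]] [b1 [b2 [cb bf1 bf2 bd1 bd2]]].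
move=> [c1 [c2 [cc cf1 cf2 cd1 cd2]]] [e1 [e2 [ce ef1 ef2 ed1 ed2]]].
apply: beq_sym; apply: (@is_bsum_cong _ xy z z (beq_refl z)); first by exists e1, e2; split.
have [k [k1 k2]] := cop_map b1 (gcomp b2 a1) cc.
have K1 : gcomp k c1 = b1 by apply: gmap_eq.
have K2 : gcomp k c2 = gcomp b2 a1 by apply: gmap_eq.
exists k, (gcomp b2 a2).
move: ca cb cc => [A1 A2 Ad Ac] [B1 B2 Bd Bc] [C1 C2 Cd Cc]; split.
- split.
  + move=> w w'; case: (Cc w) => -[p <-]; case: (Cc w') => -[q <-].
    * by rewrite !k1 => /B1->.
    * by rewrite k1 k2 => /Bd.
    * by rewrite k1 k2 => /esym/Bd.
    * by rewrite !k2 => /B2/A1->.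
  + by move=> p q /= /B2/A2.
  + move=> w q /=; case: (Cc w) => -[p <-]; rewrite ?k1 ?k2 /=; first by move/Bd.
    by move/B2/Ad.
  + move=> t; case: (Bc t) => -[p <-]; first by left; exists (c1 p).
    case: (Ac p) => -[q <-]; first by left; exists (c2 q); rewrite k2.
    by right; exists q.
- apply: gmap_eq => w; case: (Cc w) => -[p <-] /=; rewrite ?k1 ?k2 /=.
  + by rewrite -[LHS]/(gcomp (bf u) b1 p) bf1 -cf1.
  + by rewrite -[LHS]/(gcomp (gcomp (bf u) b2) a1 p) bf2 af1 -cf2.
- by rewrite gcompA bf2 af2.
- apply: (padd_inj (And4 C1 C2 Cd Cc)); rewrite -pres_comp ?K1 ?K2 ?bd1 ?cd1 //.
  by rewrite pres_comp bd2 ad1 cd2.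
- by rewrite pres_comp bd2 ad2.
Qed.

Definition bzero Z : bobj D Z := BObj (gvoid_map Z) (pinh D).

Lemma is_bsum0 Z (x z : bobj D Z) : (bS z -> False) -> is_bsum z x x.
Proof.
move=> z0; have [f fP] : exists f : gmap (bS z) (bS x), True.
  by exists (gcomp (gvoid_map _) (void_to z0)).
exists f, (gid _); split.
- split; [by move=> u; case: (z0 u) | by [] | by move=> u; case: (z0 u) |].
  by move=> v; right; exists v.
- by apply: gmap_eq => u; case: (z0 u).
- exact: gmap_eq.
- exact: pvoid_eq.
- exact: pres_id.
Qed.

End Objects.

(** * The Mackey functor presented by an input *)

Section Presented.
Variables (gT : finGroupType) (D : input gT).
Implicit Types (X Y Z S T : gset gT).

Section OneObject.
Variable Z : gset gT.
Implicit Types x y z : bobj D Z.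

Lemma senc_beq x : beq (sdec (senc x)) x.
Proof. by apply: beq_sym; apply: beq_iso; apply: sencP. Qed.

Definition lpm : premonoid.
Proof.
refine (@PreMonoid (sobj D Z) (fun x y : sobj D Z => @beq gT D Z (sdec x) (sdec y))
  (fun x y : sobj D Z => senc (@bsum gT D Z (sdec x) (sdec y))) (senc (bzero D Z)) _ _ _ _ _ _ _).
- move=> x; exact: beq_refl.
- move=> x y; exact: beq_sym.
- move=> x y z; exact: beq_trans.
- move=> x y z e; apply: (beq_trans (senc_beq _)); apply: beq_sym.
  apply: (beq_trans (senc_beq _)); apply: beq_sym.
  exact: (is_bsum_beq (beq_refl _) e (bsumP _ _) (bsumP _ _)).
- move=> x y; apply: (beq_trans (senc_beq _)); apply: beq_sym.
  apply: (beq_trans (senc_beq _)); apply: beq_sym.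
  exact: (is_bsum_beq (beq_refl _) (beq_refl _) (bsumP _ _) (is_bsumC (bsumP _ _))).
- move=> x y z; apply: (beq_trans (senc_beq _)); apply: beq_sym.
  apply: (beq_trans (senc_beq _)); apply: beq_sym.
  have s1 := bsumP (sdec x) (bsum (sdec y) (sdec z)).
  have s2 := bsumP (bsum (sdec x) (sdec y)) (sdec z).
  apply: (beq_trans (is_bsum_beq (beq_refl _) (senc_beq _) (bsumP _ _) s1)).
  apply: (beq_trans (is_bsumA (bsumP _ _) s1 (bsumP _ _) s2)).
  exact: (is_bsum_beq (beq_sym (senc_beq _)) (beq_refl _) s2 (bsumP _ _)).
- move=> x; apply: (beq_trans (senc_beq _)).
  apply: (is_bsum_beq (senc_beq _) (beq_refl _) (bsumP _ _)).
  by apply: is_bsum0; case.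
Defined.

(* Sealed, since unification must not unfold the quotients. *)
Lemma lgrp_pack : {G : zmodType & {k : bobj D Z -> G |
  [/\ forall x y, beq x y -> k x = k y,
      forall x y z, is_bsum x y z -> k z = (k x + k y)%R,
      forall a, exists x y, a = (k x - k y)%R &
      forall x y, k x = k y -> exists z, beq (bsum x z) (bsum y z)]}}.
Proof.
exists (gcar (pmquo lpm)), (fun x => gin (pmcls (senc x : lpm))).
have kdec (u : lpm) : gin (pmcls (senc (sdec (u : sobj D Z)) : lpm)) = gin (pmcls u).
  by congr gin; apply/pmcls_eq; apply: senc_beq.
split=> [x y e|x y z s|a|x y].
- congr gin; apply/pmcls_eq; rewrite /=.
  by apply: (beq_trans (senc_beq _)); apply: beq_sym; apply: (beq_trans (senc_beq _)); apply: beq_sym.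
- rewrite -ginD -pmclsD; congr gin; apply/pmcls_eq => /=.
  apply: (beq_trans (senc_beq _)); apply: beq_sym; apply: (beq_trans (senc_beq _)).
  exact: (is_bsum_beq (senc_beq _) (senc_beq _) (bsumP _ _) s).
- have [u [v ->]] := gin_surj a; elim/pmclsP: u => u; elim/pmclsP: v => v.
  by exists (sdec (u : sobj D Z)), (sdec (v : sobj D Z)); rewrite !kdec.
- move=> /gin_eq[u]; elim/pmclsP: u => u; rewrite -!pmclsD => /pmcls_eq /= e.
  exists (sdec (u : sobj D Z)).
  have h t : beq (bsum t (sdec (u : sobj D Z))) (sdec (senc (bsum (sdec (senc t)) (sdec u)))).
    apply: beq_sym; apply: (beq_trans (senc_beq _)).
    exact: (is_bsum_beq (senc_beq _) (beq_refl _) (bsumP _ _) (bsumP _ _)).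
  exact: (beq_trans (h x) (beq_trans e (beq_sym (h y)))).
Qed.

Definition lgrp : zmodType := projT1 lgrp_pack.
Definition lk : bobj D Z -> lgrp := sval (projT2 lgrp_pack).

Lemma lk_beq x y : beq x y -> lk x = lk y.
Proof. by have [h _ _ _] := svalP (projT2 lgrp_pack); apply: h. Qed.

Lemma lk_sum x y z : is_bsum x y z -> lk z = (lk x + lk y)%R.
Proof. by have [_ h _ _] := svalP (projT2 lgrp_pack); apply: h. Qed.

Lemma lk_surj a : exists x y, a = (lk x - lk y)%R.
Proof. by have [_ _ h _] := svalP (projT2 lgrp_pack); apply: h. Qed.

Lemma lk_eq x y : lk x = lk y -> exists z, beq (bsum x z) (bsum y z).
Proof. by have [_ _ _ h] := svalP (projT2 lgrp_pack); apply: h. Qed.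

Lemma lk0 z : (bS z -> False) -> lk z = 0%R.
Proof.
move=> z0; have /lk_sum := is_bsum0 z z0.
by rewrite -[LHS]addr0 => /addrI.
Qed.

Lemma lk_ind (G : zmodType) (f g : lgrp -> G) :
  {morph f : s t / (s + t)%R} -> {morph g : s t / (s + t)%R} ->
  (forall x, f (lk x) = g (lk x)) -> forall a, f a = g a.
Proof.
move=> fD gD e a; have [x [y ->]] := lk_surj a; apply: (addIr (f (lk y))).
by rewrite -fD subrK e [in RHS]e -gD subrK.
Qed.

(** A chosen difference [lk x - lk y] goes to [c x - c y]. If two differences agree, [lk_eq] relates
    the cross sums after a common summand is added, and this summand cancels in [G]. *)
Lemma lext_ex (G : zmodType) (c : bobj D Z -> G) :
  (forall x y, bstep x y -> c x = c y) ->
  (forall x y z, is_bsum x y z -> c z = (c x + c y)%R) ->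
  exists f : lgrp -> G, {morph f : s t / (s + t)%R} /\ forall x, f (lk x) = c x.
Proof.
move=> cst csum; have ceq x y : beq x y -> c x = c y.
  by elim=> {x y} [x y /cst|x|x y _ ->|x y z _ -> _ ->].
pose f a : G := let p := cid (lk_surj a) in (c (sval p) - c (sval (cid (svalP p))))%R.
have fP a x y : a = (lk x - lk y)%R -> f a = (c x - c y)%R.
  rewrite /f; case: cid => x' /= ex'; case: cid => y' /= -> /eqP.
  rewrite subr_eq addrAC eq_sym subr_eq => /eqP.
  rewrite -(lk_sum (bsumP x y')) -(lk_sum (bsumP x' y)) => /lk_eq[z].
  move=> /ceq; rewrite !(csum _ _ _ (bsumP _ _)) => /addIr e.
  by apply/eqP; rewrite subr_eq addrAC eq_sym subr_eq e.
exists f; split=> [a b|x]; last first.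
  have z0 : bS (bzero D Z) -> False by case.
  rewrite (@fP _ x (bzero D Z)) ?(lk0 z0) ?subr0 //.
  have /csum : is_bsum (bzero D Z) x x by apply: is_bsum0.
  by rewrite -[LHS]add0r => /addIr <-; rewrite subr0.
have [x [y ea]] := lk_surj a; have [x' [y' eb]] := lk_surj b.
have eab : (a + b = lk (bsum x x') - lk (bsum y y'))%R.
  rewrite ea eb (lk_sum (bsumP x x')) (lk_sum (bsumP y y')) opprD; exact: addrACA.
rewrite (fP _ _ _ ea) (fP _ _ _ eb) (fP _ _ _ eab).
rewrite (csum _ _ _ (bsumP x x')) (csum _ _ _ (bsumP y y')) opprD; exact: addrACA.
Qed.

End OneObject.

(** The double coset formula read as a definition of restriction on formal transfers. *)
Definition is_bpull X Z (g : gmap X Z) (x : bobj D Z) (y : bobj D X) :=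
  exists a : gmap (bS y) (bS x), is_pb a (bf y) (bf x) g /\ bd y = pres D a (bd x).

Definition bpull X Z (g : gmap X Z) (x : bobj D Z) : bobj D X :=
  BObj (gpb2 (bf x) g) (pres D (gpb1 (bf x) g) (bd x)).

Lemma bpullP X Z (g : gmap X Z) (x : bobj D Z) : is_bpull g x (bpull g x).
Proof. by exists (gpb1 (bf x) g); split=> //; apply: gpb_is_pb. Qed.

Lemma bpull_step X Z (g : gmap X Z) x x' y y' :
  is_bpull g x y -> is_bpull g x' y' -> bstep x x' -> bstep y y'.
Proof.
move=> [a [pa da]] [a' [pa' da']] [h [eh R]].
have ehw w : bf x' w = bf x (h w) by rewrite eh.
have [|h' [h1 h2]] := @pb_map _ _ _ _ _ _ _ _ _ _ (gcomp h a') (bf y') pa.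
  by move=> w /=; rewrite -ehw; have [->] := pa'.
exists h'; split; first by apply: gmap_eq => w /=; rewrite h2.
rewrite da da'; apply: irel_pb R; apply: is_pbI => [w|v u e|w w' e1 e2].
- by rewrite h1.
- have [|w [w1 w2]] := @pb_ex _ _ _ _ _ _ _ _ _ v (bf y u) pa'.
    by rewrite ehw e; have [->] := pa.
  by exists w; split=> //; apply: (pb_eq pa); rewrite ?h1 ?h2 /= ?w1 ?w2.
- by apply: (pb_eq pa') => //; rewrite -!h2 e2.
Qed.

Lemma bpull_sum X Z (g : gmap X Z) x1 x2 x y1 y2 y :
  is_bsum x1 x2 x -> is_bpull g x1 y1 -> is_bpull g x2 y2 -> is_bpull g x y -> is_bsum y1 y2 y.
Proof.
move=> [i1 [i2 [[I1 I2 dis cov] f1 f2 d1 d2]]] [a1 [p1 e1]] [a2 [p2 e2]] [a [p e]].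
have F1 w : bf x (i1 w) = bf x1 w by rewrite -f1.
have F2 w : bf x (i2 w) = bf x2 w by rewrite -f2.
have [|j1 [j11 j12]] := @pb_map _ _ _ _ _ _ _ _ _ _ (gcomp i1 a1) (bf y1) p.
  by move=> w /=; rewrite F1; have [->] := p1.
have [|j2 [j21 j22]] := @pb_map _ _ _ _ _ _ _ _ _ _ (gcomp i2 a2) (bf y2) p.
  by move=> w /=; rewrite F2; have [->] := p2.
exists j1, j2; split.
- split.
  + move=> w w' ew; apply: (pb_eq p1); last by rewrite -!j12 ew.
    by apply: I1; rewrite -[LHS]j11 -[RHS]j11 ew.
  + move=> w w' ew; apply: (pb_eq p2); last by rewrite -!j22 ew.
    by apply: I2; rewrite -[LHS]j21 -[RHS]j21 ew.
  + by move=> u v euv; apply: (dis (a1 u) (a2 v)); rewrite -[LHS]j11 -[RHS]j21 euv.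
  + move=> v; have [pc _] := p; case: (cov (a v)) => -[u eu]; [left|right].
    * have [|w [w1 w2]] := @pb_ex _ _ _ _ _ _ _ _ _ u (bf y v) p1.
        by rewrite -F1 eu.
      by exists w; apply: (pb_eq p); rewrite ?j11 ?j12 /= ?w1.
    * have [|w [w1 w2]] := @pb_ex _ _ _ _ _ _ _ _ _ u (bf y v) p2.
        by rewrite -F2 eu.
      by exists w; apply: (pb_eq p); rewrite ?j21 ?j22 /= ?w1.
- exact: gmap_eq.
- exact: gmap_eq.
- rewrite e e1 -d1 -!pres_comp; congr pres; exact: gmap_eq.
- rewrite e e2 -d2 -!pres_comp; congr pres; exact: gmap_eq.
Qed.

Lemma bpull_lk X Z (g : gmap X Z) x y y' :
  is_bpull g x y -> is_bpull g x y' -> lk y = lk y'.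
Proof.
move=> p p'; apply: lk_beq; apply: beq_step; apply: (bpull_step p p').
exists (gid _); split; first exact: gmap_eq.
by rewrite -[in X in irel _ _ _ X](pres_id (bd x)); apply: irel_iso; exists id.
Qed.

Lemma lres_ex X Z (g : gmap X Z) : exists f : lgrp Z -> lgrp X,
  {morph f : s t / (s + t)%R} /\ forall x, f (lk x) = lk (bpull g x).
Proof.
apply: lext_ex => [x y st|x y z s].
  by apply: lk_beq; apply: beq_step; apply: (bpull_step (bpullP g x) (bpullP g y)).
by apply: lk_sum; apply: (bpull_sum s); apply: bpullP.
Qed.

Definition lres X Z (g : gmap X Z) := sval (cid (lres_ex g)).
Lemma lresD X Z (g : gmap X Z) : {morph lres g : s t / (s + t)%R}.
Proof. by rewrite /lres; case: cid => f []. Qed.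
Lemma lresE X Z (g : gmap X Z) x y : is_bpull g x y -> lres g (lk x) = lk y.
Proof.
move=> p; rewrite /lres; case: cid => f [/= _ ->].
exact: (bpull_lk (bpullP g x) p).
Qed.

Definition bpush X Z (g : gmap X Z) (x : bobj D X) : bobj D Z := BObj (gcomp g (bf x)) (bd x).

Lemma ltr_ex X Z (g : gmap X Z) : exists f : lgrp X -> lgrp Z,
  {morph f : s t / (s + t)%R} /\ forall x, f (lk x) = lk (bpush g x).
Proof.
apply: lext_ex => [x y [h [eh R]]|x y z [i1 [i2 [cop f1 f2 d1 d2]]]].
  apply: lk_beq; apply: beq_step; exists h; split=> //=.
  by rewrite eh gcompA.
apply: lk_sum; exists i1, i2; split=> //=; by rewrite -gcompA ?f1 ?f2.
Qed.

Definition ltr X Z (g : gmap X Z) := sval (cid (ltr_ex g)).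
Lemma ltrD X Z (g : gmap X Z) : {morph ltr g : s t / (s + t)%R}.
Proof. by rewrite /ltr; case: cid => f []. Qed.
Lemma ltrE X Z (g : gmap X Z) x : ltr g (lk x) = lk (bpush g x).
Proof. by rewrite /ltr; case: cid => f []. Qed.

Lemma additive0 (G H : zmodType) (f : G -> H) : {morph f : s t / (s + t)%R} -> f 0%R = 0%R.
Proof. by move=> fD; apply: (addIr (f 0%R)); rewrite -fD !add0r. Qed.

Lemma lvoid Z (a b : lgrp Z) : (Z -> False) -> a = b.
Proof.
move=> Z0; have h (c : lgrp Z) : c = 0%R.
  have [x [y ->]] := lk_surj c; rewrite !lk0 ?subrr // => u; exact: Z0 (bf _ u).
by rewrite (h a) (h b).
Qed.

Lemma ldouble W X Y Z (a : gmap W X) (b : gmap W Y) (f : gmap X Z) (g : gmap Y Z) s :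
  is_pb a b f g -> lres g (ltr f s) = ltr b (lres a s).
Proof.
move=> p; apply: (@lk_ind _ _ (fun s => lres g (ltr f s)) (fun s => ltr b (lres a s))).
- by move=> u v; rewrite ltrD lresD.
- by move=> u v; rewrite lresD ltrD.
move=> x; rewrite (lresE (bpullP a x)) !ltrE; apply: lresE.
have [c [pc dc]] := bpullP a x.
by exists c; split=> //; apply: is_pb_sym; apply: pb_comp (is_pb_sym p) (is_pb_sym pc).
Qed.

Lemma lres_id X (s : lgrp X) : lres (gid X) s = s.
Proof.
apply: (@lk_ind _ _ (lres (gid X)) id) => // [|x]; first exact: lresD.
apply: lresE; exists (gid _); split; last by rewrite pres_id.
by apply: is_pbI => // u y /= <-; exists u.
Qed.

Lemma ltr_id X (s : lgrp X) : ltr (gid X) s = s.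
Proof.
apply: (@lk_ind _ _ (ltr (gid X)) id) => // [|x]; first exact: ltrD.
by rewrite ltrE /bpush gid_compl; case: x.
Qed.

Lemma lres_tr_inj X Y (f : gmap X Y) s : injective f -> lres f (ltr f s) = s.
Proof. by move=> /pb_inj /ldouble ->; rewrite ltr_id lres_id. Qed.

Lemma lres_tr_disj X Y Z (f : gmap X Z) (g : gmap Y Z) s :
  (forall x y, f x <> g y) -> lres g (ltr f s) = 0%R.
Proof.
move=> /pb_void/ldouble->; rewrite [lres _ _](_ : _ = 0%R).
  exact: additive0 (ltrD _).
exact: lvoid.
Qed.

(** The pullbacks of a formal transfer to the two pieces decompose its source, so [lk_sum] applies;
    this yields additivity of the presented functor. *)
Lemma lsplit V1 V2 V (i1 : gmap V1 V) (i2 : gmap V2 V) (s : lgrp V) : is_cop i1 i2 ->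
  s = (ltr i1 (lres i1 s) + ltr i2 (lres i2 s))%R.
Proof.
move=> [I1 I2 dis cov].
apply: (@lk_ind _ _ id (fun s => ltr i1 (lres i1 s) + ltr i2 (lres i2 s))%R) => //.
  by move=> u v; rewrite !lresD !ltrD addrACA.
move=> x /=; rewrite !(lresE (bpullP _ x)) !ltrE; apply: lk_sum.
exists (gpb1 (bf x) i1), (gpb1 (bf x) i2); split=> //; last first.
- by apply: gmap_eq => w; rewrite /= gpbE.
- by apply: gmap_eq => w; rewrite /= gpbE.
split.
- by move=> w w' e; apply: gpb_inj => //; apply: I1; rewrite -!gpbE e.
- by move=> w w' e; apply: gpb_inj => //; apply: I2; rewrite -!gpbE e.
- by move=> w w' e; apply: (dis (gpb2 _ _ w) (gpb2 _ _ w')); rewrite -!gpbE e.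
- move=> v; case: (cov (bf x v)) => -[u eu]; [left|right];
  by have [w [w1 _]] := gpb_mk (esym eu); exists w.
Qed.

Lemma lmackey_axioms : semi_mackey_axioms (fun X => @GRing.add (lgrp X))
   (fun X => @GRing.zero (lgrp X)) lres ltr.
Proof.
split=> //.
- by move=> X; apply: addrA.
- by move=> X; apply: addrC.
- by move=> X; apply: add0r.
- exact: lresD.
- by move=> X Y f; apply: additive0 (lresD _).
- exact: ltrD.
- by move=> X Y f; apply: additive0 (ltrD _).
- exact: lres_id.
- move=> X Y Z f g s.
  apply: (@lk_ind _ _ (lres (gcomp f g)) (fun s => lres g (lres f s))).
  + exact: lresD.
  + by move=> u v; rewrite !lresD.
  + move=> x; rewrite (lresE (bpullP f x)) (lresE (bpullP g _)); apply: lresE.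
    have [a [pa da]] := bpullP f x; have [a' [pa' da']] := bpullP g (bpull f x).
    exists (gcomp a a'); split; first exact: pb_comp pa pa'.
    by rewrite da' da pres_comp.
- exact: ltr_id.
- move=> X Y Z f g s.
  apply: (@lk_ind _ _ (ltr (gcomp f g)) (fun s => ltr f (ltr g s))).
  + exact: ltrD.
  + by move=> u v; rewrite !ltrD.
  + by move=> x; rewrite !ltrE /bpush /= gcompA.
- by move=> W X Y Z a b f g /pullback_is_pb p s; apply: ldouble.
- move=> X Y; have cop := gsum_is_cop X Y; have [I1 I2 dis _] := cop.
  exists (fun p => ltr (ginl X Y) p.1 + ltr (ginr X Y) p.2)%R => [s|[s t]] /=.
    by rewrite -lsplit.
  rewrite !lresD !lres_tr_inj // !lres_tr_disj ?addr0 ?add0r // => x y e; exact: dis (esym e).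
Qed.

Definition lmackey : mackey gT := @Mackey gT lgrp lres ltr lmackey_axioms.

Definition lnu S (d : D S) : lmackey S := lk (BObj (gid S) d).

Lemma lkE Z (x : bobj D Z) : lk x = mtr lmackey (bf x) (lnu (bd x)).
Proof. by rewrite /= ltrE /bpush /= gid_compr; case: x. Qed.

Lemma lnu_pairing : is_pairing (P := lmackey) lnu.
Proof.
split=> [S T f d|S' S h d d' R] /=.
  rewrite (lresE (y := BObj (gid S) (pres D f d))) //; exists f; split=> //=.
  by apply: is_pbI => // x y /= ->; exists y.
rewrite ltrE; apply: lk_beq; apply: beq_step; exists h; split=> //=.
Qed.

(** The value on a formal transfer is forced. It respects steps by the transfer condition on [mu]
    and sums by [mdecomp], hence extends to the group. *)
Lemma lmackey_universal : universal (L := lmackey) lnu.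
Proof.
split; first exact: lnu_pairing.
move=> P mu [mures mutr].
have ex Z : exists f : lgrp Z -> P Z,
  {morph f : s t / (s + t)%R} /\ forall x, f (lk x) = mtr P (bf x) (mu _ (bd x)).
  apply: lext_ex => [x y [h [eh R]]|x y z [i1 [i2 [cop f1 f2 d1 d2]]]].
    by rewrite eh (mutr _ _ _ _ _ R) mtr_comp.
  by rewrite -f1 -f2 -d1 -d2 !mures !mtr_comp -mtrD -mdecomp.
pose f Z := sval (cid (ex Z)).
have fD Z : {morph f Z : s t / (s + t)%R} by rewrite /f; case: cid => ? [].
have fE Z x : f Z (lk x) = mtr P (bf x) (mu _ (bd x)) by rewrite /f; case: cid => ? [].
have fres X Y (g : gmap X Y) s : f X (mres lmackey g s) = mres P g (f Y s).
  apply: (@lk_ind _ _ (fun s => f X (lres g s)) (fun s => mres P g (f Y s))).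
  - by move=> u v; rewrite lresD fD.
  - by move=> u v; rewrite fD mresD.
  - move=> x; rewrite (lresE (bpullP g x)) !fE /=.
    by rewrite (mbase _ (gpb_is_pb _ _)) mures.
have ftr X Y (g : gmap X Y) s : f Y (mtr lmackey g s) = mtr P g (f X s).
  apply: (@lk_ind _ _ (fun s => f Y (ltr g s)) (fun s => mtr P g (f X s))).
  - by move=> u v; rewrite ltrD fD.
  - by move=> u v; rewrite fD mtrD.
  - by move=> x; rewrite ltrE !fE /= mtr_comp.
exists (@MackeyHom _ lmackey P f fD fres ftr); split=> [S d|psi psiE].
  by rewrite /= fE mtr_id.
apply: mackey_hom_eq => X; apply: (@lk_ind _ _ (f X) (psi X)).
- exact: fD.
- exact: (@mh_add _ _ _ psi X).
by move=> x; rewrite fE lkE mh_tr psiE.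
Qed.

End Presented.

(** * Products with a fixed G-set *)

Section Shifts.
Variable gT : finGroupType.
Implicit Types (X Y Z W S T U V E A : gset gT).

Definition gpair X Y (x : X) (y : Y) : X ** Y := (x, y).

Lemma gpairP X Y (u : X ** Y) : u = gpair u.1 u.2.
Proof. by case: u. Qed.

Lemma gpair_act X Y (x : X) (y : Y) g :
  gact (X ** Y) (gpair x y) g = gpair (gact X x g) (gact Y y g).
Proof. by []. Qed.

Lemma gprod_map_id X Y : gid X ⊠ gid Y = gid (X ** Y).
Proof. by apply: gmap_eq => -[]. Qed.

Lemma gprod_map_compl X Y Y' Y'' (f' : gmap Y' Y'') (g' : gmap Y Y') :
  gid X ⊠ gcomp f' g' = gcomp (gid X ⊠ f') (gid X ⊠ g').
Proof. by apply: gmap_eq => -[]. Qed.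

Lemma gprod_map_compr X X' X'' Y (f : gmap X' X'') (g : gmap X X') :
  gcomp f g ⊠ gid Y = gcomp (f ⊠ gid Y) (g ⊠ gid Y).
Proof. by apply: gmap_eq => -[]. Qed.

Lemma pb_prodl X W Y Y' Z (a : gmap W Y) (b : gmap W Y') (f : gmap Y Z) (g : gmap Y' Z) :
  is_pb a b f g -> is_pb (gid X ⊠ a) (gid X ⊠ b) (gid X ⊠ f) (gid X ⊠ g).
Proof.
move=> p; apply: is_pbI => [[x w]|[x y] [x' y'] /= [<-] e|[x w] [x' w'] /= [<- e1] [e2]] /=.
- by have [->] := p.
- by have [w [<- <-]] := pb_ex p e; exists (gpair x w).
- by rewrite (pb_eq p e1 e2).
Qed.

Lemma pb_prodr X W Y Y' Z (a : gmap W Y) (b : gmap W Y') (f : gmap Y Z) (g : gmap Y' Z) :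
  is_pb a b f g -> is_pb (a ⊠ gid X) (b ⊠ gid X) (f ⊠ gid X) (g ⊠ gid X).
Proof.
move=> p; apply: is_pbI => [[w x]|[y x] [y' x'] /= [e <-]|[w x] [w' x'] /= [e1 <-] [e2]] /=.
- by have [->] := p.
- by have [w [<- <-]] := pb_ex p e; exists (gpair w x).
- by rewrite (pb_eq p e1 e2).
Qed.

Lemma pb_prod_mid X X' Y Y' (f : gmap X X') (g : gmap Y Y') :
  is_pb (f ⊠ gid Y) (gid X ⊠ g) (gid X' ⊠ g) (f ⊠ gid Y').
Proof.
apply: is_pbI => [[x y]|[x' y] [x y'] /= [-> <-]|[x y] [x' y'] /= [e1 e2] [e3 e4]] //.
- by exists (gpair x y).
- by rewrite e2 e3.
Qed.

Lemma cop_prodl X V1 V2 V (i1 : gmap V1 V) (i2 : gmap V2 V) :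
  is_cop i1 i2 -> is_cop (gid X ⊠ i1) (gid X ⊠ i2).
Proof.
move=> [I1 I2 dis cov]; split=> [[x u] [x' u'] /= [-> /I1 ->]|[x u] [x' u'] /= [-> /I2 ->]|
    [x u] [x' u'] /= [_ /dis]|[x v]] //.
by case: (cov v) => -[u <-]; [left|right]; exists (gpair x u).
Qed.

Lemma cop_prodr X V1 V2 V (i1 : gmap V1 V) (i2 : gmap V2 V) :
  is_cop i1 i2 -> is_cop (i1 ⊠ gid X) (i2 ⊠ gid X).
Proof.
move=> [I1 I2 dis cov]; split=> [[u x] [u' x'] /= [/I1 -> ->]|[u x] [u' x'] /= [/I2 -> ->]|
    [u x] [u' x'] /= [/dis]|[v x]] //.
by case: (cov v) => -[u <-]; [left|right]; exists (gpair u x).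
Qed.

Definition psh_shift X (D : gpsh gT) : gpsh gT.
Proof.
apply: (@GPsh gT (fun T => D (X ** T)) (fun S T f => pres D (gid X ⊠ f))).
- by move=> T s; rewrite gprod_map_id pres_id.
- by move=> S T U f g s; rewrite gprod_map_compl pres_comp.
- move=> S T; have cop := cop_prodl X (gsum_is_cop S T).
  pose r (p : D (X ** S) * D (X ** T)) := sval (cid (padd_ex p.1 p.2 cop)).
  have rP p : (pres D (gid X ⊠ ginl S T) (r p), pres D (gid X ⊠ ginr S T) (r p)) = p.
    by rewrite /r; case: cid => s /= [-> ->]; case: p.
  exists r => // s; apply: (padd_inj cop);
    by have := rP (pres D (gid X ⊠ ginl S T) s, pres D (gid X ⊠ ginr S T) s) => -[].
- by apply: (pres D (@GMap gT (X ** gvoid gT) (gvoid gT) (fun u => u.2) (fun _ _ => erefl)) (pinh D)).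
Defined.

Section ShiftMackey.
Variables (X : gset gT) (M : mackey gT).

(** Precomposition with an endofunctor that preserves pullbacks and disjoint unions; it serves both
    for [X ** -] and for [- ** X]. *)
Lemma shift_mackey_axioms (F : gset gT -> gset gT)
    (Fm : forall S T, gmap S T -> gmap (F S) (F T)) :
  (forall T, Fm _ _ (gid T) = gid (F T)) ->
  (forall S T U (f : gmap T U) (g : gmap S T), Fm _ _ (gcomp f g) = gcomp (Fm _ _ f) (Fm _ _ g)) ->
  (forall W S T Z (a : gmap W S) (b : gmap W T) (f : gmap S Z) (g : gmap T Z),
    is_pb a b f g -> is_pb (Fm _ _ a) (Fm _ _ b) (Fm _ _ f) (Fm _ _ g)) ->
  (forall S T, is_cop (Fm _ _ (ginl S T)) (Fm _ _ (ginr S T))) ->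
  semi_mackey_axioms (fun T => @GRing.add (M (F T))) (fun T => @GRing.zero (M (F T)))
    (fun S T f => mres M (Fm S T f)) (fun S T f => mtr M (Fm S T f)).
Proof.
move=> Fid Fcomp Fpb Fcop; split.
- by move=> S; apply: addrA.
- by move=> S; apply: addrC.
- by move=> S; apply: add0r.
- by move=> S T f; apply: mresD.
- by move=> S T f; apply: mres0.
- by move=> S T f; apply: mtrD.
- by move=> S T f; apply: mtr0.
- by move=> S s; rewrite Fid mres_id.
- by move=> S T U f g s; rewrite Fcomp mres_comp.
- by move=> S s; rewrite Fid mtr_id.
- by move=> S T U f g s; rewrite Fcomp mtr_comp.
- by move=> W S T Z a b f g /pullback_is_pb/Fpb p s; apply: mbase.
- move=> S T; have cop := Fcop S T.
  pose r (p : M (F S) * M (F T)) := sval (cid (madd_ex p.1 p.2 cop)).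
  have rP p : (mres M (Fm _ _ (ginl S T)) (r p), mres M (Fm _ _ (ginr S T)) (r p)) = p.
    by rewrite /r; case: cid => s /= [-> ->]; case: p.
  exists r => // s; apply: (madd_inj cop);
    by have := rP (mres M (Fm _ _ (ginl S T)) s, mres M (Fm _ _ (ginr S T)) s) => -[].
Qed.

Definition mshiftl : mackey gT :=
  @Mackey gT (fun T => M (X ** T)) _ _
    (shift_mackey_axioms (gprod_map_id X) (@gprod_map_compl X) (@pb_prodl X)
      (fun S T => cop_prodl X (gsum_is_cop S T))).

Definition mshiftr : mackey gT :=
  @Mackey gT (fun T => M (T ** X)) _ _
    (shift_mackey_axioms (gprod_map_id^~ X) (fun S T U f g => @gprod_map_compr S T U X f g)
      (@pb_prodr X) (fun S T => cop_prodr X (gsum_is_cop S T))).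

End ShiftMackey.

(** ** Dependent products along a projection [X × T -> T] *)

(* [E] is the set of pairs of [t : T] and a section of [q] over [X × t]; [h] is the
   projection and [e] the evaluation. *)
Definition is_dpr X T S E (q : gmap S (X ** T)) (h : gmap E T) (e : gmap (X ** E) S) :=
  (forall x u, q (e (gpair x u)) = gpair x (h u)) /\
  forall t (s : X -> S), (forall x, q (s x) = gpair x t) ->
    exists u, h u = t /\ (forall x, e (gpair x u) = s x) /\
      forall v, h v = t -> (forall x, e (gpair x v) = s x) -> v = u.

Section Dpr.
Variables (X T S E : gset gT) (q : gmap S (X ** T)) (h : gmap E T) (e : gmap (X ** E) S).

Lemma is_dprI : (forall x u, q (e (gpair x u)) = gpair x (h u)) ->
  (forall t (s : X -> S), (forall x, q (s x) = gpair x t) ->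
     exists u, h u = t /\ forall x, e (gpair x u) = s x) ->
  (forall u v, h u = h v -> (forall x, e (gpair x u) = e (gpair x v)) -> u = v) ->
  is_dpr q h e.
Proof.
move=> c ex un; split=> // t s /ex[u [u1 u2]]; exists u; do 2 split=> //.
by move=> v v1 v2; apply: un => [|x]; rewrite ?v1 ?v2.
Qed.

Hypothesis dp : is_dpr q h e.

Lemma dprE x u : q (e (gpair x u)) = gpair x (h u).
Proof. by have [->] := dp. Qed.

Lemma dpr_ex t (s : X -> S) : (forall x, q (s x) = gpair x t) ->
  exists u, h u = t /\ forall x, e (gpair x u) = s x.
Proof. by case: dp => _ H /H[u [? []]]; exists u. Qed.

Lemma dpr_eq u v : h u = h v -> (forall x, e (gpair x u) = e (gpair x v)) -> u = v.
Proof.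
move=> e1 e2; have [c H] := dp.
have [|w [w1 [w2 wU]]] := H (h u) (fun x => e (gpair x u)); first by move=> x; rewrite c.
by rewrite (wU u) // -(wU v).
Qed.

(** Sections over a point are determined by their values, hence vary equivariantly; this recovers
    the universal property of the dependent product from its pointwise form. *)
Lemma dpr_map U (t : gmap U T) (w : gmap (X ** U) S) :
  (forall x u, q (w (gpair x u)) = gpair x (t u)) ->
  exists k : gmap U E, (forall u, h (k u) = t u) /\
     forall x u, e (gpair x (k u)) = w (gpair x u).
Proof.
move=> wP; have [u|u v g [e1 e2]|k kP] := @gmap_of_graph _ U E (fun u v =>
  h v = t u /\ forall x, e (gpair x v) = w (gpair x u)).
- have [v [v1 v2]] := dpr_ex (fun x => wP x u); exists v; split=> // v' [v1' v2'].
  by apply: dpr_eq => [|x]; rewrite ?v1 ?v2.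
- split=> [|x]; first by rewrite !gfunP e1.
  (* The action on sections also moves the argument, so the translated section is evaluated at [x]
     moved back by [g^-1]. *)
  have -> : gpair x (gact E v g) = gact (X ** E) (gpair (gact X x g^-1%g) v) g.
    by rewrite gpair_act actKV.
  rewrite gfunP e2 -gfunP; congr (w _).
  by rewrite gpair_act actKV.
- by exists k; split=> [u|x u]; have [? ?] := kP u.
Qed.

End Dpr.

Lemma dpr_uniq X T S E E' (q : gmap S (X ** T)) (h : gmap E T) (e : gmap (X ** E) S)
    (h' : gmap E' T) (e' : gmap (X ** E') S) : is_dpr q h e -> is_dpr q h' e' ->
  exists k : gmap E' E, [/\ bijective k, gcomp h k = h' & gcomp e (gid X ⊠ k) = e'].
Proof.
move=> dp dp'; have [k [k1 k2]] := dpr_map dp (dprE dp').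
have [l [l1 l2]] := dpr_map dp' (dprE dp).
exists k; split; [|exact: gmap_eq|].
- exists l => u.
  + by apply: (dpr_eq dp') => [|x]; rewrite ?l1 ?k1 ?l2 ?k2.
  + by apply: (dpr_eq dp) => [|x]; rewrite ?k1 ?l1 ?k2 ?l2.
- by apply: gmap_eq => -[x u]; apply: k2.
Qed.

(** Conjugation on the set of all functions, equivariant or not. *)
Definition gfunset_act X S (s : {ffun X -> S}) (g : gT) : {ffun X -> S} :=
  [ffun x => gact S (s (gact X x g^-1%g)) g].

Definition gfunset X S : gset gT.
Proof.
exists {ffun X -> S}; exists (@gfunset_act X S); apply: is_total_action.
- by move=> s; apply/ffunP => x; rewrite ffunE invg1 !act1.
- by move=> s a b; apply/ffunP => x; rewrite !ffunE invMg !actM.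
Defined.

(** The dependent product is cut out of the product of [T] with the set of functions [X -> S] by the
    condition of being a section over the given point. *)
Lemma dpr_exists X T S (q : gmap S (X ** T)) :
  exists E (h : gmap E T) (e : gmap (X ** E) S), is_dpr q h e.
Proof.
pose P : pred (T ** gfunset X S) := fun u => [forall x, q ((u.2 : {ffun X -> S}) x) == gpair x u.1].
have Pinv u g : P (gact _ u g) = P u.
  have impl u' g' : P u' -> P (gact _ u' g').
    case: u' => t s /forallP H; apply/forallP => x /=; rewrite ffunE gfunP.
    by rewrite (eqP (H _)) gpair_act /= actKV.
  apply/idP/idP => [/impl|/impl//]; move=> /(_ g^-1%g); by rewrite actK.
pose h : gmap (gsub Pinv) T := gcomp (gfst _ _) (gincl Pinv).
have eP (u : X ** gsub Pinv) g :
  ((gincl Pinv (gact _ u g).2).2 : {ffun X -> S}) (gact _ u g).1 =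
  gact S (((gincl Pinv u.2).2 : {ffun X -> S}) u.1) g.
  by case: u => x [[t s] Ps] /=; rewrite ffunE actK.
exists (gsub Pinv), h, (GMap (fun u : X ** gsub Pinv => ((gincl Pinv u.2).2 : {ffun X -> S}) u.1) eP).
apply: is_dprI => [x [[t s] Ps]|t s sP|[[t s] Ps] [[t' s'] Ps'] /= e1 e2] /=.
- by apply/eqP; move/forallP: Ps.
- have Pu : P (gpair t ([ffun x => s x] : gfunset X S)).
    by apply/forallP => x; rewrite ffunE sP.
  by exists (gsubmk Pinv Pu); split=> // x /=; rewrite ffunE.
- apply: val_inj => /=; congr pair => //; apply/ffunP => x; exact: e2.
Qed.

(** ** The inputs of interest *)

Section Inputs.

Definition in_mackey (M : mackey gT) : input gT.
Proof.
apply: (@Input gT (psh_of_mackey M) (fun S' S h d d' => d = mtr M h d')).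
- by move=> S' S h d hb /=; rewrite mtr_res_bij.
- by move=> W S' U S a b h g d d' p -> /=; apply: mbase.
- move=> V1 V2 V V' W i1 i2 h j1 j2 k d d' cop cop' e1 e2 /= ed1 ed2.
  have [I1 I2 dis cov] := cop; have [J1 J2 dis' cov'] := cop'.
  have E1 x : k (j1 x) = i1 x by rewrite -e1.
  have E2 x : k (j2 x) = i2 (h x) by rewrite -[RHS]/(gcomp i2 h x) -e2.
  apply: (madd_inj cop).
  + have p : is_pb j1 (gid V1) k i1.
      apply: is_pbI => [w|x y ek|w w' _ /= ->] //=.
      case: (cov' x) ek => -[z <-]; rewrite ?E1 ?E2 => ez.
      * by exists z; split=> //; apply: I1.
      * by case: (dis y (h z)).
    by rewrite (mbase _ p) mtr_id ed1.
  + have p : is_pb j2 h k i2.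
      apply: is_pbI => [w|x y ek|w w' /J2 -> _] //.
      case: (cov' x) ek => -[z <-]; rewrite ?E1 ?E2 => ez.
      * by case: (dis z y).
      * by exists z; split=> //; apply: I2.
    by rewrite (mbase _ p) ed2.
Defined.

Definition psh_prod (D D' : gpsh gT) : gpsh gT.
Proof.
apply: (@GPsh gT (fun T => D T * D' T)%type
  (fun S T f s => (pres D f s.1, pres D' f s.2))) => /=.
- by move=> T [s t]; rewrite !pres_id.
- by move=> S T U f g [s t]; rewrite !pres_comp.
- move=> S T; have [f fK Kf] := padd D S T; have [f' fK' Kf'] := padd D' S T.
  exists (fun p => (f (p.1.1, p.2.1), f' (p.1.2, p.2.2))) => [[s s']|[[s s'] [t t']]] /=.
    by rewrite fK fK'.
  by have [-> ->] := Kf (s, t); have [-> ->] := Kf' (s', t').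
- exact: (pinh D, pinh D').
Defined.

(** The two disjuncts are Frobenius reciprocity in either variable: a transfer in one factor comes
    out of the pair while the other factor is restricted. *)
Definition in_prod (D D' : input gT) : input gT.
Proof.
apply: (@Input gT (psh_prod D D') (fun S' S h d d' =>
  (irel D h d.1 d'.1 /\ d'.2 = pres D' h d.2) \/
  (d'.1 = pres D h d.1 /\ irel D' h d.2 d'.2))).
- by move=> S' S h [d d'] hb; left; split=> //; apply: irel_iso.
- move=> W S' U S a b h g [d d'] [s s'] p /= H.
  have egb : gcomp h a = gcomp g b by case: p => pc _; apply: gmap_eq => w; apply: pc.
  case: H => -[H1 H2]; [left|right]; split.
  + exact: irel_pb p H1.
  + by rewrite H2 -!pres_comp egb.
  + by rewrite H1 -!pres_comp egb.
  + exact: irel_pb p H2.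
- move=> V1 V2 V V' W i1 i2 h j1 j2 k [d d'] [s s'] cop cop' e1 e2 /= [ed1 ed2].
  case=> -[H1 H2]; [left|right]; split.
  + exact: irel_cop cop cop' e1 e2 ed1 H1.
  + by apply: (padd_inj cop'); rewrite -pres_comp ?e1 ?e2 ?pres_comp.
  + by apply: (padd_inj cop'); rewrite -pres_comp ?e1 ?e2 ?pres_comp.
  + exact: irel_cop cop cop' e1 e2 ed2 H2.
Defined.

Definition psh_pt : gpsh gT.
Proof.
apply: (@GPsh gT (fun _ => unit) (fun _ _ _ _ => tt)) => [X []|X Y Z f g []|X Y|] //.
by exists (fun=> tt) => [[]|[[] []]].
Defined.

(** One generator over each G-set, related along bijections only: this presents the Grothendieck
    group of finite G-sets over the base, the Burnside functor. *)
Definition in_pt : input gT.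
Proof.
apply: (@Input gT psh_pt (fun S' S h _ _ => bijective h)) => //.
- move=> W S' U S a b h g _ _ p hb; have [h' hK Kh] := hb.
  have [||c [c1 c2]] := @gbij_inv _ _ _ b; last by exists c.
  + move=> w w' e; apply: (pb_eq p) => //; apply: (bij_inj hb).
    by have [-> _] := p; rewrite e; have [-> _] := p.
  + move=> y; have [|w [w1 w2]] := @pb_ex _ _ _ _ _ _ _ _ _ (h' (g y)) y p; first by rewrite Kh.
    by exists w.
- move=> V1 V2 V V' W i1 i2 h j1 j2 k _ _ [I1 I2 dis cov] [J1 J2 dis' cov'] e1 e2 _ hb.
  have E1 x : k (j1 x) = i1 x by rewrite -e1.
  have E2 x : k (j2 x) = i2 (h x) by rewrite -[RHS]/(gcomp i2 h x) -e2.
  have [h' hK Kh] := hb.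
  have [||c [c1 c2]] := @gbij_inv _ _ _ k; last by exists c.
  + move=> w w'; case: (cov' w) => -[p <-]; case: (cov' w') => -[r <-];
    rewrite ?E1 ?E2; [by move/I1->|by move/dis|by move/esym/dis|by move/I2/(bij_inj hb)->].
  + move=> v; case: (cov v) => -[p <-]; first by exists (j1 p).
    by exists (j2 (h' p)); rewrite E2 Kh.
Defined.

(** The formula for the norm of a transfer, imposed for every relation of [D] over [X × S]. *)
Definition shift_rel X (D : input gT) S' S (h : gmap S' S) (d : psh_shift X D S)
    (d' : psh_shift X D S') := exists A (q : gmap A (X ** S)) (a : D A) (e : gmap (X ** S') A),
  [/\ is_dpr q h e, irel D q d a & d' = pres D e a].

(** Dependent products commute with base change, because their points over [u] depend only on the
    fibre of [q] over [X × u]. *)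
Lemma dpr_pb X S S' W U A A' (q : gmap A (X ** S)) (h : gmap S' S) (e : gmap (X ** S') A)
    (a : gmap W S') (b : gmap W U) (g : gmap U S) (c : gmap A' A) (q' : gmap A' (X ** U))
    (e' : gmap (X ** W) A') :
  is_dpr q h e -> is_pb a b h g -> is_pb c q' q (gid X ⊠ g) ->
  gcomp c e' = gcomp e (gid X ⊠ a) -> gcomp q' e' = gid X ⊠ b -> is_dpr q' b e'.
Proof.
move=> dp p p' ec eq'.
have Ec x w : c (e' (gpair x w)) = e (gpair x (a w)).
  by rewrite -[LHS]/(gcomp c e' (gpair x w)) ec.
have Eq x w : q' (e' (gpair x w)) = gpair x (b w).
  by rewrite -[LHS]/(gcomp q' e' (gpair x w)) eq'.
have [pc _] := p; have [pc' _] := p'.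
apply: is_dprI => [|u s sP|w w' e1 e2] //.
- have cs x : q (c (s x)) = gpair x (g u) by rewrite pc' sP.
  have [v [v1 v2]] := dpr_ex dp cs; have [w [w1 w2]] := pb_ex p v1.
  exists w; split=> // x; apply: (pb_eq p'); first by rewrite Ec w1 v2.
  by rewrite Eq w2 sP.
- apply: (pb_eq p) => //; apply: (dpr_eq dp); first by rewrite !pc e1.
  by move=> x; rewrite -!Ec e2.
Qed.

Definition in_shift X (D : input gT) : input gT.
Proof.
apply: (@Input gT (psh_shift X D) (@shift_rel X D)).
- move=> S' S h d [h' hK Kh] /=; exists (X ** S'), (gid X ⊠ h), (pres D (gid X ⊠ h) d), (gid _).
  split; last by rewrite pres_id.
  + apply: is_dprI => [//|t s sP|u v e _]; last exact: (can_inj hK).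
    exists (h' t); split=> // x; have := sP x; case: (s x) => x' v /= [-> <-].
    by rewrite hK.
  + apply: irel_iso; exists (fun u => (u.1, h' u.2)) => -[x u] /=; by rewrite ?hK ?Kh.
- move=> W S' U S a b h g d d' p [A [q [s [e [dp R ->]]]]].
  have p' := gpb_is_pb q (gid X ⊠ g).
  have [|e' [e1 e2]] := @pb_map _ _ _ _ _ _ _ _ _ _ (gcomp e (gid X ⊠ a)) (gid X ⊠ b) p'.
    by case=> x w /=; rewrite [q _](dprE dp); congr gpair; have [] := p.
  exists (gpb q (gid X ⊠ g)), (gpb2 q (gid X ⊠ g)), (pres D (gpb1 q (gid X ⊠ g)) s), e'; split.
  + by apply: (dpr_pb dp p p'); apply: gmap_eq.
  + exact: irel_pb p' R.
  + by rewrite /= -!pres_comp; congr pres; apply: gmap_eq => u; exact: esym (e1 u).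
- move=> V1 V2 V V' W i1 i2 h j1 j2 k d d' cop cop' e1 e2 /= ed [A [q [s [e [dp R es]]]]].
  have [I1 I2 dis cov] := cop; have [J1 J2 dis' cov'] := cop'.
  have E1 x : k (j1 x) = i1 x by rewrite -e1.
  have E2 x : k (j2 x) = i2 (h x) by rewrite -[RHS]/(gcomp i2 h x) -e2.
  (* Over the first piece [q'] is the identity of [X ** V1], so exactly one section lies over each
     point; over the second piece it is [q]. *)
  pose A' := gsum (X ** V1) A.
  pose q' : gmap A' (X ** V) := gcopair (gid X ⊠ i1) (gcomp (gid X ⊠ i2) q).
  have [s' [s1 s2]] := padd_ex (pres D (gid X ⊠ i1) d) s (gsum_is_cop (X ** V1) A).
  have [e' [e1' e2']] := cop_map (ginl (X ** V1) A) (gcomp (ginr (X ** V1) A) e) (cop_prodl X cop').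
  exists A', q', s', e'; split.
  + apply: is_dprI => [x w|t f fP|w w' e3 e4].
    * case: (cov' w) => -[u <-].
        by have -> := e1' (gpair x u); rewrite /= E1.
      have -> := e2' (gpair x u).
      by rewrite /= [q _](dprE dp) E2.
    * case: (cov t) => -[u eu]; subst t.
        exists (j1 u); split=> // x; have -> := e1' (gpair x u).
        move: (fP x); case: (f x) => [[x' u'] /= [-> /I1 ->]|a] //.
        by move=> /(congr1 snd) /= /esym/dis.
      have fr x : exists a, f x = inr a /\ q a = gpair x u.
        move: (fP x); case: (f x) => [[x' u'] /= [_ /dis]|a ea] //.
        exists a; split=> //; rewrite [LHS]gpairP.
        by have /= -> := congr1 fst ea; have /= /I2 -> := congr1 snd ea.
      have [v [v1 v2]] := dpr_ex dp (s := fun x => sval (cid (fr x))) (t := u) (fun x => proj2 (svalP (cid (fr x)))).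
      exists (j2 v); split=> [|x]; first by rewrite E2 v1.
      have -> := e2' (gpair x v); rewrite /= v2.
      by case: cid => a /= [->].
    * move: e3 e4; case: (cov' w) => -[u <-]; case: (cov' w') => -[v <-]; rewrite ?E1 ?E2.
      - by move/I1->.
      - by move/dis.
      - by move/esym/dis.
      - move=> /I2 e3 e4; congr (j2 _); apply: (dpr_eq dp) => // x.
        by have := e4 x; rewrite [LHS](e2' (gpair x u)) [RHS](e2' (gpair x v)) => -[].
  + apply: (irel_cop (cop_prodl X cop) (gsum_is_cop (X ** V1) A) (h := q)) => //.
    * exact: gmap_eq.
    * exact: gmap_eq.
    * by rewrite s2.
  + apply: (padd_inj (cop_prodl X cop')); first by rewrite ed -s1 -pres_comp; congr pres; apply: gmap_eq => u; rewrite /= e1'.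
    rewrite es -s2 -!pres_comp; congr pres; apply: gmap_eq => u; by rewrite /= e2'.
Defined.

End Inputs.
End Shifts.

Notation in_norm X M := (in_shift X (in_mackey M)).

(** * Extension of polynomial maps to group completions *)

Section InclusionExclusion.
Variables (I : finType) (G : zmodType).
Local Open Scope ring_scope.

Definition sgz_set (J : {set I}) : int := (-1) ^+ #|J|.

(** Adding or removing a fixed [j] outside [W] pairs supersets of opposite signs. *)
Lemma sum_sign_supset (W : {set I}) : W != setT ->
  \sum_(J : {set I} | W \subset J) sgz_set J = 0.
Proof.
rewrite -subTset => /subsetPn[j _ jW].
rewrite (bigID (fun J : {set I} => j \in J)) /= addrC.
rewrite [X in _ + X](reindex_onto (fun J : {set I} => j |: J) (fun J => J :\ j)) /=; last first.
  by move=> J /andP[_ /setD1K].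
rewrite [X in _ + X](eq_bigl (fun J : {set I} => (W \subset J) && (j \notin J))); last first.
  move=> J; rewrite setU11 andbT; apply/andP/andP => -[].
    move=> sWJ /eqP eJ; have jJ : j \notin J by rewrite -eJ !inE eqxx.
    split=> //; apply/subsetP => w wW; have := subsetP sWJ w wW.
    by rewrite !inE => /orP[/eqP ew|//]; move: jW; rewrite -ew wW.
  move=> sWJ jJ; split; first by apply: subset_trans sWJ (subsetUr _ _).
  by rewrite setU1K.
rewrite -big_split /= big1 // => J /andP[_ jJ].
by rewrite /sgz_set cardsU1 jJ add1n exprS mulN1r subrr.
Qed.

(** After the two sums are exchanged, every [g W] with [W] proper gets coefficient 0, and only the
    term of the full set could survive. *)
Lemma inclusion_exclusion (F g : {set I} -> G) :
  (forall J, F J = \sum_(W : {set I} | W \subset J) g W) -> g setT = 0 ->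
  \sum_J F J *~ sgz_set J = 0.
Proof.
move=> FE gT0; under eq_bigr => J _ do rewrite FE mulrz_suml.
rewrite (exchange_big_dep predT) //= big1 // => W _; rewrite -mulrz_sumr.
have [->|/sum_sign_supset ->] := eqVneq W setT; last by rewrite mulr0z.
by rewrite gT0 mul0rz.
Qed.

End InclusionExclusion.

Section PolynomialExtension.
Variables (I : finType) (K G : zmodType) (C : K -> Prop) (phi : K -> G).
Local Open Scope ring_scope.
Hypothesis CD : forall a b, C a -> C b -> C (a + b).
Hypothesis phiE : forall a b, C a -> C b ->
  phi a = \sum_(J : {set I} | J != set0) phi (a + b *+ #|J|) *~ - sgz_set J.

(** The recurrence [phiE] read as a definition at an arbitrary [v]: for nonempty [J] the argument
    satisfies [C] as soon as [b] and [v + b] do. *)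
Definition pext (v b : K) := 
  \sum_(J : {set I} | J != set0) phi (v + b *+ #|J|) *~ - sgz_set J.

Lemma CMn b n : C b -> C (b *+ n.+1).
Proof. by move=> Cb; elim: n => [//|n IHn]; rewrite mulrS; apply: CD. Qed.

Lemma C_shift v b (J : {set I}) : C b -> C (v + b) -> J != set0 -> C (v + b *+ #|J|).
Proof.
move=> Cb Cv; rewrite -card_gt0; case: #|J| => [//|[|n] _]; first by rewrite mulr1n.
by rewrite mulrS addrA; apply: CD => //; apply: CMn.
Qed.

(** Expanding each term by the recurrence in the other shift gives the same double sum from both
    sides. *)
Lemma pext_indep v b b' : C b -> C (v + b) -> C b' -> C (v + b') -> pext v b = pext v b'.
Proof.
move=> Cb Cv Cb' Cv'; rewrite /pext.
rewrite (eq_bigr (fun J : {set I} => \sum_(J' : {set I} | J' != set0)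
   phi (v + b *+ #|J| + b' *+ #|J'|) *~ - sgz_set J' *~ - sgz_set J)); last first.
  by move=> J J0; rewrite (phiE (C_shift Cb Cv J0) Cb') mulrz_suml.
rewrite exchange_big /=; apply: eq_bigr => J' J'0.
rewrite [in RHS](phiE (C_shift Cb' Cv' J'0) Cb) mulrz_suml; apply: eq_bigr => J J0.
by rewrite addrAC mulrzAC.
Qed.

End PolynomialExtension.

(** * Parts of an element supported on stable subsets *)

Section Strata.
Variables (gT : finGroupType) (P : mackey gT) (E : gset gT) (om : P E).
Local Open Scope ring_scope.

Definition tpart (Q : pred E) (Qi : forall u g, Q (gact E u g) = Q u) : P E :=
  mtr P (gincl Qi) (mres P (gincl Qi) om).

Lemma tpart_ext Q Q' Qi Qi' : Q =1 Q' -> @tpart Q Qi = @tpart Q' Qi'.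
Proof.
move=> /funext e; subst Q'; congr tpart; exact: Prop_irrelevance.
Qed.

Lemma tpart_U Q1 Q2 Q Qi1 Qi2 Qi : (forall u, Q u = Q1 u || Q2 u) ->
  (forall u, Q1 u -> Q2 u -> false) -> @tpart Q Qi = @tpart Q1 Qi1 + @tpart Q2 Qi2.
Proof.
move=> QE dis.
have Q1Q u : Q1 u -> Q u by rewrite QE => ->.
have Q2Q u : Q2 u -> Q u by rewrite QE orbC => ->.
pose i1 := glift (f := gincl Qi1) Qi (fun u => Q1Q _ (ginclP u)).
pose i2 := glift (f := gincl Qi2) Qi (fun u => Q2Q _ (ginclP u)).
have cop : is_cop i1 i2.
  split=> [u v [] /gincl_inj //|u v [] /gincl_inj //|u v [] e|[u Qu]].
  - by have := dis _ (ginclP u); rewrite [gincl _ _]e (ginclP v) => /(_ isT).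
  - have := Qu; rewrite QE => /orP[Qu1|Qu2]; [left|right].
    + by exists (gsubmk Qi1 Qu1); apply: val_inj.
    + by exists (gsubmk Qi2 Qu2); apply: val_inj.
rewrite /tpart (mdecomp (mres P (gincl Qi) om) cop) mtrD -!mtr_comp -!mres_comp.
have -> : gcomp (gincl Qi) i1 = gincl Qi1 by apply: gmap_eq.
by have -> : gcomp (gincl Qi) i2 = gincl Qi2 by apply: gmap_eq.
Qed.

Variables (I : finType) (c : E -> I) (ci : forall u g, c (gact E u g) = c u).

Definition colour_pred (A : pred I) : pred E := fun u => A (c u).
Lemma colour_inv A u g : colour_pred A (gact E u g) = colour_pred A u.
Proof. by rewrite /colour_pred ci. Qed.

Lemma tpart0 Q Qi : (forall u, Q u = false) -> @tpart Q Qi = 0.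
Proof.
move=> Q0; rewrite /tpart (_ : mres P (gincl Qi) om = 0) ?mtr0 //.
by apply: mvoid_eq => u; have := ginclP u; rewrite Q0.
Qed.

Lemma tpart_sum (A : {pred I}) :
  tpart (colour_inv (mem A)) = \sum_(i in A) tpart (colour_inv (pred1 i)).
Proof.
have H n : forall A : {set I}, #|A| = n ->
    tpart (colour_inv (mem A)) = \sum_(i in A) tpart (colour_inv (pred1 i)).
  elim: n => [|n IHn] {}A.
    by move/cards0_eq => ->; rewrite big_set0 tpart0 // => u; rewrite /colour_pred /= in_set0.
  move=> cA; have /card_gt0P[i iA] : (0 < #|A|)%N by rewrite cA.
  rewrite (big_setD1 i) //= -IHn; last first.
    by apply/eqP; rewrite -eqSS -cA (cardsD1 i A) iA.
  apply: tpart_U => u; rewrite /colour_pred /= !inE.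
    by case: eqP => [->|//].
  by move=> ->.
rewrite (@tpart_ext _ (colour_pred (mem [set i in A])) _ (colour_inv (mem [set i in A]))).
  by rewrite (H _ _ erefl); apply: eq_bigl => i; rewrite inE.
by move=> u; rewrite /colour_pred /= inE.
Qed.

End Strata.

(** * Norms of presented Mackey functors *)

Fixpoint bmulti (gT : finGroupType) (D : input gT) (Z : gset gT) (x y : bobj D Z) k :=
  if k is k'.+1 then bsum (bmulti x y k') y else x.

Section NormObjects.
Variables (gT : finGroupType) (D : input gT) (X : gset gT) (P : mackey gT).
Variable mu : forall T, in_shift X D T -> P T.
Hypothesis muP : is_pairing mu.
Implicit Types S T U E : gset gT.

Lemma phi_ex T (x : bobj D (X ** T)) : exists v : P T, exists E (h : gmap E T)
  (e : gmap (X ** E) (bS x)), is_dpr (bf x) h e /\ v = mtr P h (mu (pres D e (bd x) : in_shift X D E)).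
Proof.
by have [E [h [e dp]]] := dpr_exists (bf x); exists (mtr P h (mu (pres D e (bd x) : in_shift X D E))), E, h, e.
Qed.

(** The value that a norm must take on the formal transfer [x]; uniqueness of dependent products
    makes it independent of the choice. *)
Definition phi T (x : bobj D (X ** T)) : P T := sval (cid (phi_ex x)).

Lemma phiE T (x : bobj D (X ** T)) E (h : gmap E T) (e : gmap (X ** E) (bS x)) :
  is_dpr (bf x) h e -> phi x = mtr P h (mu (pres D e (bd x) : in_shift X D E)).
Proof.
move=> dp; rewrite /phi; case: cid => v /= [E' [h' [e' [dp' ->]]]].
have [k [kb <- <-]] := dpr_uniq dp dp'.
by rewrite pres_comp (pairing_res muP k) mtr_comp mtr_res_bij.
Qed.

(** A section of a composite is a section of [q] together with a section of [f] pulled back along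
    the evaluation. *)
Lemma dpr_tower T A E E' (q : gmap A (X ** T)) (h : gmap E T) (e : gmap (X ** E) A)
    S S' (f : gmap S A) (a : gmap S' S) (f' : gmap S' (X ** E))
    (h' : gmap E' E) (e' : gmap (X ** E') S') :
  is_dpr q h e -> is_pb a f' f e -> is_dpr f' h' e' ->
  is_dpr (gcomp q f) (gcomp h h') (gcomp a e').
Proof.
move=> dp p dp'; have [pc _] := p.
apply: is_dprI => [x u|t s sP|u v /= e1 e2] /=.
- by rewrite pc (dprE dp') [q _](dprE dp).
- have [u [u1 u2]] := dpr_ex dp (s := fun x => f (s x)) sP.
  have ex x : exists w, a w = s x /\ f' w = gpair x u by apply: (pb_ex p); rewrite u2.
  have [v [v1 v2]] := dpr_ex dp' (s := fun x => sval (cid (ex x))) (t := u)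
    (fun x => proj2 (svalP (cid (ex x)))).
  exists v; rewrite v1 u1; split=> // x; rewrite v2.
  exact: (proj1 (svalP (cid (ex x)))).
- have e3 : h' u = h' v.
    apply: (dpr_eq dp) => // x.
    by rewrite -!(dprE dp') -!pc [a _]e2.
  apply: (dpr_eq dp') => // x; apply: (pb_eq p); first exact: e2.
  by rewrite !(dprE dp') e3.
Qed.

Lemma phi_tower T A E (q : gmap A (X ** T)) (h : gmap E T) (e : gmap (X ** E) A)
    (o : bobj D A) (o' : bobj D (X ** E)) : is_dpr q h e -> is_bpull e o o' ->
  phi (bpush q o) = mtr P h (phi o').
Proof.
move=> dp [a [p da]]; have [E' [h' [e' dp']]] := dpr_exists (bf o').
rewrite (phiE dp') -mtr_comp.
rewrite (phiE (x := bpush q o) (dpr_tower dp p dp')) /= pres_comp -da.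
by [].
Qed.

(** The relation between [x] and [y], pulled back along the evaluation, is a relation over [X × E]
    and hence one of the shifted input; the tower identifies its target with the dependent product
    of [bf y]. *)
Lemma phi_step T (x y : bobj D (X ** T)) : bstep x y -> phi x = phi y.
Proof.
move=> [k [ef R]]; have [E [h [e dp]]] := dpr_exists (bf x).
rewrite (phiE dp); have p := gpb_is_pb k e.
have [E' [h' [e' dp']]] := dpr_exists (gpb2 k e).
have {}R := irel_pb p R.
have R' : irel (in_shift X D) h' (pres D e (bd x) : in_shift X D E)
     (pres D e' (pres D (gpb1 k e) (bd y)) : in_shift X D E').
  by exists (gpb k e), (gpb2 k e), (pres D (gpb1 k e) (bd y)), e'.
rewrite (pairing_tr muP R') -mtr_comp.
have dpy := dpr_tower dp p dp'; rewrite -ef in dpy.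
by rewrite (phiE dpy) pres_comp.
Qed.

Lemma phi_beq T (x y : bobj D (X ** T)) : beq x y -> phi x = phi y.
Proof. by elim=> {x y} [x y /phi_step|x|x y _ ->|x y z _ -> _ ->]. Qed.

Lemma phi_res T U (g : gmap U T) (x : bobj D (X ** T)) (y : bobj D (X ** U)) :
  is_bpull (gid X ⊠ g) x y -> phi y = mres P g (phi x).
Proof.
move=> [a [p da]]; have [E [h [e dp]]] := dpr_exists (bf x).
have pW := gpb_is_pb h g; set W := gpb h g in pW *.
have [|e' [e1 e2]] := @pb_map _ _ _ _ _ _ _ _ _ _ (gcomp e (gid X ⊠ gpb1 h g)) (gid X ⊠ gpb2 h g) p.
  by case=> x' w /=; rewrite [bf x _](dprE dp) gpbE.
have dp' : is_dpr (bf y) (gpb2 h g) e' by apply: (dpr_pb dp pW p); apply: gmap_eq.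
rewrite (phiE dp') (phiE dp) (mbase _ pW); congr mtr.
rewrite -(pairing_res muP) da /= -!pres_comp; congr (mu (pres D _ _ : in_shift X D _)).
exact: gmap_eq.
Qed.

Section Difference.
Variables (T : gset gT) (x y : bobj D (X ** T)).
Local Notation n := #|X|.+1.

(** [x] together with [|X| + 1] coloured copies of [y]: one colour more than a section over [X] can
    use. *)
Definition bcolS : gset gT := gsum (bS x) (bS y ** gtriv gT 'I_n).
Definition bcol (s : bcolS) : option 'I_n :=
  match s with inl _ => None | inr u => Some u.2 end.
Lemma bcol_inv s g : bcol (gact bcolS s g) = bcol s.
Proof. by case: s => [|[]]. Qed.
Definition bcol_pred (J : {set 'I_n}) : pred bcolS :=
  fun s => if bcol s is Some j then j \in J else true.
Lemma bcol_pred_inv J s g : bcol_pred J (gact bcolS s g) = bcol_pred J s.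
Proof. by rewrite /bcol_pred bcol_inv. Qed.

Lemma bcol_data_ex : exists d : D bcolS, pres D (ginl _ _) d = bd x /\
  pres D (ginr _ _) d = pres D (gfst (bS y) (gtriv gT 'I_n)) (bd y).
Proof. exact: padd_ex (gsum_is_cop _ _). Qed.

Definition bcolO : bobj D (X ** T) :=
  BObj (gcopair (bf x) (gcomp (bf y) (gfst (bS y) (gtriv gT 'I_n)))) (sval (cid bcol_data_ex)).

Definition bcolJ (J : {set 'I_n}) : bobj D (X ** T) :=
  BObj (gcomp (bf bcolO) (gincl (bcol_pred_inv J))) (pres D (gincl (bcol_pred_inv J)) (bd bcolO)).

Lemma bcolJ_sum (J : {set 'I_n}) j : j \in J -> is_bsum (bcolJ (J :\ j)) y (bcolJ J).
Proof.
move=> jJ.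
have JP (s : bS (bcolJ (J :\ j))) : bcol_pred J (gincl (bcol_pred_inv (J :\ j)) s).
  case: s => s; rewrite /= /bcol_pred; case: bcol => // k.
  by rewrite !inE => /andP[].
pose i1 : gmap (bS (bcolJ (J :\ j))) (bS (bcolJ J)) :=
  glift (f := gincl (bcol_pred_inv (J :\ j))) (bcol_pred_inv J) JP.
pose cj : gmap (bS y) (bS y ** gtriv gT 'I_n) :=
  @GMap gT (bS y) (bS y ** gtriv gT 'I_n) (fun s => gpair s (j : gtriv gT 'I_n)) (fun _ _ => erefl).
pose i2 : gmap (bS y) (bS (bcolJ J)) :=
  glift (f := gcomp (ginr (bS x) (bS y ** gtriv gT 'I_n)) cj) (bcol_pred_inv J) (fun=> jJ).
exists i1, i2; split.
- split.
  + by move=> s t [] e; apply: val_inj.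
  + by move=> s t [].
  + by move=> [s sP] t [] /= e; move: sP; rewrite e /bcol_pred /= !inE eqxx.
  + move=> [s sP]; case E : (bcol s == Some j).
      right; case: s sP E => [//|[s k]] sP /eqP[ek]; exists s; apply: val_inj => /=.
      by rewrite -ek.
    left; have sP' : bcol_pred (J :\ j) s.
      move: sP E; rewrite /bcol_pred; case: bcol => // k kJ ne.
      by rewrite !inE kJ andbT; apply: contraFN ne => /eqP->.
    by exists (gsubmk (bcol_pred_inv (J :\ j)) sP'); apply: val_inj.
- exact: gmap_eq.
- exact: gmap_eq.
- by rewrite /= -pres_comp; congr pres; apply: gmap_eq.
- rewrite /= -pres_comp; case: cid => d /= [_ d2].
  have -> : gcomp (gincl (bcol_pred_inv J)) i2 = gcomp (ginr (bS x) (bS y ** gtriv gT 'I_n)) cj.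
    exact: gmap_eq.
  rewrite pres_comp d2 -pres_comp (_ : gcomp _ _ = gid _) ?pres_id //; exact: gmap_eq.
Qed.

Lemma bcolJ0 : beq (bcolJ set0) x.
Proof.
have xP (s : bS x) : bcol_pred set0 (inl s : bcolS) by [].
pose i : gmap (bS x) (bS (bcolJ set0)) :=
  glift (f := ginl (bS x) (bS y ** gtriv gT 'I_n)) (bcol_pred_inv set0) xP.
apply: beq_iso; exists i; split.
- have [||k [k1 k2]] := @gbij_inv _ _ _ i; last by exists k.
  + by move=> s t [].
  + case=> -[s|[s k]] sP; last by exfalso; move: sP; rewrite /bcol_pred /= inE.
    by exists s; apply: val_inj.
- exact: gmap_eq.
- rewrite /= -pres_comp; case: cid => d /= [d1 _].
  by rewrite -d1; congr pres; apply: gmap_eq.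
Qed.

Lemma bcolJ_multi (J : {set 'I_n}) : beq (bcolJ J) (bmulti x y #|J|).
Proof.
move: {2}#|J| (erefl #|J|) => k; elim: k J => [|k IHk] J cJ; rewrite cJ.
  by rewrite (cards0_eq cJ); apply: bcolJ0.
have /card_gt0P[j jJ] : (0 < #|J|)%N by rewrite cJ.
have cJ' : #|J :\ j| = k by apply/eqP; rewrite -eqSS -cJ (cardsD1 j J) jJ.
have := IHk _ cJ'; rewrite cJ' => e.
exact: (is_bsum_beq e (beq_refl y) (bcolJ_sum jJ) (bsumP _ _)).
Qed.

Local Open Scope ring_scope.

(** Stratify the sections of the total object by the set of colours they use. The sections of
    [bcolJ J] are those with colours in [J], so its norm is the sum of the strata of the subsets of
    [J], and the stratum of all colours is empty. *)
Lemma phi_bcolJ_sum : \sum_(J : {set 'I_n}) phi (bcolJ J) *~ sgz_set J = 0.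
Proof.
have [E [h [e dp]]] := dpr_exists (bf bcolO).
pose om := mu (pres D e (bd bcolO) : in_shift X D E).
pose im (u : E) : {set 'I_n} := [set j | [exists x, bcol (e (gpair x u)) == Some j]].
have imI u g : im (gact E u g) = im u.
  have impl v a : im v \subset im (gact E v a).
    apply/subsetP => j; rewrite !inE => /existsP[x' jx]; apply/existsP.
    by exists (gact X x' a); rewrite -gpair_act gfunP bcol_inv.
  apply/eqP; rewrite eqEsubset impl andbT.
  by have := impl (gact E u g) g^-1%g; rewrite actK.
apply: (inclusion_exclusion (g := fun W => mtr P h (tpart om (colour_inv imI (pred1 W))))); last first.
  rewrite tpart0 ?mtr0 // => u; rewrite /colour_pred /=; apply/negbTE/negP => /eqP imT.
  (* Choosing for each of the [|X| + 1] colours a point where it is used would embed the colours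
     into [X]. *)
  have ex j : exists x', bcol (e (gpair x' u)) == Some j.
    by have := in_setT j; rewrite -imT inE => /existsP.
  pose f j := sval (cid (ex j)).
  have fI : injective f.
    move=> j k efjk; have := svalP (cid (ex j)); have := svalP (cid (ex k)).
    by rewrite -[sval (cid (ex j))]/(f j) efjk => /eqP -> /eqP [].
  by have := leq_card f fI; rewrite card_ord ltnn.
move=> J; rewrite -raddf_sum /=.
have -> : \sum_(W : {set 'I_n} | W \subset J) tpart om (colour_inv imI (pred1 W)) =
  tpart om (colour_inv imI (mem (fun W : {set 'I_n} => W \subset J))).
  by rewrite tpart_sum.
set Ji := colour_inv imI _; rewrite /tpart -mtr_comp.
(* Sections with colours in [J] take values in the source of [bcolJ J], and together they form its
   dependent product. *)
have eJP (u : X ** gsub Ji) : bcol_pred J (gcomp e (gid X ⊠ gincl Ji) u).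
  case: u => x' u; have := ginclP u; rewrite /colour_pred /= => /subsetP sJ.
  rewrite /bcol_pred; case E1: (bcol _) => [j|//]; apply: sJ.
  by rewrite inE; apply/existsP; exists x'; rewrite E1.
pose eJ : gmap (X ** gsub Ji) (bS (bcolJ J)) := glift (bcol_pred_inv J) eJP.
have dpJ : is_dpr (bf (bcolJ J)) (gcomp h (gincl Ji)) eJ.
  apply: is_dprI => [x' u|t s sP|u v e1 e2].
  - exact: (dprE dp x' (gincl Ji u)).
  - have [u [u1 u2]] := dpr_ex dp (s := fun x => gincl (bcol_pred_inv J) (s x)) sP.
    have uJ : colour_pred im (mem (fun W : {set 'I_n} => W \subset J)) u.
      apply/subsetP => j; rewrite inE => /existsP[x']; rewrite u2 => /eqP ej.
      by have := ginclP (s x'); rewrite /bcol_pred ej.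
    exists (gsubmk Ji uJ); split=> // x'; apply: val_inj.
    exact: u2.
  - apply: (@gincl_inj _ _ _ Ji); apply: (dpr_eq dp) => // x'.
    exact: (congr1 (gincl (bcol_pred_inv J)) (e2 x')).
rewrite (phiE dpJ); congr mtr; rewrite /om -(pairing_res muP) /= -!pres_comp.
congr (mu (pres D _ _ : in_shift X D _)).
by apply: gmap_eq => -[].
Qed.

(** The empty set contributes [phi x] to the alternating sum; all other terms contain at least one
    copy of [y]. *)
Lemma phi_recurrence : phi x =
  \sum_(J : {set 'I_n} | J != set0) phi (bmulti x y #|J|) *~ - sgz_set J.
Proof.
have := phi_bcolJ_sum; rewrite (bigD1 set0) //= /sgz_set cards0 expr0 mulr1z.
rewrite (phi_beq bcolJ0) => /eqP; rewrite addr_eq0 => /eqP ->.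
rewrite -sumrN; apply: eq_bigr => J _.
by rewrite (phi_beq (bcolJ_multi J)) mulrNz.
Qed.

End Difference.
End NormObjects.

Local Open Scope ring_scope.

Lemma bval_sum (gT : finGroupType) (M : mackey gT) (Z : gset gT) (x y z : bobj (in_mackey M) Z) :
  is_bsum x y z -> mtr M (bf z) (bd z : M _) = mtr M (bf x) (bd x : M _) + mtr M (bf y) (bd y : M _).
Proof.
move=> [i1 [i2 [cop f1 f2 d1 d2]]].
by rewrite -f1 -f2 -d1 -d2 !mtr_comp -mtrD -mdecomp.
Qed.

Lemma additiveMn (G H : zmodType) (f : G -> H) n : {morph f : s t / s + t} ->
  {morph f : s / s *+ n}.
Proof. by move=> fD s; elim: n => [|n IHn]; rewrite ?(additive0 fD) // !mulrS fD IHn. Qed.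

Lemma additiveB (G H : zmodType) (f : G -> H) : {morph f : s t / s + t} ->
  {morph f : s t / s - t}.
Proof. by move=> fD s t; apply: (addIr (f t)); rewrite -fD !subrK. Qed.

(** * Extension of the norm from effective elements to the group *)

Section NormExtension.
Variables (gT : finGroupType) (D : input gT) (X : gset gT) (P : mackey gT).
Implicit Types S T U E : gset gT.
Local Notation L := (lmackey D).

Section Existence.
Variable mu : forall T, in_shift X D T -> P T.
Hypothesis muP : is_pairing mu.
Local Notation phi := (@phi _ D X P mu _).
Local Notation idx := {set 'I_#|X|.+1}.

Lemma lk_multi Z (x y : bobj D Z) k : lk (bmulti x y k) = lk x + lk y *+ k.
Proof.
elim: k => [|k IHk] /=; first by rewrite mulr0n addr0.
by rewrite (lk_sum (bsumP _ _)) IHk mulrS [lk y + _]addrC addrA.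
Qed.

Lemma beq_multi T (x x' y : bobj D (X ** T)) k :
  beq (bsum x y) (bsum x' y) -> beq (bmulti x y k.+1) (bmulti x' y k.+1).
Proof.
move=> e; elim: k => [//|k IHk].
exact: (is_bsum_beq IHk (beq_refl _) (bsumP _ _) (bsumP _ _)).
Qed.

(** Equality in the group is equality after adding some [z]. The recurrence with shift [z] sees only
    [x] plus a positive multiple of [z], where the two sides agree. *)
Lemma phi_lk T (x x' : bobj D (X ** T)) : lk x = lk x' -> phi x = phi x'.
Proof.
move=> /lk_eq[z e]; rewrite (phi_recurrence muP x z) (phi_recurrence muP x' z).
apply: eq_bigr => J; rewrite -card_gt0; case: #|J| => // k _; congr (_ *~ _).
by apply: (phi_beq muP); apply: beq_multi.
Qed.

Definition in_lk T (v : L (X ** T)) := exists x : bobj D (X ** T), v = lk x.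

(** The value 0 off the effective elements is a filler that the recurrence never meets. *)
Definition phi0 T (v : L (X ** T)) : P T :=
  match pselect (in_lk v) with left e => phi (sval (cid e)) | right _ => 0 end.

Lemma phi0E T (x : bobj D (X ** T)) : phi0 (lk x) = phi x.
Proof.
rewrite /phi0; case: pselect => [e|[]]; last by exists x.
by case: cid => x' /= e'; apply: phi_lk.
Qed.

Lemma phi0_rec T (a b : L (X ** T)) : in_lk a -> in_lk b ->
  phi0 a = \sum_(J : idx | J != set0) phi0 (a + b *+ #|J|) *~ - sgz_set J.
Proof.
move=> [x ->] [y ->]; rewrite phi0E (phi_recurrence muP x y).
by apply: eq_bigr => J _; rewrite -phi0E lk_multi.
Qed.

Lemma in_lkD T (a b : L (X ** T)) : in_lk a -> in_lk b -> in_lk (a + b).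
Proof. by move=> [x ->] [y ->]; exists (bsum x y); rewrite (lk_sum (bsumP _ _)). Qed.

Lemma in_lk_ex T (v : L (X ** T)) : exists b, in_lk b /\ in_lk (v + b).
Proof.
have [x [y ->]] := lk_surj v; exists (lk y); split; first by exists y.
by exists x; rewrite subrK.
Qed.

Definition lnorm T (v : in_norm X L T) : P T :=
  pext 'I_#|X|.+1 (@phi0 T) v (sval (cid (in_lk_ex v))).

(** Take [lk y] as the shift: adding [#|J|] copies of it to [lk x - lk y] leaves [x] with one copy
    of [y] fewer, whence the predecessor. *)
Lemma lnormE T (v : L (X ** T)) (x y : bobj D (X ** T)) : v = lk x - lk y ->
  lnorm v = \sum_(J : idx | J != set0) phi (bmulti x y #|J|.-1) *~ - sgz_set J.
Proof.
move=> ev; rewrite /lnorm; case: cid => b [b1 b2] /=.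
rewrite (@pext_indep _ _ _ (@in_lk T) _ (@in_lkD T) (@phi0_rec T) v b (lk y) b1 b2).
- rewrite /pext; apply: eq_bigr => J; rewrite -card_gt0; case: #|J| => // k _.
  by rewrite -phi0E lk_multi ev mulrS addrA subrK.
- by exists y.
- by exists x; rewrite ev subrK.
Qed.

Lemma lnorm_lk T (x : bobj D (X ** T)) : lnorm (lk x) = phi x.
Proof.
rewrite (@lnormE _ _ (bsum x x) x); last by rewrite (lk_sum (bsumP _ _)) addrK.
rewrite (phi_recurrence muP x x); apply: eq_bigr => J; rewrite -card_gt0.
case: #|J| => // k _; congr (_ *~ _); apply: phi_lk.
by rewrite !lk_multi (lk_sum (bsumP _ _)) mulrS addrA.
Qed.

(** After expansion every argument is effective, so [phi_res] and [phi_tower] apply term by term. *)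
Lemma lnorm_pairing : is_pairing lnorm.
Proof.
split=> [S T f v|E T h v w [A [q [a [e [dp /= -> ->]]]]]].
- have [x [y ev]] := lk_surj (v : L (X ** T)).
  rewrite (lnormE ev) (@lnormE _ _ (bpull (gid X ⊠ f) x) (bpull (gid X ⊠ f) y)); last first.
    rewrite -!(lresE (bpullP _ _)) ev; exact: (additiveB (lresD _)).
  rewrite raddf_sum; apply: eq_bigr => J _; rewrite raddfMz; congr (_ *~ _) => /=.
  rewrite -(phi_res muP (bpullP (gid X ⊠ f) _)); apply: phi_lk.
  rewrite lk_multi -!(lresE (bpullP _ _)) lk_multi.
  by rewrite lresD (additiveMn _ (lresD _)).
- have [x [y ea]] := lk_surj (a : L A).
  rewrite (@lnormE _ _ (bpush q x) (bpush q y)); last first.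
    rewrite -!ltrE ea; exact: (additiveB (ltrD _)).
  rewrite (@lnormE _ _ (bpull e x) (bpull e y)); last first.
    rewrite -!(lresE (bpullP _ _)) ea; exact: (additiveB (lresD _)).
  rewrite raddf_sum; apply: eq_bigr => J _; rewrite raddfMz; congr (_ *~ _) => /=.
  rewrite (@phi_lk _ _ (bpush q (bmulti x y #|J|.-1))); last first.
    by rewrite lk_multi -!ltrE lk_multi ltrD (additiveMn _ (ltrD _)).
  rewrite (phi_tower muP dp (bpullP e _)); congr mtr; apply: phi_lk.
  rewrite lk_multi -!(lresE (bpullP _ _)) lk_multi.
  by rewrite lresD (additiveMn _ (lresD _)).
Qed.

Lemma lnorm_nu T (d : D (X ** T)) : lnorm (lnu d : in_norm X L T) = mu (d : in_shift X D T).
Proof.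
rewrite lnorm_lk (@phiE _ _ _ _ _ muP T (BObj (gid (X ** T)) d) T (gid T) (gid _)) /=.
  by rewrite mtr_id pres_id.
by apply: is_dprI => // t s sP; exists t; split=> // x; exact: esym (sP x).
Qed.

End Existence.

Lemma norm_unique (n n' : forall T, in_norm X L T -> P T) :
  is_pairing n -> is_pairing n' ->
  (forall T (d : D (X ** T)), n T (lnu d) = n' T (lnu d)) -> forall T v, n T v = n' T v.
Proof.
have Eval (m : forall T, in_norm X L T -> P T) (mP : is_pairing m) T
    S E (q : gmap S (X ** T)) (h : gmap E T) (e : gmap (X ** E) S) (s : L S) :
    is_dpr q h e -> m T (mtr L q s) = mtr P h (m E (mres L e s)).
  by move=> dp; apply: (pairing_tr mP); exists S, q, s, e.
(* Every element of [L] is a generator of [in_mackey L], so any norm on [L] obeys the recurrence at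
   all elements; a difference is thereby reduced to effective elements. *)
have Rec (m : forall T, in_norm X L T -> P T) (mP : is_pairing m) T
    (a b : L (X ** T)) :
    m T a = \sum_(J : {set 'I_#|X|.+1} | J != set0) m T (a + b *+ #|J|) *~ - sgz_set J.
  pose o (s : L (X ** T)) := @BObj _ (in_mackey L) (X ** T) (X ** T) (gid _) s.
  have mphi (x : bobj (in_mackey L) (X ** T)) : phi m x = m T (mtr L (bf x) (bd x)).
    have [E [h [e dp]]] := dpr_exists (bf x).
    by rewrite (phiE mP dp) (Eval m mP _ _ _ _ _ _ _ dp).
  have := phi_recurrence mP (o a) (o b); rewrite mphi mtr_id => ->.
  apply: eq_bigr => J _; congr (_ *~ _); rewrite mphi; congr (m T _).
  elim: #|J| => [|k IHk]; first by rewrite mtr_id mulr0n addr0.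
  rewrite (bval_sum (bsumP (bmulti (o a) (o b) k) (o b))) IHk mtr_id.
  by rewrite mulrS [b + _]addrC addrA.
move=> nP nP' e T v; have [x [y ->]] := lk_surj (v : L (X ** T)).
have elk (z : bobj D (X ** T)) : n T (lk z) = n' T (lk z).
  have [E [h [k dp]]] := dpr_exists (bf z).
  by rewrite lkE !(Eval _ _ _ _ _ _ _ _ _ dp) // -!(pairing_res (lnu_pairing D)) e.
rewrite (Rec n nP _ _ (lk y)) (Rec n' nP' _ _ (lk y)); apply: eq_bigr => J.
rewrite -card_gt0; case: #|J| => // k _; congr (_ *~ _).
by rewrite mulrS addrA subrK -lk_multi elk.
Qed.

End NormExtension.

(** * Change of presentation *)

Section Transport.
Variables (gT : finGroupType) (D : input gT).

Lemma universal_iso (L L' : mackey gT) (nu : forall S, D S -> L S) (nu' : forall S, D S -> L' S) :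
  universal nu -> universal nu' ->
  exists i : @iso (Mack gT) L L', 
    (forall S d, (iso_fun i : mackey_hom L L') S (nu S d) = nu' S d) /\
    (forall S d, (iso_inv i : mackey_hom L' L) S (nu' S d) = nu S d).
Proof.
move=> u u'; have [f [fE _]] := (proj2 u) L' nu' (proj1 u').
have [g [gE _]] := (proj2 u') L nu (proj1 u).
have gf : @comp (Mack gT) _ _ _ g f = idm _.
  by apply: (universal_ext u) => S d /=; rewrite fE gE.
have fg : @comp (Mack gT) _ _ _ f g = idm _.
  by apply: (universal_ext u') => S d /=; rewrite gE fE.
by exists (@Iso (Mack gT) _ _ f g gf fg).
Qed.

Lemma miso_cancel (L L' : mackey gT) (i : @iso (Mack gT) L L') S s :
  (iso_inv i : mackey_hom L' L) S ((iso_fun i : mackey_hom L L') S s) = s.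
Proof. by have := congr1 (fun h : mackey_hom L L => h S s) (iso_invl i). Qed.

Lemma pairing_comp (D' : input gT) (L P : mackey gT) (nu : forall S, D' S -> L S) (f : mackey_hom L P) :
  is_pairing nu -> is_pairing (fun S d => f S (nu S d)).
Proof.
case=> pr pt; split=> [S T h d|S' S h d d' R]; first by rewrite pr mh_res.
by rewrite (pt _ _ _ _ _ R) mh_tr.
Qed.

Lemma shift_hom_pairing X (L L' P : mackey gT) (f : mackey_hom L' L)
    (n : forall T, in_norm X L T -> P T) :
  is_pairing n -> is_pairing (D := in_norm X L') (fun T d => n T (f (X ** T) d)).
Proof.
case=> pr pt; split=> [S T h d|S' S h d d' [A [q [a [e [dp /= -> ->]]]]]].
  by rewrite -pr /= mh_res.
rewrite mh_tr mh_res; apply: pt.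
by exists A, q, (f A a), e.
Qed.

(* If [L] is presented by [D], then the norm of [L] along [X] is presented by the
   generators of [L] over [X × T]. *)
Theorem shift_universal X (L Q : mackey gT) (nu : forall S, D S -> L S)
    (kappa : forall T, in_norm X L T -> Q T) :
  universal nu -> universal kappa ->
  universal (D := in_shift X D) (fun T d => kappa T (nu (X ** T) d)).
Proof.
move=> unu uk; have [i [iE iE']] := universal_iso unu (lmackey_universal D).
have [nup nut] := proj1 unu; have [kr kt] := proj1 uk.
split.
  split=> [S T f d|S' S h d d' [A [q [a [e [dp R ->]]]]]]; first by rewrite -kr /= nup.
  rewrite (nut _ _ _ _ _ R); apply: kt; exists A, q, (nu A a), e; split=> //=.
move=> P mu muP; have nP := shift_hom_pairing (iso_fun i : mackey_hom _ _) (lnorm_pairing muP).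
have [f [fE fU]] := (proj2 uk) P _ nP; exists f; split=> [T d|g gE].
  by rewrite fE iE (lnorm_nu muP).
apply: fU => T d; pose j : mackey_hom (lmackey D) L := iso_inv i.
have gP := shift_hom_pairing j (pairing_comp g (proj1 uk)).
have := norm_unique gP (lnorm_pairing muP).
move=> /(_ _ T ((iso_fun i : mackey_hom _ _) _ d)); rewrite /j miso_cancel; apply.
move=> U d'; rewrite (lnorm_nu muP) -[RHS]gE; congr (g _ (kappa _ _)); exact: iE'.
Qed.

End Transport.

(** * Internal and external pairings *)

Section Pairings.
Variable gT : finGroupType.
Implicit Types (S T U X Y : gset gT) (M N P Q L : mackey gT).

Definition gdiag T : gmap T (T ** T) :=
  @GMap gT T (T ** T) (fun t => gpair t t) (fun _ _ => erefl).

Definition prod_pair M N T (s : M T) (t : N T) : in_prod (in_mackey M) (in_mackey N) T := (s, t).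

Section Internal.
Variables (M N P : mackey gT) (b : pairing M N P).

(** Restriction to the diagonal loses nothing, as [ext_int] shows, and it gives the form with all
    generators over a single G-set. *)
Definition int_pair T (d : in_prod (in_mackey M) (in_mackey N) T) : P T :=
  mres P (gdiag T) (b T T d.1 d.2).

Lemma pr_trl X X' Y (f : gmap X X') s t :
  b X' Y (mtr M f s) t = mtr P (f ⊠ gid Y) (b X Y s t).
Proof. by rewrite -pr_tr mtr_id. Qed.
Lemma pr_trr X Y Y' (g : gmap Y Y') s t :
  b X Y' s (mtr N g t) = mtr P (gid X ⊠ g) (b X Y s t).
Proof. by rewrite -pr_tr mtr_id. Qed.
Lemma pr_resl X X' Y (f : gmap X' X) s t :
  b X' Y (mres M f s) t = mres P (f ⊠ gid Y) (b X Y s t).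
Proof. by rewrite -pr_res mres_id. Qed.
Lemma pr_resr X Y Y' (g : gmap Y' Y) s t :
  b X Y' s (mres N g t) = mres P (gid X ⊠ g) (b X Y s t).
Proof. by rewrite -pr_res mres_id. Qed.

(** Reciprocity is base change: the pullback of [h ⊠ gid S] along the diagonal of [S] is the graph
    of [h], and likewise in the other variable. *)
Lemma int_pairing : is_pairing int_pair.
Proof.
split=> [S T f [s t]|S' S h [s t] [s' t']]; rewrite /int_pair /=.
  by rewrite pr_res -!mres_comp; congr mres; apply: gmap_eq.
case=> -[-> ->].
- rewrite pr_trl pr_resr -mres_comp.
  rewrite (@mbase _ _ S' _ _ _ (gcomp (gid S' ⊠ h) (gdiag S')) h) //.
  by apply: is_pbI => [w|[x y] z /= [ez ->]|w w' /= []] //; exists x; rewrite -ez.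
- rewrite pr_trr pr_resl -mres_comp.
  rewrite (@mbase _ _ S' _ _ _ (gcomp (h ⊠ gid S') (gdiag S')) h) //.
  by apply: is_pbI => [w|[x y] z /= [-> ez]|w w' /= []] //; exists y; rewrite -ez.
Qed.

End Internal.

Section Additivity.
Variables (M P : mackey gT) (D : input gT).

Definition gfold T : gmap (gsum T T) T := gcopair (gid T) (gid T).

Lemma gfoldl T : gcomp (gfold T) (ginl T T) = gid T. Proof. exact: gmap_eq. Qed.
Lemma gfoldr T : gcomp (gfold T) (ginr T T) = gid T. Proof. exact: gmap_eq. Qed.

Lemma mfold (A : mackey gT) T (u : A (gsum T T)) :
  mtr A (gfold T) u = mres A (ginl T T) u + mres A (ginr T T) u.
Proof.
rewrite {1}(mdecomp u (gsum_is_cop T T)) mtrD -!mtr_comp.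
by rewrite gfoldl gfoldr !mtr_id.
Qed.

(** A sum is the transfer along the fold map [T ⊔ T -> T] of the element with the two summands as
    components, so additivity follows from the transfer relations. *)
Lemma pair_addl (nu : forall S, in_prod (in_mackey M) D S -> P S) T (s s' : M T) (d : D T) :
  is_pairing nu -> nu T (s + s', d) = nu T (s, d) + nu T (s', d).
Proof.
case=> pr pt; have [u [us us']] := madd_ex s s' (gsum_is_cop T T).
rewrite -us -us' -mfold.
rewrite (pt _ _ (gfold T) (mtr M (gfold T) u, d) (u, pres D (gfold T) d)); last by left.
rewrite mfold -!pr /= -!pres_comp.
by rewrite gfoldl gfoldr pres_id.
Qed.

Lemma pair_addr (nu : forall S, in_prod D (in_mackey M) S -> P S) T (s s' : M T) (d : D T) :
  is_pairing nu -> nu T (d, s + s') = nu T (d, s) + nu T (d, s').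
Proof.
case=> pr pt; have [u [us us']] := madd_ex s s' (gsum_is_cop T T).
rewrite -us -us' -mfold.
rewrite (pt _ _ (gfold T) (d, mtr M (gfold T) u) (pres D (gfold T) d, u)); last by right.
rewrite mfold -!pr /= -!pres_comp.
by rewrite gfoldl gfoldr pres_id.
Qed.

End Additivity.

Section External.
Variables (M N P : mackey gT) (nu : forall S, in_prod (in_mackey M) (in_mackey N) S -> P S).
Hypothesis nuP : is_pairing nu.

Definition ext_fun X Y (s : M X) (t : N Y) : P (X ** Y) :=
  nu (prod_pair (mres M (gfst X Y) s) (mres N (gsnd X Y) t)).

Lemma pb_fst X X' Y (f : gmap X' X) : is_pb (gfst X' Y) (f ⊠ gid Y) f (gfst X Y).
Proof.
apply: is_pbI => [[x y]|x [x' y] /= <-|[x y] [x' y'] /= -> [->]] //.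
by exists (gpair x y).
Qed.

Lemma pb_snd X Y Y' (g : gmap Y' Y) : is_pb (gsnd X Y') (gid X ⊠ g) g (gsnd X Y).
Proof.
apply: is_pbI => [[x y]|y [x y'] /= <-|[x y] [x' y'] /= -> [->]] //.
by exists (gpair x y).
Qed.

Definition ext_pair : pairing M N P.
Proof.
apply: (@Pairing gT M N P ext_fun).
- by move=> X Y s s' t; rewrite /ext_fun mresD /prod_pair (pair_addl _ _ _ nuP).
- by move=> X Y s t t'; rewrite /ext_fun mresD /prod_pair (pair_addr _ _ _ nuP).
- have [pr pt] := nuP; move=> X X' Y Y' f g s t; rewrite /ext_fun -pr /= -!mres_comp.
  by congr (nu (mres M _ s, mres N _ t)); apply: gmap_eq.
- have [pr pt] := nuP; move=> X X' Y Y' f g s t; rewrite /ext_fun (mbase _ (pb_fst Y' f)).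
  rewrite (pt _ _ (f ⊠ gid Y') _ (prod_pair (mres M (gfst X Y') s) (mres N (gsnd X Y') (mtr N g t)))); last first.
    left; split=> //=; rewrite -mres_comp; congr mres; exact: gmap_eq.
  rewrite (mbase _ (pb_snd X g)).
  rewrite (pt _ _ (gid X ⊠ g) _ (prod_pair (mres M (gfst X Y) s) (mres N (gsnd X Y) t))); last first.
    right; split=> //=; rewrite -mres_comp; congr mres; exact: gmap_eq.
  rewrite -mtr_comp; congr mtr; exact: gmap_eq.
Defined.

Lemma int_ext T d : int_pair ext_pair d = nu (S := T) d.
Proof.
case: d => s t; rewrite /int_pair /= /ext_fun -(pairing_res nuP) /= -!mres_comp.
rewrite /prod_pair (_ : gcomp (gfst T T) _ = gid T); last exact: gmap_eq.
by rewrite (_ : gcomp (gsnd T T) _ = gid T) ?mres_id //; apply: gmap_eq.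
Qed.

End External.

Lemma ext_int M N P (b : pairing M N P) X Y s t :
  int_pair b (prod_pair (mres M (gfst X Y) s) (mres N (gsnd X Y) t)) = b X Y s t.
Proof.
rewrite /int_pair /= pr_res -mres_comp (_ : gcomp _ _ = gid _) ?mres_id //.
by apply: gmap_eq => -[].
Qed.

Definition is_box M N Q (b : pairing M N Q) :=
  forall P (theta : pairing M N P), exists! phi : mackey_hom Q P,
    forall X Y (s : M X) (t : N Y), phi (X ** Y) (b X Y s t) = theta X Y s t.

Lemma is_box_universal M N Q (b : pairing M N Q) : is_box b -> universal (int_pair b).
Proof.
move=> bb; split=> [|P mu muP]; first exact: int_pairing.
have [f [fE fU]] := bb P (ext_pair muP); exists f; split=> [S d|g gE].
  by rewrite -(int_ext muP) /int_pair mh_res fE.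
apply: fU => X Y s t; rewrite -[b _ _ _ _]ext_int gE.
by rewrite -[RHS](ext_int (ext_pair muP)) int_ext.
Qed.

Lemma universal_is_box M N Q (nu : forall S, in_prod (in_mackey M) (in_mackey N) S -> Q S)
   (u : universal nu) : is_box (ext_pair (proj1 u)).
Proof.
move=> P theta; have [f [fE fU]] := (proj2 u) P _ (int_pairing theta).
exists f; split=> [X Y s t|g gE]; first by rewrite [LHS]fE ext_int.
apply: fU => S d; rewrite -(int_ext (proj1 u)) /int_pair mh_res gE //.
Qed.

Section Homs.
Variables (M N : mackey gT).

Definition mh_sum (f g : mackey_hom M N) : mackey_hom M N.
Proof.
exists (fun X s => f X s + g X s).
- by move=> X s t; rewrite !mh_add addrACA.
- by move=> X Y h s; rewrite !mh_res mresD.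
- by move=> X Y h s; rewrite !mh_tr mtrD.
Defined.

End Homs.

Section ShiftHoms.
Variables (P : mackey gT) (X Y : gset gT) (f : gmap X Y).

Definition shiftl_res : mackey_hom (mshiftl Y P) (mshiftl X P).
Proof.
exists (fun S (s : mshiftl Y P S) => mres P (f ⊠ gid S) s).
- by move=> S s t; apply: (@mresD _ P _ _ (f ⊠ gid S)).
- by move=> S T h s /=; rewrite -!mres_comp; congr mres; apply: gmap_eq.
- by move=> S T h s /=; apply: mbase; apply: pb_prod_mid.
Defined.

Definition shiftl_tr : mackey_hom (mshiftl X P) (mshiftl Y P).
Proof.
exists (fun S (s : mshiftl X P S) => mtr P (f ⊠ gid S) s).
- by move=> S s t; apply: (@mtrD _ P _ _ (f ⊠ gid S)).
- by move=> S T h s /=; apply: esym; apply: mbase; apply: is_pb_sym; apply: pb_prod_mid.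
- by move=> S T h s /=; rewrite -!mtr_comp; congr mtr; apply: gmap_eq.
Defined.

Definition shiftr_res : mackey_hom (mshiftr Y P) (mshiftr X P).
Proof.
exists (fun S (s : mshiftr Y P S) => mres P (gid S ⊠ f) s).
- by move=> S s t; apply: (@mresD _ P _ _ (gid S ⊠ f)).
- by move=> S T h s /=; rewrite -!mres_comp; congr mres; apply: gmap_eq.
- by move=> S T h s /=; apply: mbase; apply: is_pb_sym; apply: pb_prod_mid.
Defined.

Definition shiftr_tr : mackey_hom (mshiftr X P) (mshiftr Y P).
Proof.
exists (fun S (s : mshiftr X P S) => mtr P (gid S ⊠ f) s).
- by move=> S s t; apply: (@mtrD _ P _ _ (gid S ⊠ f)).
- by move=> S T h s /=; apply: esym; apply: mbase; apply: pb_prod_mid.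
- by move=> S T h s /=; rewrite -!mtr_comp; congr mtr; apply: gmap_eq.
Defined.

End ShiftHoms.

(** * Currying of pairings *)

Section ProductUniversal.
Variables (D D' : input gT) (L L' : mackey gT).
Variables (nu : forall S, D S -> L S) (nu' : forall S, D' S -> L' S).
Hypotheses (u : universal nu) (u' : universal nu').

Section PairingHoms.
Variables (P : mackey gT) (b : pairing L L' P).

Definition prhom_l Y (t : L' Y) : mackey_hom L (mshiftr Y P).
Proof.
exists (fun X s => b X Y s t : mshiftr Y P X).
- by move=> X s s'; apply: pr_addl.
- by move=> X X' f s; apply: pr_resl.
- by move=> X X' f s; apply: pr_trl.
Defined.

Definition prhom_r X (s : L X) : mackey_hom L' (mshiftl X P).
Proof.
exists (fun Y t => b X Y s t : mshiftl X P Y).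
- by move=> Y t t'; apply: pr_addr.
- by move=> Y Y' f t; apply: pr_resr.
- by move=> Y Y' f t; apply: pr_trr.
Defined.

End PairingHoms.

(** With one variable fixed, a pairing is a map into a shifted Mackey functor, so generators can be
    tested one variable at a time. *)
Lemma pairing_ext P (b c : pairing L L' P) :
  (forall X Y (d : D X) (d' : D' Y), b X Y (nu d) (nu' d') = c X Y (nu d) (nu' d')) ->
  forall X Y s t, b X Y s t = c X Y s t.
Proof.
move=> e X Y s t.
have e1 Y' (d' : D' Y') : prhom_l b (nu' d') = prhom_l c (nu' d').
  by apply: (universal_ext u) => S d /=.
have e2 : prhom_r b s = prhom_r c s.
  apply: (universal_ext u') => S d' /=.
  by have := congr1 (fun f : mackey_hom _ _ => f X s) (e1 S d').
by have := congr1 (fun f : mackey_hom _ _ => f Y t) e2.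
Qed.

Variables (P : mackey gT) (mu : forall S, in_prod D D' S -> P S).
Hypothesis muP : is_pairing mu.

Definition muX X Y (d : D X) (d' : D' Y) : P (X ** Y) :=
  mu ((pres D (gfst X Y) d, pres D' (gsnd X Y) d') : in_prod D D' (X ** Y)).

Lemma muX_res X X' Y Y' (f : gmap X' X) (g : gmap Y' Y) d d' :
  muX (pres D f d) (pres D' g d') = mres P (f ⊠ g) (muX d d').
Proof.
rewrite /muX -(pairing_res muP) /= -!pres_comp.
by congr (mu ((pres D _ d, pres D' _ d') : in_prod D D' _)); apply: gmap_eq.
Qed.

Lemma muX_pairing Y (d' : D' Y) : 
  is_pairing (fun X (d : D X) => muX d d' : mshiftr Y P X).
Proof.
split=> [S T f d|S' S h d d1 R] /=; first by rewrite -[in RHS](pres_id d') -muX_res !pres_id.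
apply: (pairing_tr muP); left; split=> /=; first exact: (irel_pb (pb_fst Y h) R).
by rewrite -pres_comp; congr pres; apply: gmap_eq.
Qed.

(** The extension in the first variable with a generator fixed in the second. [curry2] then extends
    in the second variable, and uniqueness makes the result additive and natural in the first. *)
Definition curry1 Y (d' : D' Y) : mackey_hom L (mshiftr Y P) :=
  sval (cid (proj2 u _ _ (muX_pairing d'))).
Lemma curry1E Y (d' : D' Y) X (d : D X) : curry1 d' X (nu d) = muX d d'.
Proof. by rewrite /curry1; case: cid => f [/= -> _]. Qed.

Lemma curry1_pairing X (l : L X) :
  is_pairing (fun Y (d' : D' Y) => curry1 d' X l : mshiftl X P Y).
Proof.
split=> [S T f d|S' S h d d1 R] /=.
  have -> : curry1 (pres D' f d) = mackey_comp (shiftr_res P f) (curry1 d).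
    apply: (universal_ext u) => Z c; rewrite /= !curry1E.
    by rewrite -[in LHS](pres_id c) muX_res.
  by [].
have -> : curry1 d = mackey_comp (shiftr_tr P h) (curry1 d1).
  apply: (universal_ext u) => Z c; rewrite /= !curry1E.
  apply: (pairing_tr muP); right; split=> /=; last exact: (irel_pb (pb_snd Z h) R).
  by rewrite -pres_comp; congr pres; apply: gmap_eq.
by [].
Qed.

Definition curry2 X (l : L X) : mackey_hom L' (mshiftl X P) :=
  sval (cid (proj2 u' _ _ (curry1_pairing l))).
Lemma curry2E X (l : L X) Y (d' : D' Y) : curry2 l Y (nu' d') = curry1 d' X l.
Proof. by rewrite /curry2; case: cid => f [/= -> _]. Qed.

Lemma curry2_res X X' (f : gmap X' X) l : curry2 (mres L f l) = mackey_comp (shiftl_res P f) (curry2 l).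
Proof. by apply: (universal_ext u') => S d; rewrite /= !curry2E mh_res. Qed.
Lemma curry2_tr X X' (f : gmap X' X) l : curry2 (mtr L f l) = mackey_comp (shiftl_tr P f) (curry2 l).
Proof. by apply: (universal_ext u') => S d; rewrite /= !curry2E mh_tr. Qed.
Lemma curry2_add X (l l' : L X) : curry2 (l + l') = mh_sum (curry2 l) (curry2 l').
Proof. by apply: (universal_ext u') => S d; rewrite /= !curry2E mh_add. Qed.

Definition uncurry : pairing L L' P.
Proof.
apply: (@Pairing gT L L' P (fun X Y s t => curry2 s Y t)).
- by move=> X Y s s' t; rewrite curry2_add.
- by move=> X Y s t t'; apply: (mh_add (curry2 s)).
- move=> X X' Y Y' f g s t; rewrite curry2_res mh_res /= -mres_comp.
  by congr mres; apply: gmap_eq.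
- move=> X X' Y Y' f g s t; rewrite curry2_tr mh_tr /= -mtr_comp.
  by congr mtr; apply: gmap_eq.
Defined.

Lemma uncurryE X Y (d : D X) (d' : D' Y) : uncurry X Y (nu d) (nu' d') = muX d d'.
Proof. by rewrite /= curry2E curry1E. Qed.

End ProductUniversal.

Theorem prod_universal (D D' : input gT) (L L' Q : mackey gT)
    (nu : forall S, D S -> L S) (nu' : forall S, D' S -> L' S)
    (kappa : forall S, in_prod (in_mackey L) (in_mackey L') S -> Q S) :
  universal nu -> universal nu' -> universal kappa ->
  universal (D := in_prod D D') (fun S d => kappa S (prod_pair (nu S d.1) (nu' S d.2))).
Proof.
move=> u u' uk; have [kr kt] := proj1 uk; have [nr nt] := proj1 u; have [nr' nt'] := proj1 u'.
split.
  split=> [S T f [d d']|S' S h [d d'] [s s'] /=]; first by rewrite -kr /= nr nr'.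
  case=> -[H H']; apply: kt; [left|right]; split=> /=.
  - exact: nt.
  - by rewrite H'.
  - by rewrite H.
  - exact: nt'.
move=> P mu muP.
have [f [fE fU]] := (proj2 uk) P _ (int_pairing (uncurry u u' muP)).
exists f; split=> [S [d d']|g gE].
  rewrite fE /int_pair uncurryE /muX -(pairing_res muP) /= -!pres_comp.
  rewrite (_ : gcomp (gfst S S) _ = gid S); last exact: gmap_eq.
  by rewrite (_ : gcomp (gsnd S S) _ = gid S) ?pres_id //; apply: gmap_eq.
apply: fU => S d; pose gP := pairing_comp g (proj1 uk).
rewrite -(int_ext gP) /int_pair; congr mres.
apply: (pairing_ext u u') => X Y c c'; rewrite uncurryE /= /ext_fun -nr -nr'.
exact: (gE _ (pres D _ c, pres D' _ c')).
Qed.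

End Pairings.

(** * Existence of the box product *)

(** Compatibility with restrictions and transfers gives additivity, again by the fold map. *)
Lemma universal_self (gT : finGroupType) (M : mackey gT) :
  universal (D := in_mackey M) (fun S (d : M S) => d).
Proof.
split=> [|P mu muP]; first by split=> // S' S h d d' /= ->.
have [pr pt] := muP.
have muD X (s t : M X) : mu X (s + t) = mu X s + mu X t.
  have [u [us us']] := madd_ex s t (gsum_is_cop X X).
  rewrite -us -us' -mfold (pt _ _ (gfold X) _ u) // mfold.
  by rewrite -(pr _ _ (ginl X X)) -(pr _ _ (ginr X X)).
have mutr X Y (f : gmap X Y) s : mu Y (mtr M f s) = mtr P f (mu X s) by apply: pt.
exists (@MackeyHom gT M P mu muD pr mutr); split=> // g gE.
by apply: mackey_hom_eq => X s; rewrite /= gE.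
Qed.

Section BoxTheory.
Variable gT : finGroupType.
Implicit Types (X Y Z S T : gset gT) (M N P Q : mackey gT).
Variable bx : mackey gT -> mackey gT -> mackey gT.
Variable bt : forall M N T, M T -> N T -> bx M N T.
Hypothesis bu : forall M N,
  universal (D := in_prod (in_mackey M) (in_mackey N)) (fun T d => bt d.1 d.2).

Lemma bt_res M N S T (f : gmap S T) (s : M T) (t : N T) :
  mres _ f (bt s t) = bt (mres M f s) (mres N f t).
Proof. by have [[pr _] _] := bu M N; rewrite -(pr _ _ f (s, t)). Qed.

Lemma bt_trl M N S T (f : gmap S T) (s : M S) (t : N T) :
  bt (mtr M f s) t = mtr _ f (bt s (mres N f t)).
Proof.
have [[_ pt] _] := bu M N; apply: (pt _ _ f (mtr M f s, t) (s, mres N f t)).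
by left.
Qed.

Lemma bt_trr M N S T (f : gmap S T) (s : M T) (t : N S) :
  bt s (mtr N f t) = mtr _ f (bt (mres M f s) t).
Proof.
have [[_ pt] _] := bu M N; apply: (pt _ _ f (s, mtr N f t) (mres M f s, t)).
by right.
Qed.

Lemma bt_addl M N T (s s' : M T) (t : N T) : bt (s + s') t = bt s t + bt s' t.
Proof. exact: (@pair_addl _ _ _ (in_mackey N) _ _ s s' t (proj1 (bu M N))). Qed.

Lemma bu2 (D D' : input gT) M N (nu : forall S, D S -> M S) (nu' : forall S, D' S -> N S) :
  universal nu -> universal nu' ->
  universal (D := in_prod D D') (fun S d => bt (nu S d.1) (nu' S d.2)).
Proof. by move=> u u'; apply: (prod_universal u u' (bu M N)). Qed.

Lemma bt_ext M N P (f g : mackey_hom (bx M N) P) :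
  (forall T (s : M T) (t : N T), f T (bt s t) = g T (bt s t)) -> f = g.
Proof. by move=> e; apply: (universal_ext (bu M N)) => T [s t]; apply: e. Qed.

Definition bu3l M N P := bu2 (bu M N) (universal_self P).
Definition bu3r M N P := bu2 (universal_self M) (bu N P).

Lemma bt_ext3l M N P Q (f g : mackey_hom (bx (bx M N) P) Q) :
  (forall T (s : M T) (t : N T) (u : P T), f T (bt (bt s t) u) = g T (bt (bt s t) u)) -> f = g.
Proof. by move=> e; apply: (universal_ext (bu3l M N P)) => T [[s t] u]; apply: e. Qed.

Lemma bt_ext3r M N P Q (f g : mackey_hom (bx M (bx N P)) Q) :
  (forall T (s : M T) (t : N T) (u : P T), f T (bt s (bt t u)) = g T (bt s (bt t u))) -> f = g.
Proof. by move=> e; apply: (universal_ext (bu3r M N P)) => T [s [t u]]; apply: e. Qed.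

Lemma bt_ext4 M N P Q R (f g : mackey_hom (bx (bx (bx M N) P) Q) R) :
  (forall T (s : M T) (t : N T) (u : P T) (v : Q T),
     f T (bt (bt (bt s t) u) v) = g T (bt (bt (bt s t) u) v)) -> f = g.
Proof.
by move=> e; apply: (universal_ext (bu2 (bu3l M N P) (universal_self Q))) => T [[[s t] u] v]; apply: e.
Qed.

Lemma bmap_ex M M' N N' (f : mackey_hom M M') (g : mackey_hom N N') :
  exists h : mackey_hom (bx M N) (bx M' N'), forall T s t,
    h T (bt s t) = bt (f T s) (g T t).
Proof.
have [|h [hE _]] := (proj2 (bu M N)) (bx M' N') (fun T d => bt (f T d.1) (g T d.2)).
  split=> [S T k [s t]|S' S k [s t] [s' t'] /=]; first by rewrite /= bt_res !mh_res.
  by case=> -[-> ->]; rewrite mh_tr ?bt_trl ?bt_trr mh_res.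
by exists h => T s t; rewrite (hE T (s, t)).
Qed.

Definition bmap M M' N N' (f : mackey_hom M M') (g : mackey_hom N N') := sval (cid (bmap_ex f g)).
Lemma bmapE M M' N N' (f : mackey_hom M M') (g : mackey_hom N N') T s t :
  bmap f g T (bt s t) = bt (f T s) (g T t).
Proof. by rewrite /bmap; case: cid => h /= ->. Qed.

Definition bfunctor : functor (prodcat (Mack gT) (Mack gT)) (Mack gT).
Proof.
apply: (@Functor (prodcat (Mack gT) (Mack gT)) (Mack gT) (fun u => bx u.1 u.2)
  (fun u v f => bmap (f.1 : mackey_hom u.1 v.1) (f.2 : mackey_hom u.2 v.2))).
- by move=> [M N] /=; apply: bt_ext => T s t; rewrite bmapE.
- by move=> [M N] [M' N'] [M'' N''] [f g] [f' g'] /=; apply: bt_ext => T s t; rewrite /= !bmapE.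
Defined.

Lemma assoc_ex M N P : exists i : @iso (Mack gT) (bx (bx M N) P) (bx M (bx N P)),
  forall T s t u, (iso_fun i : mackey_hom _ _) T (bt (bt s t) u) = bt s (bt t u).
Proof.
have [|h [hE _]] := (proj2 (bu3l M N P)) (bx M (bx N P)) (fun T d => bt d.1.1 (bt d.1.2 d.2)).
  split=> [S T k [[s t] u]|S' S k [[s t] u] [[s' t'] u'] /=]; first by rewrite /= !bt_res.
  case=> -[]; last by case=> -> -> ->; rewrite !bt_trr ?bt_res.
  by case=> -[-> ->] ->; rewrite ?bt_trl ?bt_trr ?bt_res.
have [|h' [hE' _]] := (proj2 (bu3r M N P)) (bx (bx M N) P) (fun T d => bt (bt d.1 d.2.1) d.2.2).
  split=> [S T k [s [t u]]|S' S k [s [t u]] [s' [t' u']] /=]; first by rewrite /= !bt_res.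
  case=> -[]; first by move=> -> [-> ->]; rewrite !bt_trl ?bt_res.
  by move=> -> [[-> ->]|[-> ->]]; rewrite ?bt_trl ?bt_trr ?bt_trl ?bt_res.
have e1 : @comp (Mack gT) _ _ _ h' h = idm _.
  apply: bt_ext3l => T s t u /=.
  by rewrite (hE T (s, t, u)) (hE' T (s, (t, u))).
have e2 : @comp (Mack gT) _ _ _ h h' = idm _.
  apply: bt_ext3r => T s t u /=.
  by rewrite (hE' T (s, (t, u))) (hE T (s, t, u)).
by exists (@Iso (Mack gT) _ _ h h' e1 e2) => T s t u /=; rewrite (hE T (s, t, u)).
Qed.

Lemma braid_ex M N : exists i : @iso (Mack gT) (bx M N) (bx N M),
  forall T s t, (iso_fun i : mackey_hom _ _) T (bt s t) = bt t s.
Proof.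
have ex M' N' : exists h : mackey_hom (bx M' N') (bx N' M'), forall T s t,
    h T (bt s t) = bt t s.
  have [|h [hE _]] := (proj2 (bu M' N')) (bx N' M') (fun T d => bt d.2 d.1).
    split=> [S T k [s t]|S' S k [s t] [s' t'] /=]; first by rewrite /= bt_res.
    by case=> -[-> ->]; rewrite ?bt_trl ?bt_trr.
  by exists h => T s t; rewrite (hE T (s, t)).
have [h hE] := ex M N; have [h' hE'] := ex N M.
have e1 : @comp (Mack gT) _ _ _ h' h = idm _ by apply: bt_ext => T s t /=; rewrite hE hE'.
have e2 : @comp (Mack gT) _ _ _ h h' = idm _ by apply: bt_ext => T s t /=; rewrite hE' hE.
by exists (@Iso (Mack gT) _ _ h h' e1 e2).
Qed.

Variables (U : mackey gT) (un : forall T, U T).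
Hypothesis uu : universal (D := in_pt gT) (fun T _ => un T).

Lemma un_res S T (f : gmap S T) : mres U f (un T) = un S.
Proof. by have [[pr _] _] := uu; rewrite -(pr _ _ f tt). Qed.

Definition bulu M := bu2 uu (universal_self M).
Definition buru M := bu2 (universal_self M) uu.

Lemma lunit_ext M P (f g : mackey_hom (bx U M) P) :
  (forall T (s : M T), f T (bt (un T) s) = g T (bt (un T) s)) -> f = g.
Proof. by move=> e; apply: (universal_ext (bulu M)) => T [[] s]; apply: e. Qed.

Lemma runit_ext M P (f g : mackey_hom (bx M U) P) :
  (forall T (s : M T), f T (bt s (un T)) = g T (bt s (un T))) -> f = g.
Proof. by move=> e; apply: (universal_ext (buru M)) => T [s []]; apply: e. Qed.

Lemma lunit_ex M : exists i : @iso (Mack gT) (bx U M) M,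
  (forall T s, (iso_fun i : mackey_hom _ _) T (bt (un T) s) = s).
Proof.
have [|h [hE _]] := (proj2 (bulu M)) M (fun T d => d.2).
  split=> [S T k [[] t]|S' S k [[] t] [[] t'] /=] //.
  case=> -[H1 H2] //; by rewrite H2 mtr_res_bij.
have [|h' [hE' _]] := (proj2 (universal_self M)) (bx U M) (fun T d => bt (un T) d).
  split=> [S T k s|S' S k s s' /= ->] /=; first by rewrite bt_res un_res.
  by rewrite bt_trr un_res.
have {}hE T s : h T (bt (un T) s) = s by rewrite (hE T (tt, s)).
have e1 : @comp (Mack gT) _ _ _ h' h = idm _ by apply: lunit_ext => T s /=; rewrite hE hE'.
have e2 : @comp (Mack gT) _ _ _ h h' = idm _ by apply: mackey_hom_eq => T s /=; rewrite hE' hE.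
by exists (@Iso (Mack gT) _ _ h h' e1 e2).
Qed.

Lemma runit_ex M : exists i : @iso (Mack gT) (bx M U) M,
  (forall T s, (iso_fun i : mackey_hom _ _) T (bt s (un T)) = s).
Proof.
have [b bE] := braid_ex M U; have [l lE] := lunit_ex M.
by exists (iso_comp l b) => T s /=; rewrite bE lE.
Qed.

Definition bassoc M N P := sval (cid (assoc_ex M N P)).
Lemma bassocE M N P T s t u :
  (iso_fun (bassoc M N P) : mackey_hom _ _) T (bt (bt s t) u) = bt s (bt t u).
Proof. exact: (svalP (cid (assoc_ex M N P))). Qed.
Definition bbraid M N := sval (cid (braid_ex M N)).
Lemma bbraidE M N T s t : (iso_fun (bbraid M N) : mackey_hom _ _) T (bt s t) = bt t s.
Proof. exact: (svalP (cid (braid_ex M N))). Qed.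
Definition blunit M := sval (cid (lunit_ex M)).
Lemma blunitE M T s : (iso_fun (blunit M) : mackey_hom _ _) T (bt (un T) s) = s.
Proof. exact: (svalP (cid (lunit_ex M))). Qed.
Definition brunit M := sval (cid (runit_ex M)).
Lemma brunitE M T s : (iso_fun (brunit M) : mackey_hom _ _) T (bt s (un T)) = s.
Proof. exact: (svalP (cid (runit_ex M))). Qed.

(** Each axiom equates two maps out of an iterated box product, and both sides rearrange elementary
    tensors in the same way. *)
Definition box_symmon : symmon (Mack gT).
Proof.
apply: (@SymMon (Mack gT) bfunctor U bassoc blunit brunit bbraid); rewrite /bifmap /=.
- move=> M M' N N' P P' f g h; apply: bt_ext3l => T s t u.
  by rewrite /= bassocE !bmapE bassocE.
- move=> M M' f; apply: lunit_ext => T s; by rewrite /= bmapE /= !blunitE.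
- move=> M M' f; apply: runit_ext => T s; by rewrite /= bmapE /= !brunitE.
- move=> M M' N N' f g; apply: bt_ext => T s t; by rewrite /= bbraidE !bmapE bbraidE.
- move=> M N P Q; apply: bt_ext4 => T s t u v.
  by rewrite /= !bassocE !bmapE /= !bassocE !bmapE /= !bassocE.
- move=> M N; apply: (universal_ext (bu2 (buru M) (universal_self N))) => T [[s []] t].
  by rewrite /= bassocE !bmapE /= blunitE brunitE.
- move=> M N P; apply: bt_ext3l => T s t u.
  by rewrite /= bassocE bbraidE bassocE !bmapE bbraidE bassocE bmapE /= bbraidE.
- by move=> M N; apply: bt_ext => T s t; rewrite /= !bbraidE.
Defined.

Variable bU : burnside U.
Hypothesis bUE : bcl bU (gid (gpt gT)) = un (gpt gT).

Definition box_exists : box_product gT.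
Proof.
pose pr M N := ext_pair (proj1 (bu M N)).
have prE M N X Y s t : pr M N X Y s t = bt (mres M (gfst X Y) s) (mres N (gsnd X Y) t) by [].
apply: (@BoxProduct gT box_symmon pr _ bU).
- by move=> M N P theta; apply: (universal_is_box (bu M N)).
- by move=> M M' N N' f g X Y s t; rewrite !prE /bifmap /= bmapE !mh_res.
- move=> M N P X Y Z s t u; rewrite !prE !bt_res bassocE -!mres_comp.
  by congr bt.
- move=> M N X Y s t; rewrite !prE bbraidE bt_res -!mres_comp.
  by congr bt; congr mres; apply: gmap_eq.
- by move=> M X s; rewrite !prE bUE un_res blunitE.
- by move=> M X s; rewrite !prE bUE un_res brunitE.
Defined.

End BoxTheory.

(** * The Burnside functor as the functor presented by one point *)

Section BurnsideExists.
Variable gT : finGroupType.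

(** The Grothendieck property is [lext_ex]: the steps of [in_pt] are isomorphisms, so an additive
    isomorphism invariant respects them. *)
Definition burnside_pt : burnside (lmackey (in_pt gT)).
Proof.
apply: (@Burnside gT (lmackey (in_pt gT)) (fun X Y f => lk (@BObj gT (in_pt gT) X Y f tt))).
- move=> X Y Y' f i; apply: lk_beq; apply: beq_sym; apply: beq_iso.
  exists (iso_fun i : gmap Y' Y); split=> //; exact: giso_bij.
- move=> X Y Y' f f'; apply: lk_sum; exists (ginl Y Y'), (ginr Y Y'); split=> //.
  + exact: gsum_is_cop.
  + exact: gmap_eq.
  + exact: gmap_eq.
- move=> X Z c ci cs.
  have [|x y z [i1 [i2 [cop f1 f2 _ _]]]|f [fD fE]] :=
      @lext_ex gT (in_pt gT) X Z (fun x => c _ (bf x)).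
  + move=> [S f []] [S' f' []] [h [/= -> /gbij_iso[i <-]]]; by rewrite ci.
  + have /gbij_iso[i ei] := gcopair_bij cop.
    rewrite -(ci _ _ (bf z) i) -cs; congr c; apply: gmap_eq => -[u|u]; rewrite /= ei /=.
    * by rewrite -f1.
    * by rewrite -f2.
  exists f; split=> [|g [gD gE]]; first by split=> // Y h; rewrite fE.
  apply: funext; apply: (lk_ind fD gD) => -[S h []]; by rewrite fE gE.
- by move=> X X' Y g f; rewrite /= ltrE.
- move=> W X X' Y a b f g /pullback_is_pb p; rewrite /=.
  by apply: lresE; exists a.
Defined.

Theorem box_product_exists : inhabited (box_product gT).
Proof.
pose bx (M N : mackey gT) := lmackey (in_prod (in_mackey M) (in_mackey N)).
pose bt (M N : mackey gT) T (s : M T) (t : N T) : bx M N T :=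
  lnu (prod_pair s t).
have bu M N : universal (D := in_prod (in_mackey M) (in_mackey N)) (fun T d => bt M N T d.1 d.2).
  have -> : (fun T d => bt M N T d.1 d.2) = @lnu gT (in_prod (in_mackey M) (in_mackey N)).
    by apply: functional_extensionality_dep => T; apply: funext => -[].
  exact: lmackey_universal.
have uu : universal (D := in_pt gT) (fun T _ => lnu (tt : in_pt gT T)).
  have -> : (fun T _ => lnu (tt : in_pt gT T)) = @lnu gT (in_pt gT).
    by apply: functional_extensionality_dep => T; apply: funext => -[].
  exact: lmackey_universal.
constructor; exact: (box_exists bu uu (bU := burnside_pt) erefl).
Qed.

End BurnsideExists.

Section BurnsideUniversal.
Variables (gT : finGroupType) (A : mackey gT) (bA : burnside A).
Implicit Types (X Y Z S T : gset gT).

Definition gterm T : gmap T (gpt gT) := @GMap gT T (gpt gT) (fun _ => tt) (fun _ _ => erefl).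

Definition bunit T : A T := mres A (gterm T) (bcl bA (gid (gpt gT))).

Lemma bunitE T : bunit T = bcl bA (gid T).
Proof.
apply: (@bcl_res _ _ bA _ _ _ _ (gterm T)); apply: is_pb_pullback.
by apply: is_pbI => // -[] t _; exists t.
Qed.

Lemma bcl_bunit X Y (f : gmap Y X) : bcl bA f = mtr A f (bunit Y).
Proof. by rewrite bunitE bcl_tr gid_compr. Qed.

Lemma bcl_ind X (Z : zmodType) (f g : A X -> Z) :
  {morph f : s t / s + t} -> {morph g : s t / s + t} ->
  (forall Y (h : gmap Y X), f (bcl bA h) = g (bcl bA h)) -> forall a, f a = g a.
Proof.
move=> fD gD e a; have [||k [_ kU]] := @bcl_univ _ _ bA X Z (fun Y h => f (bcl bA h)).
- by move=> Y Y' h i; rewrite bcl_iso.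
- by move=> Y Y' h h'; rewrite bcl_sum fD.
have <- : k = f by apply: kU.
by have <- : k = g by apply: kU; split=> // Y h; rewrite e.
Qed.

(** Any functor with the Grothendieck property is presented by [in_pt], so the unit of a given box
    product can be used without knowing its construction. *)
Lemma burnside_universal : universal (D := in_pt gT) (fun T _ => bunit T).
Proof.
split.
  split=> [S T f d|S' S h d d' /= /gbij_iso[i <-]] /=; first by rewrite /bunit -mres_comp; congr mres; apply: gmap_eq.
  by rewrite -bcl_bunit -[iso_fun i]gid_compl bcl_iso bunitE.
move=> P mu [pr pt].
have ex X : exists f : A X -> P X, {morph f : s t / s + t} /\
    forall Y (h : gmap Y X), f (bcl bA h) = mtr P h (mu Y tt).
  have [||k [[kD kE] _]] := @bcl_univ _ _ bA X (P X) (fun Y h => mtr P h (mu Y tt)); last by exists k.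
  - by move=> Y Y' h i; rewrite mtr_comp -(pt _ _ (iso_fun i) tt) //; apply: giso_bij.
  - move=> Y Y' h h'; rewrite (mdecomp (mu (gsum Y Y') tt) (gsum_is_cop Y Y')) mtrD -!mtr_comp.
    rewrite -(pr _ _ (ginl Y Y') tt) -(pr _ _ (ginr Y Y') tt).
    have -> : gcomp (gcopair h h') (ginl Y Y') = h by apply: gmap_eq.
    by have -> : gcomp (gcopair h h') (ginr Y Y') = h' by apply: gmap_eq.
pose f X := sval (cid (ex X)).
have fD X : {morph f X : s t / s + t} by rewrite /f; case: cid => ? [].
have fE X Y (h : gmap Y X) : f X (bcl bA h) = mtr P h (mu Y tt) by rewrite /f; case: cid => ? [].
have fres X Y (g : gmap X Y) s : f X (mres A g s) = mres P g (f Y s).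
  apply: (@bcl_ind Y (P X) (fun s => f X (mres A g s)) (fun s => mres P g (f Y s))).
  - by move=> u v; rewrite mresD fD.
  - by move=> u v; rewrite fD mresD.
  - move=> Z h; have p := gpb_is_pb h g.
    by rewrite (bcl_res bA (is_pb_pullback p)) !fE (mbase _ p) -(pr _ _ (gpb1 h g) tt).
have ftr X Y (g : gmap X Y) s : f Y (mtr A g s) = mtr P g (f X s).
  apply: (@bcl_ind X (P Y) (fun s => f Y (mtr A g s)) (fun s => mtr P g (f X s))).
  - by move=> u v; rewrite mtrD fD.
  - by move=> u v; rewrite fD mtrD.
  - by move=> Z h; rewrite bcl_tr !fE mtr_comp.
exists (@MackeyHom gT A P f fD fres ftr); split=> [S []|g gE].
  by rewrite /= bunitE fE mtr_id.
apply: mackey_hom_eq => X s; apply: (@bcl_ind X (P X) (f X) (g X)).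
- exact: fD.
- exact: mh_add.
- by move=> Y h; rewrite fE bcl_bunit mh_tr (gE Y tt).
Qed.

End BurnsideUniversal.

(** * Elementary tensors in a given box product *)

Section BoxFormulas.
Variables (gT : finGroupType) (B : box_product gT).
Implicit Types (X Y Z S T : gset gT) (M N P : mackey gT).

Definition Bx M N : mackey gT := sm_tens (box_sm B) (M, N).
Definition Bt M N T (s : M T) (t : N T) : Bx M N T := int_pair (box_pair B M N) (prod_pair s t).
Definition BU : mackey gT := sm_unit (box_sm B).
Definition Bone T : BU T := bunit (box_burnside B) T.

Lemma Bu M N : universal (D := in_prod (in_mackey M) (in_mackey N)) (fun T d => Bt d.1 d.2).
Proof.
have -> : (fun T d => Bt d.1 d.2) = @int_pair gT M N (Bx M N) (box_pair B M N).
  by apply: functional_extensionality_dep => T; apply: funext => -[].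
by apply: is_box_universal; move=> P theta; apply: box_univ.
Qed.

Lemma Buu : universal (D := in_pt gT) (fun T _ => Bone T).
Proof. exact: burnside_universal. Qed.

Lemma Bt_pair M N T (s : M T) (t : N T) : Bt s t = mres _ (gdiag T) (box_pair B M N T T s t).
Proof. by []. Qed.

Definition Bmap M M' N N' (f : mackey_hom M M') (g : mackey_hom N N') :
  mackey_hom (Bx M N) (Bx M' N') := bifmap (sm_tens (box_sm B)) f g.

Lemma BmapE M M' N N' (f : mackey_hom M M') (g : mackey_hom N N') T s t :
  Bmap f g T (Bt s t) = Bt (f T s) (g T t).
Proof. by rewrite Bt_pair mh_res [Bmap _ _ _ _]box_map. Qed.

Definition Bassoc M N P : mackey_hom (Bx (Bx M N) P) (Bx M (Bx N P)) :=
  iso_fun (sm_assoc (box_sm B) M N P).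

Lemma BassocE M N P T (s : M T) (t : N T) (u : P T) : Bassoc M N P T (Bt (Bt s t) u) = Bt s (Bt t u).
Proof.
rewrite !Bt_pair pr_resl pr_resr !mh_res [Bassoc _ _ _ _ _]box_assoc -!mres_comp.
by congr mres; apply: gmap_eq.
Qed.

Definition Bbraid M N : mackey_hom (Bx M N) (Bx N M) := iso_fun (sm_braid (box_sm B) M N).

Lemma BbraidE M N T (s : M T) (t : N T) : Bbraid M N T (Bt s t) = Bt t s.
Proof.
rewrite Bt_pair mh_res [Bbraid _ _ _ _]box_braid -mres_comp Bt_pair.
by congr mres; apply: gmap_eq.
Qed.

Lemma BassocVE M N P T (s : M T) (t : N T) (u : P T) :
  (iso_inv (sm_assoc (box_sm B) M N P) : mackey_hom _ _) T (Bt s (Bt t u)) = Bt (Bt s t) u.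
Proof. by rewrite -BassocE; apply: (miso_cancel (sm_assoc (box_sm B) M N P)). Qed.

Lemma swap2E M N T (s t : M T) (u : N T) :
  (swap2 (box_sm B) M N : mackey_hom _ _) T (Bt s (Bt t u)) = Bt t (Bt s u).
Proof.
rewrite /swap2 /= BassocVE.
have := BmapE (Bbraid M M) (mackey_id N) (Bt s t) u; rewrite /Bmap /= => ->.
by rewrite BbraidE BassocE.
Qed.

(** ** Canonical powers *)

Fixpoint ptens M T n : ('I_n -> M T) -> (tpow (box_sm B) M n : mackey gT) T :=
  match n with
  | 0 => fun _ => Bone T
  | n'.+1 => fun f => Bt (f ord0) (@ptens M T n' (fun k => f (lift ord0 k)))
  end.

Lemma tpow_mapE M N (h : mackey_hom M N) T n (f : 'I_n -> M T) :
  (tpow_map (box_sm B) h n : mackey_hom _ _) T (ptens f) = ptens (fun k => h T (f k)).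
Proof.
elim: n f => [//|n IHn] f /=; have /= := BmapE h (tpow_map (box_sm B) h n : mackey_hom _ _).
by rewrite /Bmap => ->; rewrite IHn.
Qed.

Lemma ptens_eq M T n (f g : 'I_n -> M T) : (forall k, f k = g k) -> ptens f = ptens g.
Proof. by move=> /funext ->. Qed.

(** The head factor is inserted at position [i], and [lift i] enumerates the other positions in
    order. *)
Lemma tmoveE M T n (i : 'I_n.+1) (g : 'I_n.+1 -> M T) :
  (tmove (box_sm B) M i n : mackey_hom _ _) T (Bt (g i) (ptens (fun k => g (lift i k)))) = ptens g.
Proof.
elim: n i g => [|n IHn] i g.
  have -> : i = ord0 by case: i => -[|i] ?; apply: val_inj.
  by [].
case: i => -[|i] lti; first by rewrite (_ : Ordinal lti = ord0) //; apply: val_inj.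
set i' := Ordinal _; have ltin : (i < n.+1)%N by [].
have -> : ptens (fun k => g (lift i' k)) =
    Bt (g ord0) (ptens (fun k : 'I_n => g (lift ord0 (lift (Ordinal ltin) k)))).
  rewrite /=; congr (Bt (g _) _); first exact: val_inj.
  by apply: ptens_eq => k; congr (g _); apply: val_inj; rewrite /= /bump /=; lia.
have step x : (tmove (box_sm B) M i.+1 n.+1 : mackey_hom _ _) T x =
    Bmap (mackey_id M) (tmove (box_sm B) M i n : mackey_hom _ _) T
      ((swap2 (box_sm B) M (tpow (box_sm B) M n) : mackey_hom _ _) T x) by [].
rewrite [LHS]step swap2E BmapE; congr Bt.
have -> : g i' = g (lift ord0 (Ordinal ltin)) by congr g; apply: val_inj.
exact: (IHn (Ordinal ltin) (fun k => g (lift ord0 k))).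
Qed.

(** Recursion on the list of images: [tmove] puts the head at position [j], and [unbump j] renumbers
    the positions other than [j] for the tail. *)
Lemma tperm_mapE M T n (w : seq nat) (g g' : 'I_n -> M T) :
  size w = n -> uniq w -> {in w, forall k, k < n}%N ->
  (forall k j : 'I_n, nth 0%N w k = j -> g' j = g k) ->
  (tperm_map (box_sm B) M n w : mackey_hom _ _) T (ptens g) = ptens g'.
Proof.
elim: n w g g' => [|n IHn] [|j w] g g' //=; move=> [sw] /andP[jw uw] wn gg'.
have ltj : (j < n.+1)%N by apply: wn; rewrite mem_head.
have /= := BmapE (mackey_id M) (tperm_map (box_sm B) M n [seq unbump j k | k <- w] : mackey_hom _ _).
rewrite /Bmap => ->.
pose jo := Ordinal ltj.
have ubI : {in w &, injective (unbump j)}.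
  move=> a b aw bw e; have na : a != j by apply: contraNneq jw => <-.
  have nb : b != j by apply: contraNneq jw => <-.
  by rewrite -[a](@unbumpK j) ?inE // e unbumpK ?inE.
rewrite (IHn _ _ (fun k => g' (lift jo k))).
- have -> : g ord0 = g' jo by apply: esym; apply: (gg' ord0).
  exact: (tmoveE jo g').
- by rewrite size_map.
- by rewrite map_inj_in_uniq.
- move=> k' /mapP[k kw ->]; have := wn k; rewrite inE kw orbT => /(_ isT) ltk.
  have nk : k != j by apply: contraNneq jw => <-.
  by rewrite /unbump; move: (ltj) ltk nk; lia.
- move=> k l; rewrite (nth_map 0%N) ?sw // => el; apply: gg'.
  rewrite lift0 /= -el unbumpK // inE.
  by apply: contraNneq jw => <-; rewrite mem_nth ?sw.
Qed.

Lemma texp_mapE M T (X Y : finType) (f : X -> Y) (e : #|X| = #|Y|)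
    (g : 'I_#|X| -> M T) (g' : 'I_#|Y| -> M T) : injective f ->
  (forall x, g' (enum_rank (f x)) = g (enum_rank x)) ->
  (texp_map (box_sm B) f e M : mackey_hom _ _) T (ptens g) = ptens g'.
Proof.
move=> fI gg'; rewrite /texp_map; set w := [seq _ | _ <- _].
have sw : size w = #|X| by rewrite size_map -cardE.
have uw : uniq w.
  rewrite map_inj_uniq ?enum_uniq // => a b /val_inj /enum_rank_inj; exact: fI.
have wn : {in w, forall k, k < #|Y|}%N by move=> k /mapP[x _ ->]; apply: ltn_ord.
have gw : forall (k : 'I_#|X|) (j : 'I_#|Y|), nth 0%N w k = j -> g' j = g k.
  move=> k j; rewrite (nth_map (enum_val k)) -?cardE // => ej.
  have -> : j = enum_rank (f (enum_val k)).
    by apply: val_inj; rewrite -[LHS]ej; do 3 congr (_ _); rewrite [RHS]/enum_val; apply: set_nth_default; rewrite -cardE.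
  by rewrite gg' enum_valK.
(* Abstracting the cardinal lets the cast in [texp_map] reduce to the identity. *)
move: #|Y| e g' wn gw {gg'} => m e; subst m => /= g' wn gw.
exact: tperm_mapE.
Qed.

End BoxFormulas.

(** * The G-symmetric monoidal structure *)

Section Norms.
Variable gT : finGroupType.
Implicit Types (X Y Z S T E : gset gT) (M N P L : mackey gT).

(** By uniqueness of dependent products the transfer condition needs one choice for each [q], which
    may then be an iterated construction. *)
Lemma shift_pairingI X (D : input gT) P (mu : forall T, in_shift X D T -> P T) :
  (forall S T (f : gmap S T) (d : in_shift X D T), mu S (pres (in_shift X D) f d) = mres P f (mu T d)) ->
  (forall T A (q : gmap A (X ** T)) d a, irel D q d a ->
     exists E (h : gmap E T) (e : gmap (X ** E) A), is_dpr q h e /\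
       mu T d = mtr P h (mu E (pres D e a))) ->
  is_pairing mu.
Proof.
move=> mures H; split=> // E T h d d' [A [q [a [e [dp R ->]]]]].
have [E' [h' [e' [dp' ->]]]] := H _ _ _ _ _ R.
have [k [kb <- <-]] := dpr_uniq dp dp'.
by rewrite pres_comp (mures _ _ k) mtr_comp mtr_res_bij.
Qed.

(** Pairings are compared, not relations: it is enough that the two inputs impose the same
    conditions on them. *)
Lemma universal_transport (D D' : input gT) (L : mackey gT) (nu : forall S, D S -> L S)
    (al : forall S, D' S -> D S) (be : forall S, D S -> D' S) :
  (forall S, cancel (al S) (be S)) -> (forall S, cancel (be S) (al S)) ->
  (forall P (mu : forall S, D S -> P S), is_pairing mu -> is_pairing (fun S d => mu S (al S d))) ->
  (forall P (mu : forall S, D' S -> P S), is_pairing mu -> is_pairing (fun S d => mu S (be S d))) ->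
  universal nu -> universal (fun S d => nu S (al S d)).
Proof.
move=> alK beK Hal Hbe [nuP nuU]; split; first exact: Hal.
move=> P mu muP; have [f [fE fU]] := nuU P _ (Hbe _ _ muP).
exists f; split=> [S d|g gE]; first by rewrite fE alK.
by apply: fU => S d; rewrite -[in LHS](beK S d) gE.
Qed.

Lemma dpr_fst X X' T A E (i : gmap X X') (q : gmap A (X ** T)) (h : gmap E T)
    (e : gmap (X ** E) A) (j : gmap X' X) : cancel i j -> cancel j i ->
  is_dpr q h e -> is_dpr (gcomp (i ⊠ gid T) q) h (gcomp e (j ⊠ gid E)).
Proof.
move=> iK jK dp; apply: is_dprI => [x u|t s sP|u v e1 e2].
- by rewrite /= [q _](dprE dp) /= jK.
- have [|u [u1 u2]] := dpr_ex dp (s := fun x => s (i x)) (t := t).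
    move=> x; have := sP (i x); rewrite /=; case: (q _) => x' t' /= [/(can_inj iK) -> ->] //.
  by exists u; split=> // x; rewrite [LHS]u2 jK.
- apply: (dpr_eq dp) => // x; have := e2 (i x); rewrite /= iK //.
Qed.

Lemma mres_inv M X Y (f : gmap X Y) (g : gmap Y X) s : cancel f g -> cancel g f ->
  mres M f s = mtr M g s.
Proof.
move=> fK gK; rewrite -[in RHS](mtr_res_bij s (Bijective fK gK)) -mtr_comp.
by rewrite (_ : gcomp g f = gid X) ?mtr_id //; apply: gmap_eq.
Qed.

Section NormPairing.
Variables (M P : mackey gT) (X : gset gT).
Variable nn : forall T, M (X ** T) -> P T.
Hypothesis nnP : is_pairing (D := in_norm X M) (fun T d => nn d).

Lemma np_res S T (f : gmap S T) s : nn (mres M (gid X ⊠ f) s) = mres P f (nn s).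
Proof. exact: (pairing_res nnP). Qed.

Lemma np_tr T A E (q : gmap A (X ** T)) (h : gmap E T) (e : gmap (X ** E) A) a :
  is_dpr q h e -> nn (mtr M q a) = mtr P h (nn (mres M e a)).
Proof. by move=> dp; apply: (pairing_tr nnP); exists A, q, a, e. Qed.

Lemma np_iso X' N (i : gmap X X') (j : gmap X' X) (f : mackey_hom N M) :
  cancel i j -> cancel j i ->
  is_pairing (D := in_norm X' N)
    (fun T (d : N (X' ** T)) => nn (mres M (i ⊠ gid T) (f _ d))).
Proof.
move=> iK jK; apply: shift_pairingI => [S T g d|T A q d a /= ->].
  rewrite /= mh_res -np_res -!mres_comp; congr nn; congr mres; exact: gmap_eq.
have [E [h [e dp]]] := dpr_exists q; exists E, h, e; split=> //.
have iK' S : cancel (i ⊠ gid S) (j ⊠ gid S) by move=> [x t]; rewrite /= iK.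
have jK' S : cancel (j ⊠ gid S) (i ⊠ gid S) by move=> [x t]; rewrite /= jK.
rewrite mh_tr (mres_inv _ (iK' T) (jK' T)) -mtr_comp.
rewrite (np_tr _ (dpr_fst jK iK dp)) mh_res mres_comp //.
Qed.

End NormPairing.

Lemma norm_iso_universal M X X' L (nn : forall T, M (X ** T) -> L T)
   (i : gmap X X') (j : gmap X' X) : cancel i j -> cancel j i ->
  universal (D := in_norm X M) (fun T d => nn T d) ->
  universal (D := in_norm X' M) (fun T d => nn T (mres M (i ⊠ gid T) d)).
Proof.
move=> iK jK u.
refine (@universal_transport (in_norm X M) (in_norm X' M) L nn
  (fun T d => mres M (i ⊠ gid T) d) (fun T d => mres M (j ⊠ gid T) d) _ _ _ _ u).
- move=> T d; rewrite -mres_comp (_ : gcomp _ _ = gid _) ?mres_id //.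
  by apply: gmap_eq => -[x t]; rewrite /= jK.
- move=> T d; rewrite -mres_comp (_ : gcomp _ _ = gid _) ?mres_id //.
  by apply: gmap_eq => -[x t]; rewrite /= iK.
- by move=> P mu muP; apply: (np_iso muP (mackey_id M) iK jK).
- by move=> P mu muP; apply: (np_iso muP (mackey_id M) jK iK).
Qed.

(** ** Norms along disjoint unions *)

Section NormSum.
Variables (M : mackey gT) (X Y Z : gset gT) (i : gmap X Z) (j : gmap Y Z).
Hypothesis cop : is_cop i j.

Definition ncut T (d : in_norm Z M T) :
    in_prod (in_norm X M) (in_norm Y M) T :=
  (mres M (i ⊠ gid T) d, mres M (j ⊠ gid T) d).

Definition nglue T (d : in_prod (in_norm X M) (in_norm Y M) T) :
    in_norm Z M T :=
  sval (cid (madd_ex (d.1 : M _) (d.2 : M _) (cop_prodr T cop))).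

Lemma nglueK T d : ncut (@nglue T d) = d.
Proof. by rewrite /ncut /nglue; case: cid => s /= [-> ->]; case: d. Qed.

Lemma ncutK T d : nglue (@ncut T d) = d.
Proof.
have := nglueK (ncut d); move: (nglue _) => d'; rewrite /ncut => -[e1 e2].
exact: (madd_inj (cop_prodr T cop)).
Qed.

(** A section over [Z] is a section over [X] and a section over [Y]. Relations of the product input
    change one coordinate at a time, so the dependent product is built in two stages, the second
    over the base [E1] of the first. *)
Lemma ncut_pairing P (mu : forall S, in_prod (in_norm X M) (in_norm Y M) S -> P S) :
  is_pairing mu -> is_pairing (fun S d => mu S (ncut d)).
Proof.
case=> mr mt; apply: shift_pairingI => [S T f d|T A q d a /= ->].
  rewrite -mr /ncut /= -!mres_comp.
  by congr (mu _ (_, _)); congr mres; apply: gmap_eq.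
have p1 := gpb_is_pb q (i ⊠ gid T); have p2 := gpb_is_pb q (j ⊠ gid T).
set q1 := gpb2 q (i ⊠ gid T) in p1 *; set q2 := gpb2 q (j ⊠ gid T) in p2 *.
set c1 := gpb1 q (i ⊠ gid T) in p1 *; set c2 := gpb1 q (j ⊠ gid T) in p2 *.
have [E1 [h1 [e1 dp1]]] := dpr_exists q1.
have p2' := gpb_is_pb q2 (gid Y ⊠ h1).
set q2' := gpb2 q2 (gid Y ⊠ h1) in p2' *; set c2' := gpb1 q2 (gid Y ⊠ h1) in p2' *.
have [E2 [h2 [e2 dp2]]] := dpr_exists q2'.
have [e [ei ej]] := cop_map (gcomp c1 (gcomp e1 (gid X ⊠ h2))) (gcomp c2 (gcomp c2' e2))
  (cop_prodr E2 cop).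
have {}ei x u : e (gpair (i x) u) = c1 (e1 (gpair x (h2 u))) by apply: (ei (gpair x u)).
have {}ej y u : e (gpair (j y) u) = c2 (c2' (e2 (gpair y u))) by apply: (ej (gpair y u)).
have [p1c _] := p1; have [p2c _] := p2; have [p2c' _] := p2'.
have [I J dis cov] := cop.
exists E2, (gcomp h1 h2), e; split.
  apply: is_dprI => [z u|t s sP|u v eh ee].
  - case: (cov z) => -[x <-].
    + by rewrite ei p1c [q1 _](dprE dp1).
    + by rewrite ej p2c p2c' [q2' _](dprE dp2).
  - have ex1 x : exists w, c1 w = s (i x) /\ q1 w = gpair x t by apply: (pb_ex p1); rewrite sP.
    have [u1 [hu1 eu1]] := dpr_ex dp1 (s := fun x => sval (cid (ex1 x))) (t := t)
      (fun x => proj2 (svalP (cid (ex1 x)))).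
    have ex2 y : exists w, c2 (c2' w) = s (j y) /\ q2' w = gpair y u1.
      have [|w [w1 w2]] := @pb_ex _ _ _ _ _ _ _ _ _ (s (j y)) (gpair y t) p2; first by rewrite sP.
      have [|w' [w1' w2']] := @pb_ex _ _ _ _ _ _ _ _ _ w (gpair y u1) p2'; first by rewrite w2 /= hu1.
      by exists w'; rewrite w1' w1.
    have [u2 [hu2 eu2]] := dpr_ex dp2 (s := fun x => sval (cid (ex2 x))) (t := u1)
      (fun x => proj2 (svalP (cid (ex2 x)))).
    exists u2; split=> [|z]; first by rewrite /= hu2 hu1.
    case: (cov z) => -[x <-].
    + by rewrite ei hu2 eu1; case: cid => w /= [].
    + by rewrite ej eu2; case: cid => w /= [].
  - have eh2 : h2 u = h2 v.
      apply: (dpr_eq dp1) => // x; apply: (pb_eq p1); first by rewrite -!ei.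
      by rewrite !(dprE dp1); congr gpair.
    apply: (dpr_eq dp2) => // y; apply: (pb_eq p2'); last by rewrite !(dprE dp2) eh2.
    apply: (pb_eq p2); first by rewrite -!ej.
    by rewrite !p2c' !(dprE dp2) eh2.
rewrite /ncut (mbase _ p1) (mbase _ p2) -/q1 -/q2 -/c1 -/c2.
rewrite (mt _ _ h1 _ (mres M e1 (mres M c1 a), mres M (gid Y ⊠ h1) (mtr M q2 (mres M c2 a)))); last first.
  by left; split=> //; exists (gpb q (i ⊠ gid T)), q1, (mres M c1 a), e1.
rewrite (mbase _ p2') -/q2' -/c2'.
rewrite (mt _ _ h2 _ (mres M (gid X ⊠ h2) (mres M e1 (mres M c1 a)), mres M e2 (mres M c2' (mres M c2 a)))); last first.
  by right; split=> //; exists (gpb q2 (gid Y ⊠ h1)), q2', (mres M c2' (mres M c2 a)), e2.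
rewrite -mtr_comp -!mres_comp; congr (mtr P _ (mu _ (_, _))); congr mres.
- by apply: gmap_eq => -[x u]; rewrite /= [e _]ei.
- by apply: gmap_eq => -[x u]; rewrite /= [e _]ej.
Qed.

End NormSum.

(** A relation in one coordinate becomes a relation over [Z] when the identity is added over the
    other piece, where sections are forced. *)
Lemma nglue_pairing M X Y Z (i : gmap X Z) (j : gmap Y Z) (cop : is_cop i j) P
    (mu : forall S, in_norm Z M S -> P S) :
  is_pairing mu -> is_pairing (fun S d => mu S (nglue cop d)).
Proof.
have glueE X' Y' (i' : gmap X' Z) (j' : gmap Y' Z) (cop' : is_cop i' j') T m
    (d : in_prod (in_norm X' M) (in_norm Y' M) T) :
    mres M (i' ⊠ gid T) m = d.1 -> mres M (j' ⊠ gid T) m = d.2 -> nglue cop' d = m.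
  by move=> e1 e2; rewrite -(ncutK cop' m) /ncut e1 e2; case: d {e1 e2}.
have key X' Y' (i' : gmap X' Z) (j' : gmap Y' Z) (cop' : is_cop i' j') T E A
  (q : gmap A (X' ** T)) (h : gmap E T) (e : gmap (X' ** E) A) (a : M A) (m2 : M (Y' ** T)) :
  is_pairing mu -> is_dpr q h e ->
  mu T (nglue cop' (mtr M q a, m2)) = mtr P h (mu E (nglue cop' (mres M e a, mres M (gid Y' ⊠ h) m2))).
  move=> muP dp; have [I J dis cov] := cop'.
  pose A' := gsum (Y' ** T) A.
  pose q' : gmap A' (Z ** T) := gcopair (j' ⊠ gid T) (gcomp (i' ⊠ gid T) q).
  have [a' [a1 a2]] := madd_ex m2 a (gsum_is_cop (Y' ** T) A).
  have copC : is_cop (j' ⊠ gid T) (i' ⊠ gid T).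
    have [I1 J1 dis1 cov1] := cop_prodr T cop'; split=> // [u v /esym/dis1 //|v].
    by case: (cov1 v); [right|left].
  (* By [irel_cop] for [in_mackey M], a transfer over one piece glued to an unchanged element over
     the other is a transfer along [q']. *)
  have em : nglue cop' (mtr M q a, m2) = mtr M q' a'.
    apply: (@irel_cop _ (in_mackey M) _ _ _ _ _ _ _ q (ginl (Y' ** T) A) (ginr (Y' ** T) A) q' _ _ copC (gsum_is_cop _ _)).
    - exact: gmap_eq.
    - exact: gmap_eq.
    - by rewrite /= a1; have := nglueK cop' (mtr M q a, m2); rewrite /ncut => -[_ ->].
    - by rewrite /= a2; have := nglueK cop' (mtr M q a, m2); rewrite /ncut => -[-> _].
  have [e' [ei ej]] := cop_map (gcomp (ginr (Y' ** T) A) e) (gcomp (ginl (Y' ** T) A) (gid Y' ⊠ h))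
    (cop_prodr E cop').
  have {}ei x u : e' (gpair (i' x) u) = inr (e (gpair x u)) by apply: (ei (gpair x u)).
  have {}ej y u : e' (gpair (j' y) u) = inl (gpair y (h u)) by apply: (ej (gpair y u)).
  have dp' : is_dpr q' h e'.
    apply: is_dprI => [z u|t s sP|u v eh ee].
    - case: (cov z) => -[x <-]; first by rewrite ei /= [q _](dprE dp).
      by rewrite ej.
    - have ex x : exists w, s (i' x) = inr w /\ q w = gpair x t.
        have := sP (i' x); case: (s (i' x)) => [[y t']|w] /=.
          by move=> /(congr1 fst) /= /esym /dis.
        move=> ew; exists w; split=> //; rewrite [LHS]gpairP.
        by have /= /I -> := congr1 fst ew; have /= -> := congr1 snd ew.
      have [u [u1 u2]] := dpr_ex dp (s := fun x => sval (cid (ex x))) (t := t)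
        (fun x => proj2 (svalP (cid (ex x)))).
      exists u; split=> // z; case: (cov z) => -[x <-].
        by rewrite ei u2; case: cid => w /= [->].
      rewrite ej u1; have := sP (j' x); case: (s (j' x)) => [[y t']|w] /=.
        by case=> /J -> ->.
      by move=> /(congr1 fst) /= /dis.
    - apply: (dpr_eq dp) => // x; have := ee (i' x); rewrite !ei => -[] //.
  rewrite em (pairing_tr muP (h := h) (d' := mres M e' a')); last by exists A', q', a', e'.
  congr mtr; congr (mu _ _); apply: esym; apply: glueE; rewrite /= -mres_comp.
  - by rewrite -a2 -mres_comp; congr mres; apply: gmap_eq => -[x u]; rewrite /= [e' _]ei.
  - by rewrite -a1 -mres_comp; congr mres; apply: gmap_eq => -[x u]; rewrite /= [e' _]ej.
move=> muP; split=> [S T f d|S' S h [m1 m2] [m1' m2'] /=].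
  rewrite -(pairing_res muP); congr (mu _ _); apply: glueE.
  - have := nglueK cop d; rewrite /ncut; case: d => d1 d2 [e1 e2] /=.
    by rewrite -{2}e1 -!mres_comp; congr mres; apply: gmap_eq.
  - have := nglueK cop d; rewrite /ncut; case: d => d1 d2 [e1 e2] /=.
    by rewrite -{2}e2 -!mres_comp; congr mres; apply: gmap_eq.
case=> -[].
- by move=> [A [q [a [e [dp -> ->]]]]] ->; apply: key.
- move=> -> [A [q [a [e [dp -> ->]]]]].
  have copC : is_cop j i.
    have [I1 J1 dis1 cov1] := cop; split=> // [u v /esym/dis1 //|v].
    by case: (cov1 v); [right|left].
  have glueC T d1 d2 : nglue cop (d1, d2) = nglue copC (d2, d1) :> in_norm Z M T.
    by apply: glueE; have := nglueK copC (d2, d1); rewrite /ncut => -[].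
  by rewrite glueC (key _ _ _ _ copC _ _ _ _ _ _ _ _ muP dp) -glueC.
Qed.

(** ** Norms along products *)

(** The swap of [X] and [Y] reflects the nesting: the norm along [Y] followed by the norm along [X]
    has its generators over [Y × (X × T)]. *)
Definition greassoc X Y T : gmap ((X ** Y) ** T) (Y ** (X ** T)) :=
  @GMap gT ((X ** Y) ** T) (Y ** (X ** T)) (fun u => gpair u.1.2 (gpair u.1.1 u.2)) (fun _ _ => erefl).
Definition greassocV X Y T : gmap (Y ** (X ** T)) ((X ** Y) ** T) :=
  @GMap gT (Y ** (X ** T)) ((X ** Y) ** T) (fun u => gpair (gpair u.2.1 u.1) u.2.2) (fun _ _ => erefl).

Lemma greassocK X Y T : cancel (greassoc X Y T) (greassocV X Y T).
Proof. by case=> -[]. Qed.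
Lemma greassocVK X Y T : cancel (greassocV X Y T) (greassoc X Y T).
Proof. by case=> y []. Qed.

(** A section over [X × Y] is a section over [X] of the object of sections over [Y]. *)
Lemma dpr_prod X Y T B A E (p : gmap B (Y ** (X ** T))) (q : gmap A (X ** T))
   (e1 : gmap (Y ** A) B) (h : gmap E T) (e : gmap (X ** E) A) :
  is_dpr p q e1 -> is_dpr q h e ->
  is_dpr (gcomp (greassocV X Y T) p) h (gcomp e1 (gcomp (gid Y ⊠ e) (greassoc X Y E))).
Proof.
move=> dp1 dp; apply: is_dprI => [[x y] u|t s sP|u v eh ee].
- by rewrite /= [p _](dprE dp1) /= [q _](dprE dp).
- have sp x y : p (s (gpair x y)) = gpair y (gpair x t).
    by rewrite -[LHS]greassocVK -[greassocV _ _ _ _]/(gcomp _ _ _) sP.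
  have ex x : exists w, q w = gpair x t /\ forall y, e1 (gpair y w) = s (gpair x y).
    exact: (dpr_ex dp1 (s := fun y => s (gpair x y)) (t := gpair x t) (sp x)).
  have [u [u1 u2]] := dpr_ex dp (s := fun x => sval (cid (ex x))) (t := t)
      (fun x => proj1 (svalP (cid (ex x)))).
  exists u; split=> // -[x y] /=; rewrite [e _]u2.
  by case: cid => w /= [_ ->].
- apply: (dpr_eq dp) => // x; apply: (dpr_eq dp1) => [|y]; first by rewrite !(dprE dp) [h u]eh.
  exact: (ee (gpair x y)).
Qed.

Lemma norm_prod_universal M X Y L (nn : forall T, M ((X ** Y) ** T) -> L T) :
  universal (D := in_norm (X ** Y) M) (fun T d => nn T d) ->
  universal (D := in_shift X (in_norm Y M))
    (fun T d => nn T (mres M (greassoc X Y T) d)).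
Proof.
move=> u; have rbij T := Bijective (@greassocK X Y T) (@greassocVK X Y T).
have rK T d : mres M (greassocV X Y T) (mres M (greassoc X Y T) d) = d.
  rewrite -mres_comp (_ : gcomp _ _ = gid _) ?mres_id //; apply: gmap_eq; exact: greassocVK.
have rVK T d : mres M (greassoc X Y T) (mres M (greassocV X Y T) d) = d.
  rewrite -mres_comp (_ : gcomp _ _ = gid _) ?mres_id //; apply: gmap_eq; exact: greassocK.
have rtr T B (p : gmap B (Y ** (X ** T))) b :
   mres M (greassoc X Y T) (mtr M p b) = mtr M (gcomp (greassocV X Y T) p) b.
  by rewrite (mres_inv _ (@greassocK X Y T) (@greassocVK X Y T)) mtr_comp.
refine (@universal_transport (in_norm (X ** Y) M)
  (in_shift X (in_norm Y M)) L nn (fun T d => mres M (greassoc X Y T) d)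
  (fun T d => mres M (greassocV X Y T) d) _ _ _ _ u) => //.
- move=> P mu muP; apply: shift_pairingI => [S T f d|T A q d a].
    rewrite -(pairing_res muP) /= -!mres_comp; congr (mu _ _); congr mres; exact: gmap_eq.
  move=> [B [p [b [e1 [dp1 /= -> ->]]]]].
  have [E [h [e dp]]] := dpr_exists q; exists E, h, e; split=> //.
  rewrite rtr -!mres_comp; apply: (pairing_tr muP).
  by exists B, (gcomp (greassocV X Y T) p), b, (gcomp e1 (gcomp (gid Y ⊠ e) (greassoc X Y E)));
    split=> //; exact: dpr_prod dp1 dp.
- move=> P mu muP; apply: shift_pairingI => [S T f d|T B p d b /= ->].
    rewrite -(pairing_res muP) /= -!mres_comp; congr (mu _ _); congr mres; exact: gmap_eq.
  pose p' := gcomp (greassoc X Y T) p.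
  have [A [q [e1 dp1]]] := dpr_exists p'; have [E [h [e dp]]] := dpr_exists q.
  exists E, h, (gcomp e1 (gcomp (gid Y ⊠ e) (greassoc X Y E))); split.
    have := dpr_prod dp1 dp; rewrite (_ : gcomp _ p' = p) //; apply: gmap_eq => w.
    exact: greassocK.
  have ep : mres M (greassocV X Y T) (mtr M p b) = mtr M p' b.
    by rewrite (mres_inv _ (@greassocVK X Y T) (@greassocK X Y T)) mtr_comp.
  rewrite ep -mres_comp; apply: (pairing_tr muP).
  exists A, q, (mres M e1 b), e; split=> //=; first by exists B, p', b, e1.
  by rewrite -!mres_comp; congr mres; apply: gmap_eq => -[y [x w]].
Qed.

End Norms.

Local Open Scope cat_scope.

(** * The structure isomorphisms and their values on generators *)

Section GSym.
Variables (gT : finGroupType) (B : box_product gT).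
Implicit Types (X Y Z S T E : gset gT) (M N P L : mackey gT).

Definition nx X M : mackey gT := lmackey (in_norm X M).
Definition nn X M T (d : M (X ** T)) : nx X M T := lnu (d : in_norm X M T).

Lemma nnU X M : universal (D := in_norm X M) (fun T d => nn (d : M (X ** T))).
Proof. exact: lmackey_universal. Qed.

Definition nnP X M := proj1 (nnU X M).

Lemma nn_res X M S T (f : gmap S T) (d : M (X ** T)) :
  mres _ f (nn d) = nn (mres M (gid X ⊠ f) d).
Proof. by rewrite (np_res (@nnP X M)). Qed.

Lemma nn_tr X M T A E (q : gmap A (X ** T)) (h : gmap E T) (e : gmap (X ** E) A) (a : M A) :
  is_dpr q h e -> nn (mtr M q a) = mtr _ h (nn (mres M e a)).
Proof. exact: (np_tr (@nnP X M)). Qed.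

Lemma nn_ext X M P (f g : mackey_hom (nx X M) P) :
  (forall T (d : M (X ** T)), f T (nn d) = g T (nn d)) -> f = g.
Proof. exact: (universal_ext (nnU X M)). Qed.

(** The functor is covariant in [X] whereas generators restrict contravariantly, hence the inverse
    isomorphism. *)
Lemma nmap_ex X X' M M' (i : @iso (GSet gT) X X') (f : mackey_hom M M') :
  exists h : mackey_hom (nx X M) (nx X' M'), forall T (d : M (X ** T)),
    h T (nn d) = nn (mres M' ((iso_inv i : gmap X' X) ⊠ gid T) (f _ d)).
Proof.
have np := np_iso (@nnP X' M') f (giso_cancel (iso_sym i)) (giso_cancel i).
by have [h [hE _]] := (proj2 (nnU X M)) _ _ np; exists h => T d; apply: hE.
Qed.

Definition nmap X X' M M' (i : @iso (GSet gT) X X') (f : mackey_hom M M') := sval (cid (nmap_ex i f)).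
Lemma nmapE X X' M M' (i : @iso (GSet gT) X X') (f : mackey_hom M M') T (d : M (X ** T)) :
  nmap i f T (nn d) = nn (mres M' ((iso_inv i : gmap X' X) ⊠ gid T) (f _ d)).
Proof. exact: (svalP (cid (nmap_ex i f))). Qed.

Definition nfunctor : functor (prodcat (core (GSet gT)) (Mack gT)) (Mack gT).
Proof.
apply: (@Functor (prodcat (core (GSet gT)) (Mack gT)) (Mack gT) (fun u => nx u.1 u.2)
  (fun u v f => nmap (f.1 : @iso (GSet gT) u.1 v.1) (f.2 : mackey_hom u.2 v.2))).
- move=> [X M] /=; apply: nn_ext => T d; rewrite nmapE /= gprod_map_id mres_id //.
- move=> [X M] [X' M'] [X'' M''] [i f] [i' f'] /=; apply: nn_ext => T d.
  by rewrite /= !nmapE /= mh_res -mres_comp; congr nn; congr mres; apply: gmap_eq.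
Defined.

Lemma sum_universal M X Y Z L L' (i : gmap X Z) (j : gmap Y Z)
    (n1 : forall T, M (X ** T) -> L T) (n2 : forall T, M (Y ** T) -> L' T) : is_cop i j ->
  universal (D := in_norm X M) (fun T d => n1 T d) ->
  universal (D := in_norm Y M) (fun T d => n2 T d) ->
  universal (D := in_norm Z M) (fun T d =>
     Bt B (n1 T (mres M (i ⊠ gid T) d)) (n2 T (mres M (j ⊠ gid T) d))).
Proof.
move=> cop u1 u2.
exact: (universal_transport (ncutK cop) (nglueK cop) (ncut_pairing cop) (nglue_pairing cop)
   (bu2 (Bu B) u1 u2)).
Qed.

Lemma nsum_ex X Y M : exists i : @iso (Mack gT) (nx (gsum X Y) M) (Bx B (nx X M) (nx Y M)),
  forall T (d : M (gsum X Y ** T)), (iso_fun i : mackey_hom _ _) T (nn d) =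
   Bt B (nn (mres M (ginl X Y ⊠ gid T) d)) (nn (mres M (ginr X Y ⊠ gid T) d)).
Proof.
have [i [iE _]] := universal_iso (nnU (gsum X Y) M)
  (sum_universal (gsum_is_cop X Y) (nnU X M) (nnU Y M)).
by exists i => T d; apply: iE.
Qed.

Definition nsum X Y M := sval (cid (nsum_ex X Y M)).
Lemma nsumE X Y M T (d : M (gsum X Y ** T)) : (iso_fun (nsum X Y M) : mackey_hom _ _) T (nn d) =
   Bt B (nn (mres M (ginl X Y ⊠ gid T) d)) (nn (mres M (ginr X Y ⊠ gid T) d)).
Proof. exact: (svalP (cid (nsum_ex X Y M))). Qed.

(** The composite of [q] with the evaluation is [gid X ⊠ h]; hence restricting the unchanged factor
    to [A] and then evaluating is restricting it along [gid X ⊠ h], and the two kinds of relations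
    coincide. *)
Lemma shift_prod_swap X M N P (mu : forall T, M (X ** T) -> N (X ** T) -> P T) :
  is_pairing (D := in_shift X (in_prod (in_mackey M) (in_mackey N))) (fun T d => mu T d.1 d.2) <->
  is_pairing (D := in_prod (in_norm X M) (in_norm X N))
    (fun T d => mu T d.1 d.2).
Proof.
have dprM A S S' (q : gmap A (X ** S)) (h : gmap S' S) (e : gmap (X ** S') A) (K : mackey gT) d :
    is_dpr q h e -> mres K e (mres K q d) = mres K (gid X ⊠ h) d.
  move=> dp; rewrite -mres_comp; congr mres; apply: gmap_eq => -[x u]; exact: (dprE dp).
split=> -[mr mt]; split=> //.
- move=> S' S h [d1 d2] [d1' d2'] /= [[[A [q [a [e [dp -> ->]]]]] ->]|[-> [A [q [a [e [dp -> ->]]]]]]].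
  + apply: (mt _ _ h (mtr M q a, d2) (mres M e a, mres N (gid X ⊠ h) d2)).
    exists A, q, (a, mres N q d2), e; split=> //=; first by left.
    by rewrite (dprM _ _ _ _ _ _ _ _ dp).
  + apply: (mt _ _ h (d1, mtr N q a) (mres M (gid X ⊠ h) d1, mres N e a)).
    exists A, q, (mres M q d1, a), e; split=> //=; first by right.
    by rewrite (dprM _ _ _ _ _ _ _ _ dp).
- move=> S' S h [d1 d2] [d1' d2'] [A [q [[a1 a2] [e [dp R [-> ->]]]]]].
  case: R => /= -[H1 H2].
  + rewrite H1 H2 (dprM _ _ _ _ _ _ _ _ dp).
    apply: (mt _ _ h (mtr M q a1, d2) (mres M e a1, mres N (gid X ⊠ h) d2)).
    by left; split=> //; exists A, q, a1, e.
  + rewrite H1 H2 (dprM _ _ _ _ _ _ _ _ dp).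
    apply: (mt _ _ h (d1, mtr N q a2) (mres M (gid X ⊠ h) d1, mres N e a2)).
    by right; split=> //; exists A, q, a2, e.
Qed.

Lemma nbox_ex X M N : exists i : @iso (Mack gT) (nx X (Bx B M N)) (Bx B (nx X M) (nx X N)),
  forall T (d : M (X ** T)) (d' : N (X ** T)),
    (iso_fun i : mackey_hom _ _) T (nn (Bt B d d')) = Bt B (nn d) (nn d').
Proof.
have u1 := shift_universal (Bu B M N) (nnU X (Bx B M N)).
have u2 := bu2 (Bu B) (nnU X M) (nnU X N).
have u2' : universal (D := in_shift X (in_prod (in_mackey M) (in_mackey N)))
    (fun T d => Bt B (nn d.1) (nn d.2)).
  pose D1 := in_prod (in_norm X M) (in_norm X N).
  pose D2 := in_shift X (in_prod (in_mackey M) (in_mackey N)).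
  refine (@universal_transport _ D1 D2 _ (fun T d => Bt B (nn d.1) (nn d.2))
    (fun T (d : D2 T) => d) (fun T (d : D1 T) => d) _ _ _ _ u2) => //.
  - move=> P mu muP.
    have e1 : (fun T (d : D1 T) => mu T (d.1, d.2)) = mu.
      by apply: functional_extensionality_dep => T; apply: funext => -[].
    have e2 : (fun T (d : D2 T) => mu T (d.1, d.2)) = mu.
      by apply: functional_extensionality_dep => T; apply: funext => -[].
    rewrite -e1 in muP; rewrite -e2; exact: (proj2 (shift_prod_swap (fun T d1 d2 => mu T (d1, d2)))) muP.
  - move=> P mu muP.
    have e1 : (fun T (d : D1 T) => mu T (d.1, d.2)) = mu.
      by apply: functional_extensionality_dep => T; apply: funext => -[].
    have e2 : (fun T (d : D2 T) => mu T (d.1, d.2)) = mu.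
      by apply: functional_extensionality_dep => T; apply: funext => -[].
    rewrite -e2 in muP; rewrite -e1; exact: (proj1 (shift_prod_swap (fun T d1 d2 => mu T (d1, d2)))) muP.
have [i [iE _]] := universal_iso u1 u2'.
by exists i => T d d'; apply: (iE T (d, d')).
Qed.

Definition nbox X M N := sval (cid (nbox_ex X M N)).
Lemma nboxE X M N T (d : M (X ** T)) (d' : N (X ** T)) :
    (iso_fun (nbox X M N) : mackey_hom _ _) T (nn (Bt B d d')) = Bt B (nn d) (nn d').
Proof. exact: (svalP (cid (nbox_ex X M N))). Qed.

Lemma nbox_ext X M N P (f g : mackey_hom (nx X (Bx B M N)) P) :
  (forall T (d : M (X ** T)) (d' : N (X ** T)), f T (nn (Bt B d d')) = g T (nn (Bt B d d'))) -> f = g.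
Proof.
move=> e; apply: (universal_ext (shift_universal (Bu B M N) (nnU X (Bx B M N)))) => T [d d'].
exact: e.
Qed.

Lemma nprod_ex X Y M : exists i : @iso (Mack gT) (nx X (nx Y M)) (nx (X ** Y) M),
  forall T (d : M (Y ** (X ** T))),
    (iso_fun i : mackey_hom _ _) T (nn (nn d)) = nn (mres M (greassoc X Y T) d).
Proof.
have [i [iE _]] := universal_iso (shift_universal (nnU Y M) (nnU X (nx Y M)))
  (norm_prod_universal (nnU (X ** Y) M)).
by exists i => T d; apply: iE.
Qed.

Definition nprod X Y M := sval (cid (nprod_ex X Y M)).
Lemma nprodE X Y M T (d : M (Y ** (X ** T))) :
    (iso_fun (nprod X Y M) : mackey_hom _ _) T (nn (nn d)) = nn (mres M (greassoc X Y T) d).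
Proof. exact: (svalP (cid (nprod_ex X Y M))). Qed.

Lemma nprod_ext X Y M P (f g : mackey_hom (nx X (nx Y M)) P) :
  (forall T (d : M (Y ** (X ** T))), f T (nn (nn d)) = g T (nn (nn d))) -> f = g.
Proof. move=> e; exact: (universal_ext (shift_universal (nnU Y M) (nnU X (nx Y M)))). Qed.

(** ** Trivial G-sets *)

Definition gat (X : finType) T (x : X) : gmap T (gtriv gT X ** T) :=
  @GMap gT T (gtriv gT X ** T) (fun t => gpair (x : gtriv gT X) t) (fun _ _ => erefl).

Definition gtriv_map (X Y : finType) (f : X -> Y) : gmap (gtriv gT X) (gtriv gT Y) :=
  @GMap gT (gtriv gT X) (gtriv gT Y) f (fun _ _ => erefl).

(** A section over one point is an element, so the dependent product of [q] is [q] itself and the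
    norm relations become those of [in_mackey M]. *)
Lemma pt_universal M :
  universal (D := in_norm (gpt gT) M) (fun T d => mres M (gat T tt) d).
Proof.
have K T : cancel (gat T tt) (gsnd (gpt gT) T) by [].
have K' T : cancel (gsnd (gpt gT) T) (gat T tt) by case=> -[].
refine (@universal_transport _ (in_mackey M) (in_norm (gpt gT) M) M (fun T d => d)
  (fun T d => mres M (gat T tt) d) (fun T d => mres M (gsnd (gpt gT) T) d) _ _ _ _ (universal_self M)).
- move=> T d; rewrite -mres_comp (_ : gcomp _ _ = gid _) ?mres_id //; by apply: gmap_eq => u; apply: K'.
- move=> T d; rewrite -mres_comp (_ : gcomp _ _ = gid _) ?mres_id //; exact: gmap_eq.
- move=> P mu muP; apply: shift_pairingI => [S T f d|T A q d a /= ->].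
    by rewrite -(pairing_res muP) /= -!mres_comp; congr (mu _ _); congr mres; apply: gmap_eq.
  exists A, (gcomp (gsnd (gpt gT) T) q), (gsnd (gpt gT) A); split.
    apply: is_dprI => [[] u|t s sP|u v _ /(_ tt)] //=.
      by rewrite [LHS]gpairP; case: (q u) => -[].
    by exists (s tt); split=> [|[]] //=; rewrite sP.
  rewrite (mres_inv _ (K T) (@K' T)) -mtr_comp (pairing_tr muP (h := gcomp (gsnd (gpt gT) T) q) (d' := a)) //.
  congr (mtr P _ (mu _ _)); rewrite /= -mres_comp (_ : gcomp _ _ = gid _) ?mres_id //; exact: gmap_eq.
- move=> P mu muP; split=> [S T f d|S' S h d d' /= ->].
    by rewrite -(pairing_res muP) /= -!mres_comp; congr (mu _ _); congr mres; apply: gmap_eq.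
  apply: (pairing_tr muP); exists S', (gcomp (gat S tt) h), d', (gsnd (gpt gT) S'); split=> //=.
    apply: is_dprI => [[] u|t s sP|u v _ /(_ tt)] //=.
    by exists (s tt); split=> [|[]] //; have := sP tt => /(congr1 snd).
  by rewrite (mres_inv _ (@K' S) (K S)) mtr_comp.
Qed.

(** Over the empty set each point carries exactly one section, so relations hold along bijections
    only, as in [in_pt]. *)
Lemma void_universal M (X : finType) : (X -> False) ->
  universal (D := in_norm (gtriv gT X) M) (fun T d => Bone B T).
Proof.
move=> X0; have X0' T : gtriv gT X ** T -> False by case=> x _; apply: X0.
refine (@universal_transport _ (in_pt gT) (in_norm (gtriv gT X) M) _ (fun T _ => Bone B T)
  (fun T _ => tt) (fun T _ => (0 : M (gtriv gT X ** T))) _ _ _ _ (Buu B)).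
- by move=> T d; apply: mvoid_eq => u; apply: X0' u.
- by move=> T [].
- move=> P mu muP; split=> [S T f d|E T h d d' [A [q [a [e [dp _ _]]]]]].
    exact: (pairing_res muP f tt).
  apply: (pairing_tr muP) => /=.
  have [||g [gK Kg]] := @gbij_inv _ _ _ h; last by exists g.
    by move=> u v euv; apply: (dpr_eq dp) => // x; case: (X0 x).
  move=> t; have [|u [ut _]] := dpr_ex dp (t := t) (s := fun x => match X0 x return A with end).
    by move=> x; case: (X0 x).
  by exists u.
- move=> P mu muP; split=> [S T f d|S' S h d d' hb].
    by rewrite -(pairing_res muP) /= mres0.
  apply: (pairing_tr muP).
  have [A [q [a [e R]]]] := irel_iso (i := in_norm (gtriv gT X) M) (0 : M (_ ** S)) hb.
  by exists A, q, a, e; move: R; rewrite /= mres0.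
Qed.

(** The decomposition of ['I_n.+1] into [ord0] and the image of [lift ord0] matches the recursion of
    [tpow]. *)
Lemma ord_universal M n : universal (D := in_norm (gtriv gT 'I_n) M)
  (fun T d => ptens B (fun k : 'I_n => mres M (gat T k) d)).
Proof.
elim: n => [|n IHn]; first by apply: void_universal; case.
have cop : is_cop (gtriv_map (fun _ : unit => @ord0 n)) (gtriv_map (lift (@ord0 n))).
  split=> [[] [] //|x y /lift_inj //|x y /eqP|v].
    by rewrite (negbTE (neq_lift _ _)).
  by have [k ->|->] := unliftP ord0 v; [right; exists k|left; exists tt].
have := sum_universal cop (pt_universal M) IHn; congr universal.
apply: functional_extensionality_dep => T; apply: funext => d /=.
congr Bt; first by rewrite -mres_comp; congr mres; apply: gmap_eq.
by apply: ptens_eq => k; rewrite -mres_comp; congr mres; apply: gmap_eq.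
Qed.

Lemma triv_universal M (X : finType) : universal (D := in_norm (gtriv gT X) M)
  (fun T d => ptens B (fun k : 'I_#|X| => mres M (gat T (enum_val k)) d)).
Proof.
have iK : cancel (gtriv_map (@enum_val X predT)) (gtriv_map (@enum_rank X)).
  by move=> k; apply: enum_valK.
have jK : cancel (gtriv_map (@enum_rank X)) (gtriv_map (@enum_val X predT)).
  by move=> x; apply: enum_rankK.
have := norm_iso_universal iK jK (ord_universal M #|X|); congr universal.
apply: functional_extensionality_dep => T; apply: funext => d.
by apply: ptens_eq => k; rewrite -mres_comp; congr mres; apply: gmap_eq.
Qed.

Lemma ntriv_ex (X : finType) M :
  exists i : @iso (Mack gT) (nx (gtriv gT X) M) (tpow (box_sm B) M #|X|),
    forall T (d : M (gtriv gT X ** T)), (iso_fun i : mackey_hom _ _) T (nn d) =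
      ptens B (fun k : 'I_#|X| => mres M (gat T (enum_val k)) d).
Proof.
have [i [iE _]] := universal_iso (nnU (gtriv gT X) M) (triv_universal M X).
by exists i => T d; apply: iE.
Qed.

Definition ntriv (X : finType) M := sval (cid (ntriv_ex X M)).
Lemma ntrivE (X : finType) M T (d : M (gtriv gT X ** T)) :
  (iso_fun (ntriv X M) : mackey_hom _ _) T (nn d) =
      ptens B (fun k : 'I_#|X| => mres M (gat T (enum_val k)) d).
Proof. exact: (svalP (cid (ntriv_ex X M))). Qed.

Definition norm_gsymmon : gsymmon gT (box_sm B).
Proof.
apply: (@GSymMon gT (Mack gT) (box_sm B) nfunctor nsum _ nbox _ ntriv _ nprod _); rewrite /bifmap /=.
- move=> X X' Y Y' f g M M' h; apply: nn_ext => T d.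
  rewrite /= nsumE nmapE nsumE.
  have /= := BmapE B (nmap f h) (nmap g h); rewrite /Bmap /bifmap /= => ->.
  rewrite !nmapE /= !mh_res -!mres_comp.
  by congr (Bt _ (nn _) (nn _)); congr mres; apply: gmap_eq.
- move=> X X' f M M' N N' h k; apply: nbox_ext => T d d'.
  rewrite /= nboxE nmapE.
  have /= := BmapE B h k; rewrite /Bmap /bifmap /= => ->.
  rewrite (bt_res (Bu B)) nboxE.
  have /= := BmapE B (nmap f h) (nmap f k); rewrite /Bmap /bifmap /= => ->.
  by rewrite !nmapE.
- move=> X Y f M M' h; apply: nn_ext => T d.
  rewrite /= !nmapE !ntrivE (tpow_mapE B h).
  apply: esym; apply: texp_mapE; first exact: can_inj (giso_cancel f).
  move=> x; rewrite !enum_rankK -!mh_res -mres_comp; congr (h _ _); congr mres.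
  by apply: gmap_eq => t /=; rewrite (giso_cancel f x).
- move=> X X' Y Y' f g M M' h; apply: nprod_ext => T d.
  rewrite /= !nmapE nn_res !nprodE nmapE.
  rewrite !mh_res -!mres_comp; congr nn; congr mres; exact: gmap_eq.
Defined.

End GSym.

(** * Tambara functors are G-commutative monoids *)

Section DependentProductPoints.
Variables (gT : finGroupType) (X Y A : gset gT) (f : gmap X Y) (p : gmap A X).

Lemma gdprod_eval (u : gdprod f p) x (h : f x == gdprod_proj f p u) :
  p (val (projT2 (u : dprod_car f p)) (exist _ x h)) = x.
Proof. exact: eqP (forallP (valP (projT2 (u : dprod_car f p))) (exist _ x h)). Qed.

Definition gexp_pt (x : X) (u : gdprod f p) (e : f x = gdprod_proj f p u) : gexp_pb f p :=
  exist _ (x, u) (introT eqP e).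

Lemma gexp_ptE x u e : p (gexp_e f p (@gexp_pt x u e)) = x.
Proof. exact: gdprod_eval. Qed.

Lemma gexp_pt_irr x u e e' : @gexp_pt x u e = @gexp_pt x u e'.
Proof. by apply: val_inj. Qed.

Lemma gdprod_ext (u v : gdprod f p) : gdprod_proj f p u = gdprod_proj f p v ->
  (forall x e e', gexp_e f p (@gexp_pt x u e) = gexp_e f p (@gexp_pt x v e')) -> u = v.
Proof.
move=> e1 e2; apply: dprod_eq => // x h h'.
apply: etrans (etrans (e2 x (eqP h) (eqP h')) _); exact: gsection_congr.
Qed.

Lemma gdprod_mk y (s : forall x, f x = y -> A) : (forall x e, p (s x e) = x) ->
  exists u : gdprod f p, gdprod_proj f p u = y /\
    forall x e (e' : f x = y), gexp_e f p (@gexp_pt x u e) = s x e'.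
Proof.
move=> sP; pose t := [ffun z : gfiber f y => s (val z) (eqP (valP z))].
have tP : [forall z, p (t z) == val z] by apply/forallP => z; rewrite ffunE sP.
exists (existT (gsection f p) y (exist _ t tP)); split=> // x e e'.
rewrite /= /gexp_eval /= ffunE /=; congr s; exact: Prop_irrelevance.
Qed.

Lemma canonical_exponential :
  is_exponential p (gexp_e f p) (gexp_f' f p) (gdprod_proj f p) f.
Proof.
exists X, Y, A, f, p, (iso_id (X : GSet gT)), (iso_id (Y : GSet gT)), (iso_id (A : GSet gT)),
  (iso_id (gexp_pb f p : GSet gT)), (iso_id (gdprod f p : GSet gT)).
by split; apply: gmap_eq.
Qed.

End DependentProductPoints.

Section TambaraToGcm.
Variables (gT : finGroupType) (B : box_product gT) (R : tambara gT).
Implicit Types (X Y Z S T E : gset gT).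
Local Notation M := (tam_mackey R).
Local Notation norm := (@tam_norm gT R _ _).

Lemma tn_id X s : norm (gid X) s = s.
Proof. exact: (ma_tr_id (tam_semi_mackey R)). Qed.
Lemma tn_comp X Y Z (f : gmap Y Z) (g : gmap X Y) s : norm (gcomp f g) s = norm f (norm g s).
Proof. exact: (ma_tr_comp (tam_semi_mackey R)). Qed.
Lemma tn_base W X Y Z (a : gmap W X) (b : gmap W Y) (f : gmap X Z) (g : gmap Y Z) s :
  is_pb a b f g -> mres M g (norm f s) = norm b (mres M a s).
Proof. by move/is_pb_pullback => pb; apply: (ma_double_coset (tam_semi_mackey R) pb). Qed.
Lemma tn_bij X Y (f : gmap X Y) (g : gmap Y X) s : cancel f g -> cancel g f ->
  norm f s = mres M g s.
Proof.
move=> fK gK; have := tn_base (mres M g s) (pb_bij (Bijective fK gK)).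
rewrite tn_id mres_id -mres_comp => ->; congr tam_norm.
rewrite (_ : gcomp g f = gid X) ?mres_id //; exact: gmap_eq.
Qed.

(** Dependent products along [X × T -> Y × T -> T] compose: a section of [p] over [X] is a section
    over [Y] of the dependent product of [p] along [F × T]. The exponential axiom of [R] handles the
    first map, the relations of [Y ⊗ M] the second. *)
Lemma norm_dpr X Y T A (F : gmap X Y) (p : gmap A (X ** T)) :
  exists E (h : gmap E T) (e : gmap (X ** E) A), is_dpr p h e /\
   forall (a : M A), nn (norm (F ⊠ gid T) (mtr M p a)) =
      mtr (nx Y M) h (nn (norm (F ⊠ gid E) (mres M e a))).
Proof.
pose f := F ⊠ gid T; pose D := gdprod f p; pose h0 := gdprod_proj f p.
have [E [h [e dp]]] := dpr_exists h0.
have comm x u : f (gpair x (h u)) = h0 (e (gpair (F x) u)) by rewrite (dprE dp).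
(* The map [w] sends [(x, u)] to the partial section that [u] gives at [F x], together with the
   point [x] at which to evaluate it. *)
have [w [w1 w2]] : exists w : gmap (X ** E) (gexp_pb f p),
  (forall u, gpb1 f h0 (w u) = (gid X ⊠ h) u) /\ (forall u, gpb2 f h0 (w u) = e ((F ⊠ gid E) u)).
  apply: (pb_map (gpb_is_pb f h0) (s := gid X ⊠ h) (t := gcomp e (F ⊠ gid E))).
  by case=> x u; apply: comm.
have wE x u : w (gpair x u) = gexp_pt (comm x u).
  by apply: (gpb_inj (f := f) (g := h0)); rewrite ?w1 ?w2.
exists E, h, (gcomp (gexp_e f p) w); split.
  apply: is_dprI => [x u|t s sP|u v eh ee].
  - by rewrite /= wE gexp_ptE.
  - have ex y : exists d : D, h0 d = gpair y t /\
        forall x c (c' : f x = gpair y t), gexp_e f p (@gexp_pt _ _ _ _ f p x d c) = s x.1.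
      apply: (@gdprod_mk _ _ _ _ f p (gpair y t) (fun x _ => s x.1)).
      by move=> [x t'] /= [_ ->]; rewrite sP.
    have [u [u1 u2]] := dpr_ex dp (s := fun y => sval (cid (ex y))) (t := t)
      (fun y => proj1 (svalP (cid (ex y)))).
    exists u; split=> // x; rewrite /= wE.
    have c' : f (gpair x t) = gpair (F x) t by [].
    move: (comm x u); rewrite u1 u2 => c.
    exact: (proj2 (svalP (cid (ex (F x)))) (gpair x t) c c').
  - apply: (dpr_eq dp) => // y; apply: gdprod_ext; first by rewrite !(dprE dp) eh.
    move=> [x t] c c'.
    have := c; rewrite (dprE dp) => -[ey et]; move: c c'; rewrite -ey et => c c'.
    have := ee x; rewrite /= !wE => E1.
    rewrite (gexp_pt_irr c (comm x u)) E1.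
    move: (comm x v) c' {E1}; rewrite -eh => c1 c2; congr (gexp_eval _); exact: gexp_pt_irr.
move=> a; rewrite (tam_exponential (canonical_exponential f p)) (nn_tr _ dp).
(* Base change in this square exchanges evaluation of sections over [Y] with the norm along [F]. *)
have pw : is_pb w (F ⊠ gid E) (gexp_f' f p) e.
  apply: is_pbI => [u|u [y v] euv|[x u] [x' u'] e1 [_ ->]].
  - exact: w2.
  - have [eF et] : F (gpb1 f h0 u).1 = y /\ (gpb1 f h0 u).2 = h v.
      have := gpbE u; rewrite -[gpb2 f h0 u]/(gexp_f' f p u) euv (dprE dp) => -[] //.
    exists (gpair (gpb1 f h0 u).1 v); split; last by rewrite /= eF.
    apply: (gpb_inj (f := f) (g := h0)); rewrite ?w1 ?w2.
      by rewrite [RHS]gpairP et.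
    by rewrite -[RHS]/(gexp_f' f p u) euv -eF.
  - by have := congr1 (gpb1 f h0) e1; rewrite !w1 => -[->].
congr mtr; congr nn; rewrite (tn_base _ pw) mres_comp //.
Qed.

Lemma gmap_nx_ex X Y (F : gmap X Y) : exists g : mackey_hom (nx X M) (nx Y M),
  forall T (d : M (X ** T)), g T (nn d) = nn (norm (F ⊠ gid T) d).
Proof.
have np : is_pairing (D := in_norm X M) (P := nx Y M)
    (fun T (d : M (X ** T)) => nn (norm (F ⊠ gid T) d)).
  apply: shift_pairingI => [S T g d|T A q d a /= ->].
    by rewrite nn_res (tn_base _ (is_pb_sym (pb_prod_mid F g))).
  have [E [h [e [dp H]]]] := norm_dpr F q.
  by exists E, h, e; split=> //; apply: H.
by have [g [gE _]] := (proj2 (nnU X M)) _ _ np; exists g => T d; apply: gE.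
Qed.

Definition gmap_nx X Y (F : gmap X Y) := sval (cid (gmap_nx_ex F)).
Lemma gmap_nxE X Y (F : gmap X Y) T (d : M (X ** T)) :
  gmap_nx F T (nn d) = nn (norm (F ⊠ gid T) d).
Proof. exact: (svalP (cid (gmap_nx_ex F))). Qed.

(** Compatibility with disjoint unions and with products is base change for norms in the evident
    pullback squares. *)
Lemma tambara_gcm : is_gcm (norm_gsymmon B) M.
Proof.
constructor.
apply: (@GcmStructure gT (Mack gT) (box_sm B) (norm_gsymmon B) M gmap_nx); rewrite /bifmap.
- by move=> X; apply: nn_ext => T d; rewrite gmap_nxE gprod_map_id tn_id.
- move=> X Y Z f g; apply: nn_ext => T d.
  by rewrite gmap_nxE /= !gmap_nxE gprod_map_compr tn_comp.
- move=> X Y f; apply: nn_ext => T d; rewrite gmap_nxE [RHS]nmapE; congr nn.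
  apply: tn_bij => -[x t] /=; first by rewrite giso_cancel.
  by rewrite (giso_cancel (iso_sym f)).
- move=> X X' Y Y' f g; apply: nn_ext => T d /=; rewrite gmap_nxE !nsumE.
  have /= := BmapE B (gmap_nx f) (gmap_nx g); rewrite /Bmap /bifmap /= => ->.
  rewrite !gmap_nxE; congr (Bt _ (nn _) (nn _)); apply: tn_base.
  + apply: is_pbI => [[x t]|[[x|y] t] [x' t'] //= [<- <-]|[x t] [x' t'] [<- <-]] //.
    by exists (gpair x t).
  + apply: is_pbI => [[x t]|[[x|y] t] [x' t'] //= [<- <-]|[x t] [x' t'] [<- <-]] //.
    by exists (gpair y t).
- move=> X Y Y' g; apply: nprod_ext => T d; rewrite /= nprodE gmap_nxE nmapE gprod_map_id.
  rewrite mres_id gmap_nxE nprodE; congr nn; apply: tn_base.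
  apply: is_pbI => [[[x y] t]|[y [x t]] [[x' y'] t'] /= [<- <- <-]|[[x y] t] [[x' y'] t'] [<- <- <-]] //.
  by exists (gpair (gpair x y) t).
Qed.

End TambaraToGcm.

(** * G-commutative monoids are Tambara functors *)

Section GcmNorms.
Variables (gT : finGroupType) (B : box_product gT) (M : mackey gT).
Variable H : gcm_structure (norm_gsymmon B) M.
Implicit Types (X Y Z W S T U V E A : gset gT).

Definition gcm_hom X Y (f : gmap X Y) : mackey_hom (nx X M) (nx Y M) := gcm_map H f.

Lemma gcm_hom_id X T (s : nx X M T) : gcm_hom (gid X) T s = s.
Proof. by rewrite /gcm_hom (gcm_id H X). Qed.

Lemma gcm_hom_comp X Y Z (f : gmap Y Z) (g : gmap X Y) T (s : nx X M T) : gcm_hom (gcomp f g) T s = gcm_hom f T (gcm_hom g T s).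
Proof. by rewrite /gcm_hom (gcm_comp H f g). Qed.

Lemma gcm_hom_iso X Y (i : @iso (GSet gT) X Y) T (d : M (X ** T)) :
  gcm_hom (iso_fun i) T (nn d) = nn (mres M ((iso_inv i : gmap Y X) ⊠ gid T) d).
Proof. by rewrite /gcm_hom (gcm_iso H i) [LHS]nmapE. Qed.

Lemma gcm_hom_bij X Y (f : gmap X Y) T (d : M (Y ** T)) : bijective f ->
  gcm_hom f T (nn (mres M (f ⊠ gid T) d)) = nn d.
Proof.
move=> /gbij_iso[i <-]; rewrite gcm_hom_iso -mres_comp; congr nn.
rewrite (_ : gcomp _ _ = gid _) ?mres_id //; apply: gmap_eq => -[x t] /=.
by rewrite (giso_cancel (iso_sym i)).
Qed.

Lemma gcm_hom_sum X X' Y Y' (f : gmap X X') (g : gmap Y Y') T (s : nx (gsum X Y) M T) :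
  (iso_fun (nsum B X' Y' M) : mackey_hom _ _) T (gcm_hom (gsum_map f g) T s) =
  Bmap B (gcm_hom f) (gcm_hom g) T ((iso_fun (nsum B X Y M) : mackey_hom _ _) T s).
Proof. exact: (congr1 (fun k : mackey_hom _ _ => k T s) (gcm_sum H f g)). Qed.

Lemma nmap_id_exists X Y Y' (g : mackey_hom (nx Y M) (nx Y' M)) T (s : nx Y M (X ** T)) :
  nmap (iso_id (X : GSet gT)) g T (nn s) = nn (g _ s).
Proof. by rewrite nmapE gprod_map_id mres_id. Qed.

Lemma gcm_hom_prod X Y Y' (g : gmap Y Y') T (s : nx Y M (X ** T)) :
  (iso_fun (nprod X Y' M) : mackey_hom _ _) T (nn (gcm_hom g _ s)) =
  gcm_hom (gid X ⊠ g) T ((iso_fun (nprod X Y M) : mackey_hom _ _) T (nn s)).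
Proof.
by have := congr1 (fun k : mackey_hom _ _ => k T (nn s)) (gcm_prod H X g); rewrite -nmap_id_exists.
Qed.

(** ** The norms [M (X × T) -> M T] *)

Lemma npt_ex : exists i : @iso (Mack gT) (nx (gpt gT) M) M,
  forall T (d : M (gpt gT ** T)), (iso_fun i : mackey_hom _ _) T (nn d) = mres M (gat T tt) d.
Proof.
have [i [iE _]] := universal_iso (nnU (gpt gT) M) (pt_universal M).
by exists i => T d; apply: iE.
Qed.

Definition npt : @iso (Mack gT) (nx (gpt gT) M) M := sval (cid npt_ex).
Definition iota : mackey_hom (nx (gpt gT) M) M := iso_fun npt.
Definition iotaV : mackey_hom M (nx (gpt gT) M) := iso_inv npt.
Lemma iotaE T (d : M (gpt gT ** T)) : iota T (nn d) = mres M (gat T tt) d.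
Proof. exact: (svalP (cid npt_ex)). Qed.
Lemma iotaK T (s : nx (gpt gT) M T) : iotaV T (iota T s) = s.
Proof. exact: miso_cancel. Qed.

Lemma gat_sndK T : gcomp (gsnd (gpt gT) T) (gat T tt) = gid T.
Proof. exact: gmap_eq. Qed.

Lemma iotaVE T (s : M T) : iotaV T s = nn (mres M (gsnd (gpt gT) T) s).
Proof.
rewrite -[RHS]iotaK; congr (iotaV T _).
by rewrite iotaE -mres_comp gat_sndK mres_id.
Qed.

(** The norm that a Tambara structure would attach to the projection [X × T -> T]. *)
Definition pnorm X T (m : M (X ** T)) : M T := iota T (gcm_hom (gterm X) T (nn m)).

Lemma gcm_hom_term X T (m : M (X ** T)) : gcm_hom (gterm X) T (nn m) = iotaV T (pnorm m).
Proof. by rewrite iotaK. Qed.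

Lemma gterm_comp X Y (f : gmap X Y) : gcomp (gterm Y) f = gterm X.
Proof. exact: gmap_eq. Qed.

Lemma pnorm_res X S T (f : gmap S T) (m : M (X ** T)) :
  pnorm (mres M (gid X ⊠ f) m) = mres M f (pnorm m).
Proof. by rewrite /pnorm -nn_res !mh_res. Qed.

Lemma pnorm_tr X T A E (q : gmap A (X ** T)) (h : gmap E T) (e : gmap (X ** E) A) (a : M A) :
  is_dpr q h e -> pnorm (mtr M q a) = mtr M h (pnorm (mres M e a)).
Proof. by move=> dp; rewrite /pnorm (nn_tr _ dp) !mh_tr. Qed.

Lemma pnorm_bij X Y (f : gmap X Y) T (d : M (Y ** T)) : bijective f ->
  pnorm (mres M (f ⊠ gid T) d) = pnorm d.
Proof. by move=> fb; rewrite /pnorm -(gterm_comp f) gcm_hom_comp gcm_hom_bij. Qed.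

Lemma pnorm_pt T (d : M (gpt gT ** T)) : pnorm d = mres M (gat T tt) d.
Proof.
rewrite /pnorm (_ : gterm (gpt gT) = gid (gpt gT)) ?gcm_hom_id ?iotaE //.
by apply: gmap_eq => -[].
Qed.

(** Up to [X × pt ≅ X] the projection is the product of [X] with [Y -> pt], so [gcm_prod] computes
    its action by a norm over [Y]. *)
Lemma gcm_hom_fst X Y T (d : M (Y ** (X ** T))) :
  gcm_hom (gfst X Y) T (nn (mres M (greassoc X Y T) d)) = nn (pnorm d).
Proof.
have fb : bijective (gfst X (gpt gT)).
  by exists (fun x : X => gpair x (tt : gpt gT)) => [[x []]|x].
have -> : gfst X Y = gcomp (gfst X (gpt gT)) (gid X ⊠ gterm Y) by apply: gmap_eq.
rewrite gcm_hom_comp -nprodE -gcm_hom_prod gcm_hom_term iotaVE nprodE -[RHS](gcm_hom_bij _ fb); congr (gcm_hom _ _ (nn _)).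
rewrite -mres_comp; congr mres; exact: gmap_eq.
Qed.

(** Fubini for norms: the map [X × Y -> pt] factors through the projection to [X]. *)
Lemma pnorm_N X Y T (d : M (Y ** (X ** T))) : pnorm (mres M (greassoc X Y T) d) = pnorm (pnorm d).
Proof. by rewrite {1}/pnorm -(gterm_comp (gfst X Y)) gcm_hom_comp gcm_hom_fst. Qed.

Local Notation pt2 := (gsum (gpt gT) (gpt gT)).

Definition gcm_mul T (a b : M T) : M T :=
  iota T (gcm_hom (gterm pt2) T ((iso_inv (nsum B (gpt gT) (gpt gT) M) : mackey_hom _ _) T
    (Bt B (iotaV T a) (iotaV T b)))).

Lemma pnorm_sum X Y T (d : M (gsum X Y ** T)) :
  pnorm d = gcm_mul (pnorm (mres M (ginl X Y ⊠ gid T) d)) (pnorm (mres M (ginr X Y ⊠ gid T) d)).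
Proof.
rewrite /gcm_mul {1}/pnorm -(gterm_comp (gsum_map (gterm X) (gterm Y))) gcm_hom_comp.
congr (iota T (gcm_hom _ T _)); rewrite -!gcm_hom_term.
by rewrite -BmapE -nsumE -gcm_hom_sum; apply: esym; apply: (miso_cancel (nsum B _ _ M)).
Qed.

Lemma pnorm_cop X Y Z (i : gmap X Z) (j : gmap Y Z) T (d : M (Z ** T)) : is_cop i j ->
  pnorm d = gcm_mul (pnorm (mres M (i ⊠ gid T) d)) (pnorm (mres M (j ⊠ gid T) d)).
Proof.
move=> /gcopair_bij cb; rewrite -(pnorm_bij d cb) pnorm_sum -!mres_comp.
by congr gcm_mul; congr pnorm; congr mres; apply: gmap_eq => -[].
Qed.

Lemma gcm_mul_addl T (a a' b : M T) : gcm_mul (a + a') b = gcm_mul a b + gcm_mul a' b.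
Proof. by rewrite /gcm_mul !mh_add (bt_addl (Bu B)) !mh_add. Qed.

Lemma gcm_mul_res S T (f : gmap S T) a b : mres M f (gcm_mul a b) = gcm_mul (mres M f a) (mres M f b).
Proof. by rewrite /gcm_mul -!mh_res (bt_res (Bu B)) -!mh_res. Qed.

Definition gcm_one T : M T := pnorm (0 : M (gvoid gT ** T)).

Lemma pnorm_void X T (d : M (X ** T)) : (X -> False) -> pnorm d = gcm_one T.
Proof.
move=> X0; have fb : bijective (void_to X0).
  by exists (fun v : void => match v return X with end) => [x|[]]; case: (X0 x).
rewrite /gcm_one -(pnorm_bij _ fb); congr pnorm; apply: mvoid_eq => -[x _]; apply: (X0 x).
Qed.

Lemma gcm_one_res S T (f : gmap S T) : mres M f (gcm_one T) = gcm_one S.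
Proof. by rewrite /gcm_one -pnorm_res mres0. Qed.

(** One is the norm over the empty set, and a product with the empty set is empty. *)
Lemma pnorm_one X T : pnorm (gcm_one (X ** T)) = gcm_one T.
Proof. by rewrite /gcm_one -pnorm_N; apply: pnorm_void => -[_ []]. Qed.

Lemma cop_sym X Y Z (i : gmap X Z) (j : gmap Y Z) : is_cop i j -> is_cop j i.
Proof.
by move=> [I J dis cov]; split=> // [u v /esym/dis|v] //; case: (cov v); [right|left].
Qed.

(** Products become norms over a two-point set, so that their laws can be read off from
    decompositions of G-sets. *)
Lemma gcm_mul_pnorm2 T (a b : M T) : exists d : M (pt2 ** T),
  [/\ gcm_mul a b = pnorm d, mres M (gcomp (ginl _ _ ⊠ gid T) (gat T tt)) d = a &
      mres M (gcomp (ginr _ _ ⊠ gid T) (gat T tt)) d = b].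
Proof.
have [d [d1 d2]] := madd_ex (mres M (gsnd (gpt gT) T) a) (mres M (gsnd (gpt gT) T) b)
  (cop_prodr T (gsum_is_cop (gpt gT) (gpt gT))).
have e1 : mres M (gcomp (ginl _ _ ⊠ gid T) (gat T tt)) d = a.
  by rewrite mres_comp d1 -mres_comp gat_sndK mres_id.
have e2 : mres M (gcomp (ginr _ _ ⊠ gid T) (gat T tt)) d = b.
  by rewrite mres_comp d2 -mres_comp gat_sndK mres_id.
by exists d; split=> //; rewrite pnorm_sum !pnorm_pt -!mres_comp e1 e2.
Qed.

Lemma gcm_mulC T : commutative (@gcm_mul T).
Proof.
move=> a b; have [d [-> da db]] := gcm_mul_pnorm2 a b.
by rewrite (pnorm_cop d (cop_sym (gsum_is_cop _ _))) !pnorm_pt -!mres_comp da db.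
Qed.

Lemma gcm_mul1 T : left_id (gcm_one T) (@gcm_mul T).
Proof.
move=> a; have cop : is_cop (gvoid_map (gpt gT)) (gid (gpt gT)).
  by split; [case | | case | move=> v; right; exists v].
have := pnorm_cop (mres M (gsnd (gpt gT) T) a) cop.
rewrite (pnorm_void _ (X := gvoid gT)); last by case.
rewrite !pnorm_pt -!mres_comp gat_sndK mres_id => e; apply: esym; rewrite {1}e; congr gcm_mul.
Qed.

Lemma gcm_mulA T : associative (@gcm_mul T).
Proof.
move=> a b c; pose P2 := gpt gT; pose Z := gsum P2 (gsum P2 P2).
have [d' [d1' d2']] := madd_ex (mres M (gsnd P2 T) b) (mres M (gsnd P2 T) c)
  (cop_prodr T (gsum_is_cop P2 P2)).
have [d [d1 d2]] := madd_ex (mres M (gsnd P2 T) a) d' (cop_prodr T (gsum_is_cop P2 (gsum P2 P2))).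
pose k := gcopair (ginl P2 (gsum P2 P2)) (gcomp (ginr P2 (gsum P2 P2)) (ginl P2 P2)).
pose l := gcomp (ginr P2 (gsum P2 P2)) (ginr P2 P2).
have cop : is_cop k l.
  split=> [[u|u] [v|v] //= []|u v []|[u|u] v|[[]|[[]|[]]]] //; try by move=> ->.
  - by left; exists (inl tt).
  - by left; exists (inr tt).
  - by right; exists tt.
have Npt (x : M T) : pnorm (mres M (gsnd P2 T) x) = x.
  by rewrite pnorm_pt -mres_comp gat_sndK mres_id.
have := pnorm_sum d; rewrite d1 d2 (pnorm_sum d') d1' d2' !Npt => <-.
rewrite (pnorm_cop d cop) pnorm_sum -!mres_comp.
have ea : mres M (gcomp (k ⊠ gid T) (ginl P2 P2 ⊠ gid T)) d = mres M (gsnd P2 T) a.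
  by rewrite -d1; congr mres; apply: gmap_eq.
have eb : mres M (gcomp (k ⊠ gid T) (ginr P2 P2 ⊠ gid T)) d = mres M (gsnd P2 T) b.
  by rewrite -d1' -d2 -mres_comp; congr mres; apply: gmap_eq.
have ec : mres M (l ⊠ gid T) d = mres M (gsnd P2 T) c.
  by rewrite -d2' -d2 -mres_comp; congr mres; apply: gmap_eq.
by rewrite ea eb ec !Npt.
Qed.

(** The G-set [X × (pt ⊔ pt)] is two copies of [X]; Fubini and the decomposition compute the norm
    over it in two ways. *)
Lemma pnorm_mul X T (a b : M (X ** T)) : pnorm (gcm_mul a b) = gcm_mul (pnorm a) (pnorm b).
Proof.
have [d [-> da db]] := gcm_mul_pnorm2 a b; rewrite -pnorm_N.
pose i1 : gmap X (X ** pt2) := @GMap gT X (X ** pt2) (fun x => gpair x (inl tt : pt2)) (fun _ _ => erefl).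
pose i2 : gmap X (X ** pt2) := @GMap gT X (X ** pt2) (fun x => gpair x (inr tt : pt2)) (fun _ _ => erefl).
have cop : is_cop i1 i2.
  split=> [x y []|x y []|x y []|[x [[]|[]]]] //; [left|right]; by exists x.
rewrite (pnorm_cop _ cop) -!mres_comp -da -db.
by congr gcm_mul; congr pnorm; congr mres; apply: gmap_eq => -[].
Qed.

(** ** Extension by one *)

Definition gfork W X Y (f : gmap W X) (g : gmap W Y) : gmap W (X ** Y).
Proof. by exists (fun w => gpair (f w) (g w)) => w a; rewrite !gfunP. Defined.

Definition off_im W V (i : gmap W V) : pred V := fun v => v \notin codom i.
Lemma off_im_inv W V (i : gmap W V) v a : off_im i (gact V v a) = off_im i v.
Proof. by rewrite /off_im gim_inv. Qed.
Definition gcompl W V (i : gmap W V) : gmap (gsub (off_im_inv i)) V := gincl (off_im_inv i).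

Lemma compl_cop W V (i : gmap W V) : injective i -> is_cop i (gcompl i).
Proof.
move=> iI; split=> //; first exact: gincl_inj.
- by move=> w v e; have := ginclP v; rewrite /off_im -[gincl _ v]e codom_f.
- move=> v; case Pv : (v \in codom i).
    by left; have /codomP[w ->] := Pv; exists w.
  have nPv : off_im i v by rewrite /off_im Pv.
  by right; exists (gsubmk (off_im_inv i) nPv).
Qed.

Lemma compl_off W V (i : gmap W V) v w : gcompl i v <> i w.
Proof. by move=> e; have := ginclP v; rewrite /off_im -/(gcompl i) [gincl _ v]e codom_f. Qed.

Lemma gcm_ext_ex W V (i : gmap W V) (m : M W) : exists z : M V, injective i ->
  mres M i z = m /\ mres M (gcompl i) z = gcm_one _.
Proof.
case: (pselect (injective i)) => [iI|nI]; last by exists 0.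
by have [z zP] := madd_ex m (gcm_one _) (compl_cop iI); exists z.
Qed.

(** Extension by one outside the image; for [i] not injective the chosen value is arbitrary. *)
Definition gcm_ext W V (i : gmap W V) (m : M W) : M V := sval (cid (gcm_ext_ex i m)).

Lemma gcm_ext_on W V (i : gmap W V) m : injective i -> mres M i (gcm_ext i m) = m.
Proof. by move=> iI; rewrite /gcm_ext; case: cid => z /= /(_ iI)[]. Qed.

Lemma gcm_ext_off W V (i : gmap W V) m U (c : gmap U V) : injective i ->
  (forall u w, c u <> i w) -> mres M c (gcm_ext i m) = gcm_one U.
Proof.
move=> iI cP; have cP' u : off_im i (c u).
  by apply/negP => /codomP[w]; apply: cP.
have -> : c = gcomp (gcompl i) (glift (off_im_inv i) cP') by apply: gmap_eq.
rewrite mres_comp /gcm_ext; case: cid => z /= /(_ iI)[_ ->]; exact: gcm_one_res.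
Qed.

(** Testing against all maps that avoid the image, rather than the inclusion of the complement,
    makes the criterion convenient under base change. *)
Lemma gcm_ext_eq W V (i : gmap W V) m z : injective i -> mres M i z = m ->
  (forall U (c : gmap U V), (forall u w, c u <> i w) -> mres M c z = gcm_one U) -> z = gcm_ext i m.
Proof.
move=> iI e1 e2; apply: (madd_inj (compl_cop iI)); first by rewrite gcm_ext_on.
rewrite (gcm_ext_off _ iI (@compl_off _ _ i)); apply: e2; exact: compl_off.
Qed.

Lemma gcm_ext_res W V W' V' (a : gmap W' W) (i' : gmap W' V') (i : gmap W V) (g : gmap V' V) m :
  injective i -> is_pb a i' i g -> mres M g (gcm_ext i m) = gcm_ext i' (mres M a m).
Proof.
move=> iI p; have [pc _] := p.
have iI' : injective i'.
  by move=> u v e; apply: (pb_eq p) => //; apply: iI; rewrite !pc e.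
apply: gcm_ext_eq => //.
- rewrite -mres_comp (_ : gcomp g i' = gcomp i a); last by apply: gmap_eq => u; rewrite /= pc.
  by rewrite mres_comp gcm_ext_on.
- move=> U c cP; rewrite -mres_comp; apply: gcm_ext_off => // u w /= e.
  have [v [_ v2]] := pb_ex p (esym e); exact: (cP u v (esym v2)).
Qed.

Lemma gcm_ext_one W V (i : gmap W V) : injective i -> gcm_ext i (gcm_one W) = gcm_one V.
Proof. by move=> iI; apply: esym; apply: gcm_ext_eq => // *; rewrite gcm_one_res. Qed.

Lemma gcm_ext_mul W V (i : gmap W V) m m' : injective i ->
  gcm_ext i (gcm_mul m m') = gcm_mul (gcm_ext i m) (gcm_ext i m').
Proof.
move=> iI; apply: esym; apply: gcm_ext_eq => // [|U c cP]; rewrite gcm_mul_res ?gcm_ext_on //.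
by rewrite !(gcm_ext_off _ iI cP) gcm_mul1.
Qed.

(** Off the image of [i] the element to be normed is one, and so is its norm; on the image base
    change reduces to the identity of [W]. *)
Lemma pnorm_ext X V W (i : gmap W V) (x : gmap W X) m : injective i ->
  pnorm (gcm_ext (gfork x i) m) = gcm_ext i (pnorm (gcm_ext (gfork x (gid W)) m)).
Proof.
move=> iI; have fI : injective (gfork x i) by move=> u v [_ /iI].
apply: gcm_ext_eq => // [|U c cP].
- rewrite -pnorm_res; congr pnorm; rewrite -[in RHS](mres_id m); apply: gcm_ext_res => //.
  apply: is_pbI => [w|u [y w] [<- /iI <-]|u v _ [_]] //; by exists u.
- rewrite -pnorm_res (_ : mres M _ _ = gcm_one _) ?pnorm_one //; apply: gcm_ext_off => // -[y u] w [_].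
  exact: cP.
Qed.

End GcmNorms.

(** * Norms along graphs and independence of the embedding *)

Section GraphNorm.
Variables (gT : finGroupType) (B : box_product gT) (M : mackey gT).
Variable H : gcm_structure (norm_gsymmon B) M.
Implicit Types (X Y Z W S T U V E A : gset gT).

Local Notation gcm_hom := (gcm_hom H).
Local Notation pnorm := (pnorm H).
Local Notation gcm_mul := (gcm_mul H).
Local Notation gcm_one := (gcm_one H).
Local Notation gcm_ext := (gcm_ext H).

(** The map from the empty set to [V] is, up to a bijection, the projection from [V × ∅], whose
    action is a norm over the empty set. *)
Lemma gcm_hom_void V T (z : nx (gvoid gT) M T) (d : M (gvoid gT ** T)) : z = nn d ->
  gcm_hom (gvoid_map V) T z = nn (gcm_one (V ** T)).
Proof.
move=> ->; have V0 : V ** gvoid gT -> False by case=> _ [].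
pose k := gvoid_map (V ** gvoid gT).
have kb : bijective k by exists (void_to V0) => [[]|[_ []]].
have -> : gvoid_map V = gcomp (gfst V (gvoid gT)) k by apply: gmap_eq => -[].
have -> : d = mres M (k ⊠ gid T) (mres M (greassoc V (gvoid gT) T) 0).
  by apply: mvoid_eq => -[[]].
by rewrite gcm_hom_comp gcm_hom_bij // gcm_hom_fst.
Qed.

(** After [S ≅ S ⊔ ∅], the graph is the sum of the identity of [S] and the empty map into the
    complement; [gcm_sum] then puts one on the complement. *)
Lemma gcm_hom_graph S Y (s : gmap S Y) T (d : M ((S ** Y) ** T)) :
  mres M (gcompl (gfork (gid S) s) ⊠ gid T) d = gcm_one _ ->
  gcm_hom (gfork (gid S) s) T (nn (mres M (gfork (gid S) s ⊠ gid T) d)) = nn d.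
Proof.
set j := gfork (gid S) s => dc; set c := gcompl j in dc; set V := gsub _ in c dc.
have jI : injective j by move=> x y [].
have kb : bijective (gcopair j c) by apply: gcopair_bij; apply: compl_cop.
pose v := gsum_map (gid S) (gvoid_map V).
pose l := ginl S (gvoid gT).
have lb : bijective l by exists (fun u : S + void => match u with inl x => x | inr w => match w with end end) => [x|[x|[]]].
have -> : j = gcomp (gcopair j c) (gcomp v l) by apply: gmap_eq.
rewrite !gcm_hom_comp -(gcm_hom_bij H d kb); congr (gcm_hom _ T _).
have [d0 [d1 d2]] := madd_ex (mres M (j ⊠ gid T) d) (0 : M (gvoid gT ** T)) (cop_prodr T (gsum_is_cop S (gvoid gT))).
have -> : nn (mres M (gcomp (gcopair j c) (gcomp v l) ⊠ gid T) d) = nn (mres M (l ⊠ gid T) d0).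
  by rewrite d1; congr nn; congr mres; apply: gmap_eq.
rewrite (gcm_hom_bij H d0 lb).
apply: (can_inj (@miso_cancel _ _ _ (nsum B S V M) T)).
rewrite gcm_hom_sum nsumE BmapE nsumE d1 d2 (gcm_hom_void V erefl) gcm_hom_id -!mres_comp.
have -> : gcomp (gcopair j c ⊠ gid T) (ginl S V ⊠ gid T) = j ⊠ gid T by apply: gmap_eq.
have -> : gcomp (gcopair j c ⊠ gid T) (ginr S V ⊠ gid T) = c ⊠ gid T by apply: gmap_eq.
by rewrite dc.
Qed.

(* Functoriality for the factorization of the identity of [S] through the graph of
   [s] and the projection [S × Y -> S]. *)
Lemma nn_graph S Y (s : gmap S Y) T (m : M (S ** T)) :
  nn m = nn (pnorm (gcm_ext (gfork (gcomp s (gfst S T)) (gid (S ** T))) m)).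
Proof.
set f := gfork _ _; have fI : injective f by move=> u v [_].
rewrite -gcm_hom_fst; set d := mres M (greassoc S Y T) _.
have -> : nn d = gcm_hom (gfork (gid S) s) T (nn (mres M (gfork (gid S) s ⊠ gid T) d)).
  apply: esym; apply: gcm_hom_graph; rewrite /d -mres_comp; apply: gcm_ext_off => // -[v t] u [e1 e2].
  apply: (@compl_off _ _ _ (gfork (gid S) s) v u.1).
  have := congr1 fst e2; rewrite /= => <-; rewrite [LHS]gpairP /=; congr pair.
  by have := e1; rewrite /= -e2.
rewrite -gcm_hom_comp (_ : gcomp (gfst S Y) _ = gid S); last exact: gmap_eq.
rewrite gcm_hom_id /d -mres_comp; congr nn.
rewrite -[LHS](gcm_ext_on H m fI); congr mres.
by apply: gmap_eq => -[x t].
Qed.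

Section Orbit.
Hypothesis abel : forall a b : gT, (a * b = b * a)%g.
Variables (S : gset gT) (o : S).
Hypothesis tr_o : forall x : S, exists a, gact S o a = x.

Definition tr_elt (x : S) : gT := sval (cid (tr_o x)).
Lemma tr_eltE x : gact S o (tr_elt x) = x.
Proof. exact: (svalP (cid (tr_o x))). Qed.

Definition Str : gset gT := gtriv gT S.

(** Translation of the orbit by an element that carries [o] to the first argument; it is equivariant
    in the second because [G] is abelian. *)
Definition sh : gmap (Str ** S) S.
Proof.
exists (fun u : S * S => gact S u.2 (tr_elt u.1)) => -[x y] a /=.
by rewrite -!actM abel.
Defined.

Lemma sh_swap x b : gact S (gact S o b) (tr_elt x) = gact S x b.
Proof. by rewrite -actM abel actM tr_eltE. Qed.

Lemma sh_bij : bijective (gfork sh (gsnd Str S)).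
Proof.
have [||g [gK Kg]] := @gbij_inv _ _ _ (gfork sh (gsnd Str S)); last by exists g.
- move=> [x y] [x' y'] [] /= e1 e2; subst y'; have [b eb] := tr_o y.
  by move: e1; rewrite -eb !sh_swap => /(can_inj (actK _ _)) ->.
- move=> [z y]; have [b eb] := tr_o y; exists (gpair (gact S z b^-1%g : Str) y).
  by rewrite /= -{1}eb sh_swap actKV.
Qed.

Definition sh_map T : gmap (Str ** (S ** T)) (S ** T) :=
  gfork (gcomp sh (gid Str ⊠ gfst S T)) (gcomp (gsnd S T) (gsnd Str (S ** T))).

Lemma sh_mapE T x y (t : T) : sh_map T (gpair x (gpair y t)) = gpair (sh (gpair x y)) t.
Proof. by []. Qed.

(* Over an orbit [S] of an abelian group, [S × S] is the product of [S] with a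
   trivial G-set, so that norms along [S] can be compared with products. *)
Lemma kappa_ex : exists k : mackey_hom (nx S M) (mshiftl S M),
  forall T (m : M (S ** T)), k T (nn m) = pnorm (mres M (sh_map T) m).
Proof.
have np : is_pairing (D := in_norm S M) (P := mshiftl S M)
    (fun T (d : M (S ** T)) => pnorm (mres M (sh_map T) d)).
  apply: shift_pairingI => [S' T g d|T A q a' a /= ->] /=.
    rewrite -pnorm_res -!mres_comp; congr pnorm; congr mres; exact: gmap_eq.
  have [E [h [e dp]]] := dpr_exists q; exists E, h, e; split=> //.
  have p := gpb_is_pb q (sh_map T); have [pc _] := p.
  have [w [w1 w2]] : exists w : gmap (Str ** (S ** E)) (gpb q (sh_map T)),
    (forall u, gpb1 q (sh_map T) (w u) = e (sh_map E u)) /\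
    (forall u, gpb2 q (sh_map T) (w u) = (gid Str ⊠ (gid S ⊠ h)) u).
    apply: (pb_map p (s := gcomp e (sh_map E)) (t := gid Str ⊠ (gid S ⊠ h))).
    by move=> [x [y u]]; rewrite /= [q _](dprE dp).
  have [g gK Kg] := sh_bij.
  (* For fixed [y] the translations identify the trivial set with [S], by [sh_bij], and so identify
     sections over the one with sections over the other. *)
  have dpw : is_dpr (gpb2 q (sh_map T)) (gid S ⊠ h) w.
    apply: is_dprI => [x [y u]|[y t] s sP|[y u] [y' u'] [ey eh] ew].
    - by rewrite w2.
    - pose s' (z : S) := gpb1 q (sh_map T) (s (g (gpair z y)).1).
      have gE z : (g (gpair z y)).2 = y /\ sh (gpair (g (gpair z y)).1 y) = z.
        have := Kg (gpair z y); case: (g _) => x y' /= [e1 e2]; subst y'; by [].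
      have [|u [u1 u2]] := dpr_ex dp (s := s') (t := t).
        by move=> z; rewrite /s' pc sP sh_mapE; have [_ ->] := gE z.
      exists (gpair y u); split=> [|x]; first by rewrite /= u1.
      apply: (gpb_inj (f := q) (g := sh_map T)).
        rewrite w1 sh_mapE u2 /s'; congr (gpb1 _ _ (s _)).
        by have := gK (gpair x y); rewrite -[gfork _ _ _]/(gpair _ _) => ->.
      by rewrite w2 sP /= u1.
    - subst y'; congr gpair; apply: (dpr_eq dp) => // z.
      have := congr1 (gpb1 q (sh_map T)) (ew (g (gpair z y)).1).
      rewrite !w1 !sh_mapE; have := Kg (gpair z y); case: (g _) => x y' /= [e1 e2]; subst y'.
      by rewrite e1.
  rewrite (mbase _ p) (pnorm_tr H _ dpw) -!mres_comp; congr mtr; congr pnorm; congr mres.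
  by apply: gmap_eq => u; apply: w1.
by have [k [kE _]] := (proj2 (nnU S M)) _ _ np; exists k => T m; apply: kE.
Qed.

(** Translating by [x] and then restricting to the diagonal of [S × S] gives [m0] for [x = o] and
    one for every other [x]; the product over the trivial set is therefore [m0]. *)
Lemma orbit_retract : exists k : nx S M S -> M S,
  forall (m : M (S ** S)) m0, m = gcm_ext (gfork (gid S) (gid S)) m0 -> k (nn m) = m0.
Proof.
have [k kE] := kappa_ex.
pose D := gfork (gid S) (gid S); have DI : injective D by move=> x y [].
exists (fun z => mres M D (k S z)) => m m0 ->.
rewrite kE -pnorm_res -mres_comp.
pose i : gmap S (Str ** S) := @GMap gT S (Str ** S) (fun x => gpair (o : Str) x) (fun _ _ => erefl).
have o1 x : gact S x (tr_elt o) = x.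
  by have [b <-] := tr_o x; rewrite sh_swap.
have iI : injective i by move=> x y [].
rewrite (gcm_ext_res H (a := gid S) (i' := i) m0 DI); last first.
  apply: is_pbI => [x|x [y z] [e1 e2]|x y ? []] //.
    by rewrite /= o1.
  subst z; exists x; split=> //; congr pair.
  have [b eb] := tr_o x; move: e1; rewrite /= -eb sh_swap => /(can_inj (actK _ _)) //.
rewrite mres_id.
pose c1 : gmap (gpt gT) Str := gtriv_map gT (fun _ : unit => o).
pose c2 : gmap (gtriv gT {x : S | x != o}) Str := gtriv_map gT (fun u : {x : S | x != o} => val u).
have cop : is_cop c1 c2.
  split=> [[] []|u v /val_inj|[] u /esym/eqP|x] //; first by rewrite (negbTE (valP u)).
  have [->|nx] := eqVneq (x : S) o; first by left; exists tt.
  by right; exists (exist _ x nx).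
rewrite (pnorm_cop H _ cop) pnorm_pt -mres_comp.
rewrite (_ : gcomp (c1 ⊠ gid S) _ = i); last exact: gmap_eq.
rewrite gcm_ext_on // (gcm_ext_off H _ iI) ?pnorm_one; last first.
  by move=> [[x xo] y] z [ex _]; move: xo; rewrite ex eqxx.
by rewrite gcm_mulC gcm_mul1.
Qed.

(** Apply [nn_graph] to the extension of [m0] by one along the diagonal. Its norm over [Y] is again
    such an extension, and the retraction recovers both elements from the same generator. *)
Lemma norm_section_orbit Y (s : gmap S Y) (m0 : M S) : pnorm (gcm_ext (gfork s (gid S)) m0) = m0.
Proof.
have [k kE] := orbit_retract.
pose D := gfork (gid S) (gid S); have DI : injective D by move=> x y [].
have sI V (f : gmap V Y) : injective (gfork f (gid V)) by move=> x y [].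
have := nn_graph s (gcm_ext D m0); set m' := pnorm _ => e.
have em' : m' = gcm_ext D (pnorm (gcm_ext (gfork s (gid S)) m0)).
  apply: gcm_ext_eq => // [|U c cP]; rewrite /m' -pnorm_res.
  - congr pnorm; rewrite -[in RHS](gcm_ext_on H m0 DI); apply: gcm_ext_res => //.
    by apply: is_pbI => [x|[u v] [y x] [<- -> ->]|x x' _ []] //; exists x.
  - rewrite (gcm_ext_res H (a := c) (i' := gfork (gcomp s (gcomp (gfst S S) c)) (gid U)) _ (sI _ _)).
      by rewrite (gcm_ext_off H _ DI cP) gcm_ext_one ?pnorm_one //; apply: sI.
    by apply: is_pbI => [x|u [y x] [<- ->]|x x' _ []] //; exists x.
by rewrite -[RHS](kE _ _ erefl) e em' (kE _ _ erefl).
Qed.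

End Orbit.

(** Split off one orbit and induct on the cardinal, since Mackey functors take disjoint unions to
    products. *)
Lemma mackey_orbit_eq X (a b : M X) :
  (forall S (o : S) (i : gmap S X), (forall x : S, exists g, gact S o g = x) ->
     mres M i a = mres M i b) -> a = b.
Proof.
move: {2}#|X| (leqnn #|X|) => n; elim: n X a b => [|n IHn] X a b.
  rewrite leqn0 => /eqP/card0_eq X0 _; apply: mvoid_eq => x; by have := X0 x.
move=> cX H0; case: (pickP (predT : pred X)) => [o _|X0]; last first.
  by apply: mvoid_eq => x; have := X0 x.
pose P : pred X := fun x => [exists g, gact X o g == x].
have Pi x g : P (gact X x g) = P x.
  apply/existsP/existsP => -[h /eqP e].
    by exists (h * g^-1)%g; rewrite actM e actK.
  by exists (h * g)%g; rewrite actM e.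
have Po : P o by apply/existsP; exists 1%g; rewrite act1.
apply: (madd_inj (gincl_is_cop Pi)).
- apply: (H0 _ (gsubmk Pi Po)) => x; have /existsP[g /eqP e] := ginclP x.
  by exists g; apply: val_inj; rewrite /= e.
- apply: IHn => [|S s i tr].
    rewrite -ltnS; apply: leq_trans cX; rewrite card_sig -(cardC P) -add1n.
    by rewrite leq_add2r; apply/card_gt0P; exists o.
  by rewrite -!mres_comp; apply: (H0 _ s).
Qed.

Hypothesis abel : forall a b : gT, (a * b = b * a)%g.

Lemma norm_section S Y (s : gmap S Y) (m : M S) : pnorm (gcm_ext (gfork s (gid S)) m) = m.
Proof.
apply: mackey_orbit_eq => O o i tr; rewrite -pnorm_res.
rewrite (gcm_ext_res H (a := i) (i' := gfork (gcomp s i) (gid O))); last 2 first.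
- by move=> x y [].
- by apply: is_pbI => [x|u [y x] [<- ->]|x x' _ []] //; exists x.
exact: (norm_section_orbit abel tr).
Qed.

Lemma norm_embed X V W (i : gmap W V) (x : gmap W X) m : injective i ->
  pnorm (gcm_ext (gfork x i) m) = gcm_ext i m.
Proof. by move=> iI; rewrite pnorm_ext // norm_section. Qed.

Lemma mres_bij_ext W V V' (f : gmap V' V) (i : gmap W V) (i' : gmap W V') m :
  bijective f -> injective i -> gcomp f i' = i -> mres M f (gcm_ext i m) = gcm_ext i' m.
Proof.
move=> fb iI e; rewrite (gcm_ext_res H (a := gid W) (i' := i') m iI) ?mres_id //.
have E w : f (i' w) = i w by rewrite -e.
apply: is_pbI => [w|w v e1|w w' //]; first by rewrite E.
by exists w; split=> //; apply: (bij_inj fb); rewrite E.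
Qed.

(** Each extension may be replaced by the norm, over the other auxiliary set, of an extension along
    both embeddings, by [norm_embed]; Fubini and the symmetry of [X × X'] then identify the two
    sides. *)
Lemma norm_indep X X' Y W (x : gmap W X) (x' : gmap W X') (y : gmap W Y) m :
  injective (gfork x y) -> injective (gfork x' y) ->
  pnorm (gcm_ext (gfork x y) m) = pnorm (gcm_ext (gfork x' y) m).
Proof.
move=> I I'; rewrite -(norm_embed x' m I) -(norm_embed x m I') -!pnorm_N.
have J : injective (gfork (gfork x x') y) by move=> u v [e1 _ e2]; apply: I; rewrite /= e1 e2.
have J' : injective (gfork (gfork x' x) y) by move=> u v [_ e1 e2]; apply: I; rewrite /= e1 e2.
rewrite (mres_bij_ext _ (i' := gfork (gfork x x') y)); first last.
- exact: gmap_eq.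
- by move=> u v [_ e1 e2]; apply: I; rewrite /= e1 e2.
- by exists (greassocV X X' Y); [apply: greassocK|apply: greassocVK].
rewrite (mres_bij_ext _ (i' := gfork (gfork x' x) y)); first last.
- exact: gmap_eq.
- by move=> u v [_ e1 e2]; apply: I'; rewrite /= e1 e2.
- by exists (greassocV X' X Y); [apply: greassocK|apply: greassocVK].
have cb : bijective (gprodC X' X) by exists (gprodC X X') => -[].
have cb' : bijective (gprodC X' X ⊠ gid Y) by exists (gprodC X X' ⊠ gid Y) => -[[]].
rewrite -(pnorm_bij H _ cb); congr pnorm; apply: mres_bij_ext => //; exact: gmap_eq.
Qed.

(** ** The norm of a map *)

Definition gcm_norm X Y (f : gmap X Y) (m : M X) : M Y := pnorm (gcm_ext (gfork (gid X) f) m).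

Lemma graphI X Y (f : gmap X Y) : injective (gfork (gid X) f).
Proof. by move=> x y []. Qed.

Lemma gcm_normE X Y X' (f : gmap X Y) (x : gmap X X') m : injective (gfork x f) ->
  gcm_norm f m = pnorm (gcm_ext (gfork x f) m).
Proof. by move=> I; apply: norm_indep => //; apply: graphI. Qed.

Lemma gcm_norm_id X (m : M X) : gcm_norm (gid X) m = m.
Proof. exact: norm_section. Qed.

(** The iterated norm is a norm over [Y × X] of the extension along another embedding of [X] over
    [Z], so independence applies. *)
Lemma gcm_norm_comp X Y Z (f : gmap Y Z) (g : gmap X Y) m : gcm_norm (gcomp f g) m = gcm_norm f (gcm_norm g m).
Proof.
have gI := @graphI _ _ g; have fI := @graphI _ _ f.
have I : injective (gfork (gid X) (gfork g (gcomp f g))) by move=> x y [].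
have -> : gcm_norm f (gcm_norm g m) = pnorm (pnorm (gcm_ext (gfork (gid X) (gfork g (gcomp f g))) m)).
  congr pnorm; apply: esym; apply: gcm_ext_eq => // [|U c cP]; rewrite -pnorm_res.
  - congr pnorm; rewrite -[in RHS](mres_id m); apply: gcm_ext_res => //.
    by apply: is_pbI => [x|x [x' y] /= [<- <-]|x x' /=] //; exists x.
  - rewrite (gcm_ext_off H _ I) ?pnorm_one // => -[x u] w [_].
    exact: (cP u (g w)).
rewrite -pnorm_N (mres_bij_ext _ (i' := gfork (gfork g (gid X)) (gcomp f g))) //.
- by apply: gcm_normE => x y [].
- by exists (greassocV Y X Z); [apply: greassocK|apply: greassocVK].
- exact: gmap_eq.
Qed.

(** The graph of [f] pulls back to the embedding [(a, b)] of [W] over [Y], not to the graph of [b];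
    independence of the embedding closes the gap. *)
Lemma gcm_norm_base W X Y Z (a : gmap W X) (b : gmap W Y) (f : gmap X Z) (g : gmap Y Z) m :
  is_pb a b f g -> mres M g (gcm_norm f m) = gcm_norm b (mres M a m).
Proof.
move=> p; rewrite /gcm_norm -pnorm_res.
have I : injective (gfork a b) by move=> u v [] e1 e2; apply: (pb_eq p).
rewrite (gcm_ext_res H (a := a) (i' := gfork a b)); last 2 first.
- exact: graphI.
- apply: is_pbI => [w|x [x' y] [<- e]|w w' _ []] //.
  + by rewrite /=; have [-> _] := p.
  + by have [w [<- <-]] := pb_ex p e; exists w.
  + by move=> e1 e2; apply: (pb_eq p).
by rewrite -(gcm_normE _ I).
Qed.

Lemma gcm_norm_mul X Y (f : gmap X Y) m m' : gcm_norm f (gcm_mul m m') = gcm_mul (gcm_norm f m) (gcm_norm f m').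
Proof. by rewrite /gcm_norm gcm_ext_mul ?pnorm_mul //; apply: graphI. Qed.

Lemma gcm_norm_one X Y (f : gmap X Y) : gcm_norm f (gcm_one X) = gcm_one Y.
Proof. by rewrite /gcm_norm gcm_ext_one ?pnorm_one //; apply: graphI. Qed.

(** The extension by one of a transfer along [p] is a transfer along [q], which is [p] over the
    graph of [f] and the identity over its complement. Sections of [q] at a point of [Y] are free on
    the fibre of [f] and forced elsewhere, so the dependent product of [p] along [f] is also one for
    [q] along [X × Y -> Y]. *)
Lemma gcm_norm_canonical X Y A (f : gmap X Y) (p : gmap A X) (s : M A) :
  gcm_norm f (mtr M p s) =
  mtr M (gdprod_proj f p) (gcm_norm (gexp_f' f p) (mres M (gexp_e f p) s)).
Proof.
pose Gf := gfork (gid X) f; pose c := gcompl Gf; set V := gsub _ in c.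
pose h := gdprod_proj f p.
have fI := @graphI _ _ f; have cop := compl_cop fI.
pose q : gmap (gsum V A) (X ** Y) := gcopair c (gcomp Gf p).
have [a [a1 a2]] := madd_ex (gcm_one V) s (gsum_is_cop V A).
have eq : gcm_ext Gf (mtr M p s) = mtr M q a.
  apply: (@irel_cop _ (in_mackey M) _ _ _ _ _ _ _ p (ginl V A) (ginr V A) q _ _ (cop_sym cop) (gsum_is_cop _ _)).
  - exact: gmap_eq.
  - exact: gmap_eq.
  - by rewrite /= a1 (gcm_ext_off H _ fI) //; apply: compl_off.
  - by rewrite /= a2 gcm_ext_on.
pose w : gmap (gexp_pb f p) (X ** gdprod f p) := gfork (gpb1 f h) (gpb2 f h).
have wI : injective w by move=> u v [e1 e2]; apply: (gpb_inj (f := f) (g := h)).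
have copw := compl_cop wI.
(* A pair outside the pullback lies off the graph of [f], where the value of the section is
   forced. *)
have cP (u : gsub (off_im_inv w)) : off_im Gf ((gid X ⊠ h) (gcompl w u)).
  apply/negP => /codomP[x e]; have [e1 e2] : (gcompl w u).1 = x /\ h (gcompl w u).2 = f x.
    by have := congr1 fst e; have := congr1 snd e.
  have [v [v1 v2]] := gpb_mk (f := f) (g := h) (esym e2).
  by apply: (@compl_off _ _ _ w u v); rewrite [LHS]gpairP [RHS]gpairP; congr pair; rewrite ?e1; exact: esym.
have [e [ew ec]] := cop_map (gcomp (ginr V A) (gexp_e f p))
  (gcomp (ginl V A) (glift (f := gcomp (gid X ⊠ h) (gcompl w)) (off_im_inv Gf) cP)) copw.
have qe u : q (e u) = (gid X ⊠ h) u.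
  case: copw => _ _ _ cov; case: (cov u) => -[v <-].
    rewrite ew /=; case: v => -[x d] ed /=.
    rewrite gdprod_eval; congr (_, _); exact: (eqP ed).
  by rewrite ec.
have eP x d (E : f x = h d) : e (gpair x d) = inr (gexp_e f p (gexp_pt E)).
  by have := ew (gexp_pt E).
have dp : is_dpr q h e.
  apply: is_dprI => [x u|t s' sP|u v eh ee]; first by rewrite qe.
  - have ex x : f x = t -> exists b : A, s' x = inr b /\ p b = x.
      move=> ft; have := sP x; case: (s' x) => [v|b] /= e1.
        by case: (@compl_off _ _ _ Gf v x); apply: etrans e1 _; rewrite /= ft.
      by exists b; split=> //; have := congr1 fst e1.
    have [u [u1 u2]] := gdprod_mk (f := f) (p := p) (y := t) (s := fun x ft => sval (cid (ex x ft)))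
      (fun x ft => proj2 (svalP (cid (ex x ft)))).
    exists u; split=> // x; case: (pselect (f x = t)) => [ft|nft].
      have E : f x = h u by rewrite u1.
      by rewrite (eP _ _ E) (u2 x E ft); case: cid => b /= [->].
    have := sP x; have := qe (gpair x u).
    case: (s' x) => [v|b] /= E1 E2; last first.
      by case: nft; have := congr1 fst E2; have /= <- := congr1 snd E2 => /= ->.
    case: (e _) E1 => [v'|b'] /= E1.
      by congr inl; apply: (@gincl_inj _ _ _ (off_im_inv Gf)); rewrite [LHS]E1 [RHS]E2 -u1.
    have e1 : p b' = x := congr1 fst E1; have e2 : f (p b') = h u := congr1 snd E1.
    by case: nft; rewrite -u1 -e1.
  - apply: gdprod_ext => // x E E'; have := ee x; rewrite (eP _ _ E) (eP _ _ E').
    by case.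
rewrite /gcm_norm eq (pnorm_tr H _ dp); congr mtr.
(* The pullback embeds over the dependent product by its projection to [X], and this embedding may
   replace the graph of [gexp_f']. *)
have I : injective (gfork (gpb1 f h) (gexp_f' f p)) by apply: wI.
rewrite -/(gcm_norm _ _) (gcm_normE _ I); congr pnorm; apply: gcm_ext_eq => // [|U k kP].
- by rewrite -mres_comp -a2 -mres_comp; congr mres; apply: gmap_eq => u; apply: ew.
- have kP' u : off_im w (k u) by apply/negP => /codomP[v]; apply: kP.
  have -> : k = gcomp (gcompl w) (glift (off_im_inv w) kP') by apply: gmap_eq.
  rewrite mres_comp -[mres M (gcompl w) _]mres_comp.
  have -> : gcomp e (gcompl w) = gcomp (ginl V A) (glift (f := gcomp (gid X ⊠ h) (gcompl w)) (off_im_inv Gf) cP).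
    by apply: gmap_eq => u; apply: ec.
  by rewrite mres_comp a1 !gcm_one_res.
Qed.

Lemma pb_iso X X' Y Y' (iX : @iso (GSet gT) X X') (iY : @iso (GSet gT) Y Y')
    (f : gmap X Y) (f' : gmap X' Y') :
  gcomp (iso_fun iY) f = gcomp f' (iso_fun iX) -> is_pb (iso_fun iX : gmap X X') f f' (iso_fun iY).
Proof.
move=> e; have E x : (iso_fun iY : gmap _ _) (f x) = f' ((iso_fun iX : gmap _ _) x).
  exact: (congr1 (fun h : gmap _ _ => h x) e).
apply: is_pbI => [x|x' y e'|x x' e1 _]; first by rewrite E.
- exists ((iso_inv iX : gmap _ _) x'); split; first exact: (giso_cancel (iso_sym iX)).
  apply: (can_inj (giso_cancel iY)); rewrite E -e'; congr (f' _).
  exact: (giso_cancel (iso_sym iX)).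
- exact: (can_inj (giso_cancel iX)).
Qed.

(** The comparison squares of an isomorphism of diagrams are pullbacks, so base change carries the
    canonical formula over. *)
Lemma gcm_norm_exponential X Y A X' Y' (p : gmap A X)
      (e : gmap X' A) (f' : gmap X' Y') (h : gmap Y' Y) (f : gmap X Y) :
    is_exponential p e f' h f -> forall s : M A,
    gcm_norm f (mtr M p s) = mtr M h (gcm_norm f' (mres M e s)).
Proof.
move=> [X0 [Y0 [A0 [f0 [p0 [iX [iY [iA [iX' [iY' [ep ee ef' eh ef]]]]]]]]]]] s.
pose s0 := mres M (iso_inv iA : gmap A0 A) s.
have es : s = mres M (iso_fun iA : gmap A A0) s0.
  rewrite /s0 -mres_comp (_ : gcomp _ _ = gid A) ?mres_id //.
  by apply: gmap_eq => a /=; apply: giso_cancel.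
rewrite es -(mbase _ (pb_iso (iX := iA) (iY := iX) ep)).
rewrite -(gcm_norm_base _ (pb_iso (iX := iX) (iY := iY) ef)) gcm_norm_canonical.
rewrite (mbase _ (pb_iso (iX := iY') (iY := iY) eh)).
rewrite (gcm_norm_base _ (pb_iso (iX := iX') (iY := iY') ef')) -!mres_comp.
by have -> : gcomp (iso_fun iA : gmap A A0) e = gcomp (gexp_e f0 p0) (iso_fun iX') by exact: ee.
Qed.

Definition gcm_tambara : tambara gT.
Proof.
apply: (@Tambara gT M gcm_mul gcm_one gcm_norm).
- by move=> X a b c; apply: gcm_mul_addl.
- split.
  + by move=> X; apply: gcm_mulA.
  + by move=> X; apply: gcm_mulC.
  + by move=> X; apply: gcm_mul1.
  + by move=> X Y f a b; apply: gcm_mul_res.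
  + by move=> X Y f; apply: gcm_one_res.
  + by move=> X Y f a b; apply: gcm_norm_mul.
  + by move=> X Y f; apply: gcm_norm_one.
  + by move=> X s; apply: mres_id.
  + by move=> X Y Z f g s; apply: mres_comp.
  + by move=> X s; apply: gcm_norm_id.
  + by move=> X Y Z f g s; apply: gcm_norm_comp.
  + by move=> W X Y Z a b f g /pullback_is_pb p s; apply: gcm_norm_base.
  + exact: (ma_additive (mackeyP M)).
- exact: gcm_norm_exponential.
Defined.

End GraphNorm.

Theorem theorem1p1 (p : nat) (gT : finGroupType)
    (p_prime : prime p) (gcm_hom_cyclic : cyclic [set: gT])
    (gcm_hom_pgroup : pgroup p [set: gT]) :
  inhabited (box_product gT) /\
  forall B : box_product gT,
  exists T : gsymmon gT (box_sm B),
  forall M : mackey gT, is_gcm T M <-> has_tambara_structure M.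
Proof.
split=> [|B]; first exact: box_product_exists.
have abel (a b : gT) : (a * b = b * a)%g.
  by have /centsP := cyclic_abelian gcm_hom_cyclic; apply; rewrite inE.
exists (norm_gsymmon B) => M; split=> [[H]|[R <-]]; last exact: tambara_gcm.
by exists (gcm_tambara H abel).
Qed.
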